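(* Let $\delta\ge0$. Then, as $n\to\infty$, in the space $M_p((0,\infty])$ of Radon point measures on $(0,\infty]$ with the vague topology, $$\sum_{i=1}^n\epsilon_{D^A_i(n)/n^{1/(2+\delta)}}\Rightarrow\sum_{i=1}^\infty\epsilon_{\sigma_i e^{-T^A_i}/W_A^{1/(2+\delta)}},\qquad \sum_{i=1}^n\epsilon_{D^B_i(n)/n^{1/(2+\delta)}}\Rightarrow\sum_{i=1}^\infty\epsilon_{\sigma_i e^{-T^B_{i-1}}/W_B^{1/(2+\delta)}},$$ where $D^A_i(n)$ (resp. $D^B_i(n)$) is the degree of node $v_i$ in $G(n)$ under Model A (resp. Model B).
   Context: $\epsilon_x$ denotes the Dirac (point) measure at $x$; $\Rightarrow$ denotes weak convergence. Model A: $G(1)$ consists of a single node $v_1$ with a self loop (degree 2; a self loop contributes 2 to the degree). For $n\ge1$, given $G(n)$, add node $v_{n+1}$ and an edge joining it to $v_i$, $1\le i\le n$, chosen with probability $\frac{D_i(n)+\delta}{(2+\delta)n}$. Model B: $G(1)$ as in Model A; for $n\ge1$, either add $v_{n+1}$ with an edge to $v_i$ with probability $\frac{D_i(n)+\delta}{(2+\delta)n+1+\delta}$, $1\le i\le n$, or add $v_{n+1}$ with a self loop with probability $\frac{1+\delta}{(2+\delta)n+1+\delta}$. B.I. processes: $\{BI_i(t):t\ge0\}_{i\ge1}$ independent continuous-time Markov pure-jump processes on the integers with rate $q_{j,j+1}=j+\delta$, $BI_1(0)=2$, $BI_i(0)=1$ for $i\ge2$; $\tau^{(i)}_k$ is the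 $k$-th jump time of $BI_i$. $T^A_1=0$, $T^A_{n+1}:=\min\{T^A_i+\tau^{(i)}_k: k\ge1,\ 1\le i\le n,\ T^A_i+\tau^{(i)}_k>T^A_n\}$; $T^B_0=T^B_1=0$, $T^B_{n+1}:=\min\{T^B_{i-1}+\tau^{(i)}_k: k\ge1,\ 1\le i\le n+1,\ T^B_{i-1}+\tau^{(i)}_k>T^B_n\}$. $W_A:=\lim_n n e^{-(2+\delta)T^A_n}$, $W_B:=\lim_n ne^{-(2+\delta)T^B_n}$ and $\sigma_i:=\lim_{t\to\infty}e^{-t}BI_i(t)$ (almost sure limits); the $\sigma_i$ are independent with $\sigma_1\sim\mathrm{Gamma}(2+\delta,1)$, $\sigma_i\sim\mathrm{Gamma}(1+\delta,1)$ for $i\ge2$. *)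

(* Defs.v *)
From HB Require Import structures.
From mathcomp Require Import all_boot all_order all_algebra.
From mathcomp Require Import all_classical all_reals all_analysis.
Set Implicit Arguments. Unset Strict Implicit. Unset Printing Implicit Defensive.
Import Order.TTheory GRing.Theory Num.Theory.
Import numFieldNormedType.Exports.
Local Open Scope classical_set_scope.
Local Open Scope ring_scope.

Section Defs.
Variable R : realType.

(* A run of the graph process is encoded by its choice sequence [c]:
   [c m] (m >= 1) is the index of the node the edge of v_(m+1) is attached to.
   In Model B, [c m = m+1] encodes "v_(m+1) arrives with a self loop".
   [deg c n i] = D_i(n), the degree of v_i in G(n) (1-based node indices). *)
Fixpoint deg (c : nat -> nat) (n i : nat) : nat :=
  match n with
  | 0 => 0
  | m.+1 => if m is 0 then (if i == 1 then 2 else 0)%N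
            else (deg c m i + (c m == i) + (i == m.+1))%N
  end.

(* one-step transition probability of Model A at step k (G(k) -> G(k+1)) *)
Definition pA (delta : R) (s : nat -> nat) (k : nat) : R :=
  if (1 <= s k <= k)%N then ((deg s k (s k))%:R + delta) / ((2 + delta) * k%:R)
  else 0.

Definition pB (delta : R) (s : nat -> nat) (k : nat) : R :=
  if (1 <= s k <= k)%N then
    ((deg s k (s k))%:R + delta) / ((2 + delta) * k%:R + 1 + delta)
  else if s k == k.+1 then (1 + delta) / ((2 + delta) * k%:R + 1 + delta)
  else 0.

Definition mutually_independent d (Omega : measurableType d)
  (P : probability Omega R) (I : eqType) (ok : I -> Prop)
  (Y : I -> Omega -> R) : Prop :=
  forall (J : seq I) (B : I -> set R), uniq J -> (forall j, j \in J -> ok j) ->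
    (forall j, measurable (B j)) ->
    P (\big[setI/setT]_(j <- J) (Y j @^-1` B j)) =
    (\prod_(j <- J) fine (P (Y j @^-1` B j)))%:E.

Definition exp_distributed d (Omega : measurableType d)
  (P : probability Omega R) (rate : R) (Y : Omega -> R) : Prop :=
  forall t : R, 0 <= t -> P [set w | t < Y w] = (expR (- (rate * t)))%:E.

Definition BI_start (i : nat) : nat := if i == 1 then 2%N else 1%N.

(* rate of the k-th jump (k >= 1) of BI_i: current state is BI_start i + k - 1 *)
Definition BI_rate (delta : R) (i k : nat) : R :=
  (BI_start i + k.-1)%:R + delta.

Definition jump_time (E : nat -> nat -> R) (i k : nat) : R :=
  \sum_(1 <= j < k.+1) E i j.

Definition BI (tau : nat -> nat -> R) (i : nat) (t : R) : R :=
  (BI_start i)%:R + fine (\sum_(1 <= k <oo) (((tau i k <= t)%R)%:R)%:E)%E.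

Definition sigma (tau : nat -> nat -> R) (i : nat) : R :=
  lim (expR (- t) * BI tau i t @[t --> +oo]).

Definition next_time (tau : nat -> nat -> R) (s : seq R) : R :=
  inf [set r | exists i k, [/\ (1 <= i <= size s)%N, (1 <= k)%N,
                  r = nth 0 s i.-1 + tau i k & last 0 s < r]].

(* [TAs tau n] = [:: T^A_1; ...; T^A_(n+1)] *)
Fixpoint TAs (tau : nat -> nat -> R) (n : nat) : seq R :=
  match n with
  | 0 => [:: 0]
  | m.+1 => let s := TAs tau m in rcons s (next_time tau s)
  end.
(* T^A_n for n >= 1 *)
Definition TA (tau : nat -> nat -> R) (n : nat) : R := nth 0 (TAs tau n.-1) n.-1.

(* [TBs tau n] = [:: T^B_0; T^B_1; ...; T^B_(n+1)] *)
Fixpoint TBs (tau : nat -> nat -> R) (n : nat) : seq R :=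
  match n with
  | 0 => [:: 0; 0]
  | m.+1 => let s := TBs tau m in rcons s (next_time tau s)
  end.
Definition TB (tau : nat -> nat -> R) (n : nat) : R := nth 0 (TBs tau n.-1) n.

Definition WA (delta : R) (tau : nat -> nat -> R) : R :=
  lim (n%:R * expR (- ((2 + delta) * TA tau n)) @[n --> \oo]).
Definition WB (delta : R) (tau : nat -> nat -> R) : R :=
  lim (n%:R * expR (- ((2 + delta) * TB tau n)) @[n --> \oo]).

(* the point measure sum_i eps_(x i), restricted to (0,+oo]
   (points outside (0,+oo] are discarded) *)
Definition ptm (x : nat -> \bar R) : set (\bar R) -> \bar R :=
  fun A => (\sum_(i <oo) (\1_(A `&` [set y | (0 < y)%E]) (x i))%:E)%E.

(* Radon: finitely many points in every compact [eps, +oo], eps > 0 *)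
Definition radon_points (x : nat -> \bar R) : Prop :=
  forall eps : R, 0 < eps -> finite_set [set i | (eps%:E <= x i)%E].

Definition CKplus (f : \bar R -> R) : Prop :=
  (forall y, 0 <= f y) /\
  (exists2 eps : R, 0 < eps & forall y, (y < eps%:E)%E -> f y = 0) /\
  (forall y : \bar R, (0 < y)%E -> {for y, continuous f}).

Definition pm_int (x : nat -> \bar R) (f : \bar R -> R) : \bar R :=
  (\sum_(i <oo) (f (x i))%:E)%E.

Definition vague_cvg (xs : nat -> nat -> \bar R) (x : nat -> \bar R) : Prop :=
  forall f, CKplus f -> pm_int (xs n) f @[n --> \oo] --> pm_int x f.

(* bounded continuous functionals on M_p((0,+oo]) with the vague topology
   (M_p is metrizable, so sequential continuity = continuity) *)
Definition bounded_vague_continuous (F : (set (\bar R) -> \bar R) -> R) : Prop :=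
  (exists C : R, forall mu, `|F mu| <= C) /\
  (forall xs x, radon_points x -> (forall n, radon_points (xs n)) ->
     vague_cvg xs x -> F (ptm (xs n)) @[n --> \oo] --> F (ptm x)).

Definition power_scale (delta : R) (a : R) : R := a `^ (2 + delta)^-1.

Definition degree_points (delta : R) (c : nat -> nat) (n : nat) : nat -> \bar R :=
  fun i => if (1 <= i <= n)%N then
             ((deg c n i)%:R / power_scale delta n%:R)%:E else 0%E.

Definition limit_points (delta : R) (tau : nat -> nat -> R) (T : nat -> R) (W : R)
  : nat -> \bar R :=
  fun i => if (1 <= i)%N then
             (sigma tau i * expR (- T i) / power_scale delta W)%:E else 0%E.

End Defs.

(* Main.v *)
Require Import Defs.
From HB Require Import structures.
From mathcomp Require Import all_boot all_order all_algebra.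
From mathcomp Require Import all_classical all_reals all_analysis.
From mathcomp Require Import measurable_realfun.
From mathcomp Require Import ring lra zify.
Set Implicit Arguments.
Unset Strict Implicit.
Unset Printing Implicit Defensive.
Import Order.TTheory GRing.Theory Num.Theory.
Import numFieldNormedType.Exports.
Local Open Scope classical_set_scope.
Local Open Scope ring_scope.

(* Both graph processes are realised on the space of the birth-immigration
   processes: by lack of memory of competing exponential clocks, the index of the
   process that jumps at the n-th event time attaches v_(n+1) with the prescribed
   probabilities, and the waiting times between events are independent exponentials
   with rates Lam n = (2+delta)n + b(1+delta), where b = 0 in Model A, 1 in Model B.
   A sum of independent exponentials with rates a k + c, recentred by (ln n)/a,
   converges almost surely (second moments along cubes, then monotonicity). Applied
   to the waiting times this gives W in (0, oo), and applied to the holding times of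
   BI_i it gives sigma_i > 0, so each D_i(n)/n^(1/(2+delta)) converges almost surely.
   Rising factorials of the degree, divided by their mean growth, are nonnegative
   martingales; the maximal inequality and Borel-Cantelli show that late nodes
   contribute nothing above any positive level, which upgrades the coordinatewise
   limits to vague convergence. Bounded convergence concludes. *)

(** * Competing exponential clocks *)

(** The decisive fact is that the total jump rate is not random: each event raises one state by one
    and starts one new process, so after any history the running rates add up to [Lam n]. Hence the
    waiting times are independent of the choices, and the event times are sums of independent
    exponentials with known rates. Conditioning is avoided throughout. Lack of memory is expressed
    by joint tails on the event that a given finite history has been realised, and the martingale
    estimate is proved on the cylinder of a given history. There are only countably many finite
    histories, and this settles measurability and null sets. The given processes live on spaces of
    their own. A functional of the degrees at time n reads finitely many choices, so its integral
    depends only on cylinder probabilities and can be moved to the space of the clocks, where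
    convergence is almost sure. The order p of the rising factorials is chosen with p / (2 + delta)
    >= 2, so that the probability that node i ever exceeds a fixed level is O(i^-2), hence
    summable. *)

Lemma expR_opp_ge (R : realType) (x : R) : 1 - x <= expR (- x).
Proof. exact: expR_ge1Dx. Qed.

Lemma one_sub_expR_ge (R : realType) (x : R) : 0 < x ->
  x / (1 + x) <= 1 - expR (- x).
Proof.
move=> x0; have x1 : 0 < 1 + x by lra.
rewrite expRN lerBrDl -lerBrDr.
have -> : 1 - x / (1 + x) = (1 + x)^-1 by field; lra.
by rewrite lef_pV2 ?posrE ?expR_gt0// expR_ge1Dx.
Qed.

Lemma one_sub_expR_gt0 (R : realType) (x : R) : 0 < x -> 0 < 1 - expR (- x).
Proof. by move=> x0; rewrite subr_gt0 expR_lt1 oppr_lt0. Qed.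

Lemma nneseries_geometric (R : realType) (c z : R) : 0 <= c -> 0 <= z -> z < 1 ->
  (\sum_(k <oo) (c * z ^+ k)%:E = (c / (1 - z))%:E)%E.
Proof.
move=> c0 z0 z1; apply/cvg_lim => //.
have -> : (fun n => \sum_(0 <= k < n) (c * z ^+ k)%:E)%E =
   EFin \o series (geometric c z).
  by apply/funext => n /=; rewrite /series/= sumEFin.
apply: cvg_EFin; first by apply: nearW.
by apply: cvg_geometric_series; rewrite ger0_norm.
Qed.

(** Lets the mesh [h] of a Riemann sum go to zero without taking a limit. *)
Lemma eq_of_linear_bound (R : realType) (x z C : R) : 0 <= C ->
  (forall h, 0 < h -> z - C * h <= x <= z + C * h) -> x = z.
Proof.
move=> C0 xz; have C1 : 0 < C + 1 by lra.
have aux e : 0 < e -> C * (e / (C + 1)) <= e.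
  move=> e0; have E : C * (e / (C + 1)) + e / (C + 1) = e by field; lra.
  by have := divr_gt0 e0 C1; lra.
apply/eqP; rewrite eq_le; apply/andP; split; apply/ler_addgt0Pr => e e0.
  have /andP[_ h2] := xz _ (divr_gt0 e0 C1).
  by apply: (le_trans h2); rewrite lerD2l aux.
have /andP[h1 _] := xz _ (divr_gt0 e0 C1).
by have := aux _ e0; lra.
Qed.

Section Survival.
Context d (T : measurableType d) (R : realType) (P : probability T R) (I : eqType).
Implicit Types (H : set T) (Y : I -> T -> R) (lam t : I -> R) (J A : seq I).

Definition above Y t J : set T := [set w | forall j, j \in J -> t j < Y j w].

(** On an event [H] of probability [p], the variables indexed by [ok] are independent exponentials
    with rates [lam]. Joint tails avoid dividing by [p], and the form is reproduced by
    [survival_min], so it can be iterated. *)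
Definition survival H (p : R) (ok : I -> Prop) lam Y :=
  forall J t, uniq J -> (forall j, j \in J -> ok j) -> (forall j, 0 <= t j) ->
  P (H `&` above Y t J) = (p * \prod_(j <- J) expR (- (lam j * t j)))%:E.

Lemma measurable_gtr (f g : T -> R) :
  measurable_fun setT f -> measurable_fun setT g -> measurable [set w | f w < g w].
Proof.
move=> mf mg; have := measurable_fun_ltr mf mg measurableT.
by move=> /(_ [set true] Logic.I); rewrite setTI preimage_true.
Qed.

Lemma above_cons Y t j J : above Y t (j :: J) = [set w | t j < Y j w] `&` above Y t J.
Proof.
apply/seteqP; split => w /=.
  by move=> h; split; [apply: h; rewrite mem_head|move=> i iJ; apply: h; rewrite inE iJ orbT].
by move=> [h1 h2] i; rewrite inE => /predU1P[->//|]; exact: h2.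
Qed.

Lemma measurable_above Y t J : (forall i, measurable_fun setT (Y i)) ->
  measurable (above Y t J).
Proof.
move=> mY; elim: J => [|j J ih].
  by rewrite (_ : above _ _ _ = setT)//; apply/seteqP; split.
rewrite above_cons; apply: measurableI => //.
by apply: measurable_gtr => //; exact: measurable_cst.
Qed.

Lemma eq_above Y t1 t2 J : {in J, t1 =1 t2} -> above Y t1 J = above Y t2 J.
Proof.
by move=> e; apply/seteqP; split => w h j jJ; have := h j jJ; rewrite e.
Qed.

Lemma survival_strip H p ok lam Y a x y K th :
  measurable H -> (forall i, measurable_fun setT (Y i)) ->
  survival H p ok lam Y -> ok a -> 0 <= x -> x <= y ->
  a \notin K -> uniq K -> (forall j, j \in K -> ok j) -> (forall j, 0 <= th j) ->
  P (H `&` [set w | x < Y a w <= y] `&` above Y th K) =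
  (p * (expR (- (lam a * x)) - expR (- (lam a * y))) *
   \prod_(j <- K) expR (- (lam j * th j)))%:E.
Proof.
move=> mH mY sv oka x0 xy aK uK okK th0.
pose T1 z i := if i == a then z else th i.
have eT z : 0 <= z -> H `&` [set w | z < Y a w] `&` above Y th K =
    H `&` above Y (T1 z) (a :: K).
  move=> z0; rewrite above_cons setIA /T1 eqxx; congr (_ `&` _).
  by apply: eq_above => i iK; case: eqP => // ia; move: aK; rewrite -ia iK.
have PT z : 0 <= z -> P (H `&` [set w | z < Y a w] `&` above Y th K) =
    (p * expR (- (lam a * z)) * \prod_(j <- K) expR (- (lam j * th j)))%:E.
  move=> z0; rewrite eT// sv//=; last 3 first.
  - by rewrite aK.
  - by move=> j; rewrite inE => /predU1P[->//|]; exact: okK.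
  - by move=> j; rewrite /T1; case: ifP.
  rewrite big_cons /T1 eqxx mulrA; congr (_ * _)%:E.
  apply: eq_big_seq => i iK; case: eqP => // ia; by move: aK; rewrite -ia iK.
have mZ z : measurable (H `&` [set w | z < Y a w] `&` above Y th K).
  apply: measurableI; last exact: measurable_above.
  by apply: measurableI => //; apply: measurable_gtr => //; exact: measurable_cst.
have -> : H `&` [set w | x < Y a w <= y] `&` above Y th K =
  (H `&` [set w | x < Y a w] `&` above Y th K) `\`
  (H `&` [set w | y < Y a w] `&` above Y th K).
  apply/seteqP; split => w /=.
    move=> [[Hw /andP[h1 h2]] h3]; split => // -[[_ h4] _].
    by move: h2; rewrite leNgt h4.
  move=> [[[Hw h1] h3] h2]; split => //; split => //; rewrite h1/= leNgt.
  by apply/negP => h4; apply: h2.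
rewrite measureD//=; last by rewrite PT// ltry.
rewrite PT//.
rewrite setIidr; last first.
  by move=> w [[Hw h1] h2]; split => //; split => //; exact: le_lt_trans h1.
by rewrite PT ?(le_trans x0)// -EFinB; congr EFin; ring.
Qed.

Lemma survival_ge0 H p ok lam Y : survival H p ok lam Y -> 0 <= p.
Proof.
move=> sv; have e : P (H `&` above Y (fun=> 0) [::]) = p%:E.
  by rewrite sv// big_nil mulr1.
by rewrite -lee_fin -e.
Qed.

Lemma big_mem_filter (S : Type) (idx : S) (op : Monoid.com_law idx) K J (f : I -> S) :
  uniq K -> uniq J -> {subset J <= K} ->
  \big[op/idx]_(i <- K) (if i \in J then f i else idx) = \big[op/idx]_(i <- J) f i.
Proof.
move=> uK uJ JK; rewrite -big_mkcond -big_filter; apply: perm_big.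
apply: uniq_perm => //; first exact: filter_uniq.
by move=> i; rewrite mem_filter; case: (boolP (i \in J)) => //= /JK.
Qed.

(* Riemann sums: cutting the range of [Y a] into cells of length [h] squeezes
   the probability between two geometric series, both tending to the value. *)
Lemma survival_min H p ok lam Y A a (v : R) :
  measurable H -> (forall i, measurable_fun setT (Y i)) ->
  survival H p ok lam Y -> (forall i, ok i -> 0 < lam i) ->
  uniq A -> (forall i, i \in A -> ok i) -> a \in A -> 0 <= v ->
  survival (H `&` [set w | v < Y a w /\ forall i, i \in A -> i != a -> Y a w < Y i w])
    (p * (lam a / (\sum_(i <- A) lam i) * expR (- ((\sum_(i <- A) lam i) * v))))
    (fun i => ok i /\ i != a) lam
    (fun i w => if i \in A then Y i w - Y a w else Y i w).
Proof.
move=> mH mY sv lam0 uA okA aA v0 J t uJ okJ t0.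
set L := \sum_(i <- A) lam i.
have la0 : 0 < lam a by apply/lam0/okA.
have LE : L = lam a + \sum_(i <- A | i != a) lam i by rewrite /L (bigD1_seq a).
have L'0 : 0 <= \sum_(i <- A | i != a) lam i.
  by rewrite big_seq_cond sumr_ge0// => i /andP[iA _]; apply/ltW/lam0/okA.
have L0 : 0 < L by rewrite LE; lra.
have p0 := survival_ge0 sv.
pose A' := [seq i <- A | i != a].
pose K := undup (A' ++ J).
have uK : uniq K by exact: undup_uniq.
have aJ : a \notin J by apply/negP => /okJ[_]; rewrite eqxx.
have aK : a \notin K by rewrite mem_undup mem_cat mem_filter eqxx/=.
have okK j : j \in K -> ok j.
  by rewrite mem_undup mem_cat mem_filter => /orP[/andP[_ /okA//]|/okJ[]].
(* [th z i] is the level that [Y i] must exceed when [Y a] equals [z]: competitors of [a] have to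
   survive [z] first. *)
pose t' i := if i \in J then t i else 0.
have t'0 i : 0 <= t' i by rewrite /t'; case: ifP.
pose th z i := t' i + (if i \in A' then z else 0).
have th0 z i : 0 <= z -> 0 <= th z i.
  by move=> z0; rewrite /th addr_ge0//; case: ifP.
set K0 := \prod_(j <- J) expR (- (lam j * t j)).
have K00 : 0 <= K0 by apply: prodr_ge0 => i _; exact: expR_ge0.
have prodK z : \prod_(j <- K) expR (- (lam j * th z j)) = K0 * expR (- ((L - lam a) * z)).
  transitivity (\prod_(j <- K) ((if j \in J then expR (- (lam j * t j)) else 1) *
                               (if j \in A' then expR (- (lam j * z)) else 1))).
    apply: eq_bigr => i _; rewrite /th /t'.
    by do 2 case: ifP => _; rewrite ?addr0 ?add0r ?mulr1 ?mul1r ?mulr0 ?oppr0 ?expR0//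
      mulrDr opprD expRD.
  have JK : {subset J <= K} by move=> i iJ; rewrite mem_undup mem_cat iJ orbT.
  have AK : {subset A' <= K} by move=> i iJ; rewrite mem_undup mem_cat iJ.
  rewrite big_split/= (big_mem_filter _ _ uK uJ JK).
  rewrite (big_mem_filter _ _ uK (filter_uniq _ uA) AK).
  congr (_ * _); rewrite -expR_sum; congr expR.
  by rewrite big_filter sumrN -mulr_suml LE addrAC subrr add0r.
(* [Y a] lies in the k-th cell, and the other variables clear the levels computed at its left end
   ([c] = 0, upper sum) or its right end ([c] = 1, lower sum). *)
pose B (c : R) (h : R) (k : nat) := H `&` [set w | v + k%:R * h < Y a w <= v + k.+1%:R * h] `&`
  above Y (th (v + (k%:R + c) * h)) K.
have mB c h k : measurable (B c h k).
  apply: measurableI; last exact: measurable_above.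
  apply: measurableI => //.
  have -> : [set w | v + k%:R * h < Y a w <= v + k.+1%:R * h] =
    [set w | v + k%:R * h < Y a w] `\` [set w | v + k.+1%:R * h < Y a w].
    apply/seteqP; split=> w /=; first by move=> /andP[-> ]; rewrite leNgt => /negP.
    by move=> [-> /negP]; rewrite -leNgt.
  by apply: measurableD; apply: measurable_gtr => //; exact: measurable_cst.
have PB c h k : 0 <= c -> 0 < h -> P (B c h k) =
   ((p * K0 * expR (- (L * v)) * (1 - expR (- (lam a * h))) * expR (- ((L - lam a) * (c * h))))
     * (expR (- (L * h))) ^+ k)%:E.
  move=> c0 h0.
  have k0 : 0 <= k%:R * h by rewrite mulr_ge0// ltW.
  have ckh : 0 <= (k%:R + c) * h by apply: mulr_ge0; [exact: addr_ge0|exact: ltW].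
  rewrite (survival_strip mH mY sv (okA _ aA))//; last 3 first.
  - lra.
  - by rewrite lerD2l; apply: ler_wpM2r; rewrite ?ler_nat ?ltW.
  - by move=> j; apply: th0; lra.
  rewrite prodK -expRM_natl; congr EFin.
  have -> : expR (- (lam a * (v + k%:R * h))) - expR (- (lam a * (v + k.+1%:R * h))) =
     expR (- (lam a * (v + k%:R * h))) * (1 - expR (- (lam a * h))).
    rewrite mulrBr mulr1 -expRD; congr (_ - expR _); rewrite -natr1; ring.
  rewrite !mulrA -!(mulrC (1 - _)) -!mulrA; congr (_ * _).
  rewrite !mulrA -!(mulrAC _ K0) -!mulrA; congr (_ * (_ * _)).
  by rewrite -!expRD; congr expR; ring.
have sumB c h : 0 <= c -> 0 < h -> (\sum_(k <oo) P (B c h k) =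
   (p * K0 * expR (- (L * v)) * (1 - expR (- (lam a * h))) * expR (- ((L - lam a) * (c * h)))
     / (1 - expR (- (L * h))))%:E)%E.
  move=> c0 h0; rewrite -nneseries_geometric.
  - by apply: eq_eseriesr => k _; exact: PB.
  - rewrite !mulr_ge0 ?expR_ge0// subr_ge0 -expR0 ler_expR oppr_le0.
    by apply/ltW/mulr_gt0.
  - exact: expR_ge0.
  - by rewrite expR_lt1 oppr_lt0 mulr_gt0.
set E := (X in P X).
(* As [t] is nonnegative, losing to [a] and exceeding it by [t i] merge into a single threshold per
   index of [K]. *)
have EE : E = H `&` [set w | v < Y a w] `&`
   [set w | forall i, i \in K -> t' i + (if i \in A' then Y a w else 0) < Y i w].
  rewrite /E; apply/seteqP; split => w /=.
    move=> [[Hw [vw h1]] h2]; split => // i; rewrite mem_undup mem_cat /t' !mem_filter.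
    case: (boolP (i \in J)) => [iJ _|iJ].
      have := h2 _ iJ; have [_ ia] := okJ _ iJ; rewrite ia/=; case: ifP => _; lra.
    by rewrite orbF => /[dup] /andP[ia iA] ->; rewrite add0r; apply: h1.
  move=> [[Hw vw] h]; split; first split => //; first split => //.
    move=> i iA ia; have := h i; rewrite mem_undup mem_cat !mem_filter ia iA/= => /(_ isT).
    by have := t'0 i; lra.
  move=> i iJ; have := h i; rewrite mem_undup mem_cat !mem_filter iJ orbT => /(_ isT).
  have [_ ia] := okJ _ iJ; rewrite ia/= /t' iJ; case: ifP => _; lra.
have mE : measurable E.
  rewrite EE; apply: measurableI.
    by apply: measurableI => //; apply: measurable_gtr => //; exact: measurable_cst.
  elim: K {uK aK okK prodK B mB PB sumB EE} => [|k K ih].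
    by rewrite (_ : [set w | _] = setT)//; apply/seteqP; split.
  rewrite (_ : [set w | _] = [set w | t' k + (if k \in A' then Y a w else 0) < Y k w] `&`
     [set w | forall i, i \in K -> t' i + (if i \in A' then Y a w else 0) < Y i w]).
    apply: measurableI => //; apply: measurable_gtr => //.
    by apply: measurable_funD; [exact: measurable_cst|case: (k \in A') => //; exact: measurable_cst].
  apply/seteqP; split => w /=.
    by move=> h; split; [apply: h; rewrite mem_head|move=> i iJ; apply: h; rewrite inE iJ orbT].
  by move=> [h1 h2] i; rewrite inE => /predU1P[->//|]; exact: h2.
have cell h w : 0 < h -> v < Y a w ->
    exists k : nat, v + k%:R * h < Y a w <= v + k.+1%:R * h.
  move=> h0 vw.
  have ex : exists n : nat, Y a w <= v + n%:R * h.
    have z0 : 0 < (Y a w - v) / h by rewrite divr_gt0// subr_gt0.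
    exists (Num.bound ((Y a w - v) / h)).
    by have := ltW (archi_boundP (ltW z0)); rewrite ler_pdivrMr// lerBlDl.
  case: (ex_minnP ex) => [[|k] k1 k2]; first by move: k1; rewrite mul0r addr0 leNgt vw.
  exists k; rewrite k1 andbT ltNge; apply/negP => /k2; rewrite ltnn//.
have up h : 0 < h -> (P E <= \sum_(k <oo) P (B 0%R h k))%E.
  move=> h0; apply: measure_sigma_subadditive => //.
  rewrite EE => w /= [[Hw vw] hw]; have [k /[dup] kP /andP[k1 k2]] := cell h w h0 vw.
  exists k => //; split => // i iK; apply: le_lt_trans (hw _ iK).
  by rewrite /th lerD2l addr0; case: ifP => // _; exact: ltW.
have lo h : 0 < h -> (\sum_(k <oo) P (B 1%R h k) <= P E)%E.
  move=> h0; rewrite -measure_semi_bigcup//; last 2 first.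
  - apply/trivIsetP => i j _ _ ij; apply/seteqP; split => // w /=.
    move=> [[[_ /andP[i1 i2]] _] [[_ /andP[j1 j2]] _]].
    have lti (k l : nat) : (k < l)%N -> v + k.+1%:R * h <= v + l%:R * h.
      by move=> kl; rewrite lerD2l; apply: ler_wpM2r; rewrite ?ler_nat ?ltW.
    by have [/lti|/lti|/eqP] := ltngtP i j; [lra|lra|rewrite (negbTE ij)].
  - exact: bigcupT_measurable.
  apply: le_measure; rewrite ?inE//; first exact: bigcupT_measurable.
  rewrite EE => w [k _ [[Hw /andP[k1 k2]] hw]].
  have kh : 0 <= k%:R * h by rewrite mulr_ge0// ltW.
  split; first by split => //=; apply: le_lt_trans k1; lra.
  move=> i iK /=; apply: le_lt_trans (hw _ iK).
  by rewrite /th lerD2l; case: ifP => // _; rewrite natr1.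
have Lh h : 0 < h -> 0 < L * h by move=> h0; rewrite mulr_gt0.
have fP : P E \is a fin_num by exact: fin_num_measure.
rewrite -(fineK fP); congr EFin.
set Z := p * K0 * expR (- (L * v)).
have Z0 : 0 <= Z by rewrite !mulr_ge0 ?expR_ge0.
rewrite (_ : _ * K0 = Z * (lam a / L)); last by rewrite /Z; ring.
have ZL0 : 0 <= Z * (lam a / L) by rewrite mulr_ge0// divr_ge0// ltW.
apply: (@eq_of_linear_bound _ _ _ (Z * (lam a / L) * L)).
  by rewrite mulr_ge0// ltW.
move=> h h0; have Lh0 := Lh h h0.
have lah0 : 0 < lam a * h by rewrite mulr_gt0.
apply/andP; split.
  rewrite -lee_fin fineK//; apply: le_trans (lo h h0); rewrite sumB// lee_fin -/Z.
  have h1 : lam a * h / (1 + lam a * h) <= 1 - expR (- (lam a * h)) by exact: one_sub_expR_ge.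
  have h2 : 1 - (L - lam a) * h <= expR (- ((L - lam a) * (1 * h))).
    by rewrite mul1r; exact: expR_opp_ge.
  have h3 : (L * h)^-1 <= (1 - expR (- (L * h)))^-1.
    rewrite lef_pV2 ?posrE//; last exact: one_sub_expR_gt0.
    by have := expR_opp_ge (L * h); lra.
  have u0 : 0 < 1 + lam a * h by lra.
  have iL0 : 0 < (L * h)^-1 by rewrite invr_gt0.
  (* For [L * h >= 1] the required lower bound is nonpositive and only the sign of the lower sum
     matters. *)
  have [h4|h4] := leP (1 - L * h) 0.
    apply: (@le_trans _ _ 0).
      rewrite (_ : _ - _ = Z * (lam a / L) * (1 - L * h)); last by ring.
      by rewrite mulr_ge0_le0.
    rewrite !mulr_ge0 ?expR_ge0//; first by have := divr_gt0 lah0 u0; lra.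
    by rewrite (le_trans _ h3)// ltW.
  apply: (@le_trans _ _ (Z * (lam a * h / (1 + lam a * h)) * (1 - (L - lam a) * h) / (L * h))).
    rewrite (_ : _ - _ = Z * (lam a / L) * (1 - L * h)); last by ring.
    rewrite [leRHS](_ : _ = Z * (lam a / L) * ((1 - (L - lam a) * h) / (1 + lam a * h))); last first.
      by field; rewrite !gt_eqF.
    apply: ler_wpM2l => //; rewrite ler_pdivlMr//.
    have : 0 <= L * h * (lam a * h) by rewrite mulr_ge0 ?ltW.
    have : 0 <= lam a * h * (lam a * h) by rewrite mulr_ge0 ?ltW.
    nra.
  have h5 : 0 <= 1 - (L - lam a) * h by lra.
  have h6 : 0 <= lam a * h / (1 + lam a * h) by rewrite divr_ge0 ?ltW.
  have h7 : 0 <= Z * (lam a * h / (1 + lam a * h)) by exact: mulr_ge0.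
  apply: ler_pM; [exact: mulr_ge0|exact: ltW| |exact: h3].
  by apply: ler_pM => //; exact: ler_wpM2l.
rewrite -lee_fin fineK//; apply: (le_trans (up h h0)); rewrite sumB// lee_fin -/Z.
have h1 : 1 - expR (- (lam a * h)) <= lam a * h by have := expR_opp_ge (lam a * h); lra.
have h3 : (1 - expR (- (L * h)))^-1 <= (1 + L * h) / (L * h).
  rewrite -[leRHS]invrK lef_pV2 ?posrE//; last 2 first.
  - exact: one_sub_expR_gt0.
  - by rewrite invr_gt0 divr_gt0//; lra.
  by rewrite invf_div; exact: one_sub_expR_ge.
rewrite mul0r mulr0 oppr0 expR0 mulr1.
apply: (@le_trans _ _ (Z * (lam a * h) * ((1 + L * h) / (L * h)))).
  apply: ler_pM => //.
  - by rewrite mulr_ge0// ltW// one_sub_expR_gt0.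
  - by rewrite invr_ge0 ltW// one_sub_expR_gt0.
  - exact: ler_wpM2l.
rewrite le_eqVlt; apply/orP; left; apply/eqP; field.
by rewrite !gt_eqF.
Qed.

End Survival.

(** * Moments of exponential variables *)

Lemma bounded_nneseries (R : realType) (u : nat -> R) (C : R) :
  (forall j, 0 <= u j) -> (forall n, \sum_(0 <= j < n) u j <= C) ->
  (\sum_(j <oo) (u j)%:E <= C%:E)%E.
Proof.
move=> u0 uC; apply: lime_le.
  by apply: is_cvg_nneseries => n _ _; rewrite lee_fin.
by apply: nearW => n; rewrite sumEFin lee_fin.
Qed.

Lemma sum_inv_sqr_le (R : realType) n : \sum_(0 <= j < n) (j.+1%:R ^+ 2)^-1 <= 2 :> R.
Proof.
case: n => [|n]; first by rewrite big_nil.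
(* Strengthened so that the induction step telescopes. *)
suff h : \sum_(0 <= j < n.+1) (j.+1%:R ^+ 2)^-1 <= 2 - n.+1%:R^-1 :> R.
  by apply: (le_trans h); rewrite gerBl invr_ge0.
elim: n => [|n ih]; first by rewrite big_nat1 expr1n invr1; lra.
rewrite big_nat_recr//=.
have n0 : (0 : R) < n.+1%:R by rewrite ltr0n.
have -> : n.+2%:R = n.+1%:R + 1 :> R by rewrite natr1.
have e : ((n.+1%:R + 1) ^+ 2)^-1 <= n.+1%:R^-1 - (n.+1%:R + 1)^-1 :> R.
  have -> : n.+1%:R^-1 - (n.+1%:R + 1)^-1 = (n.+1%:R * (n.+1%:R + 1))^-1 :> R.
    by field; rewrite !gt_eqF//; lra.
  have p1 : 0 < n.+1%:R * (n.+1%:R + 1) :> R by apply: mulr_gt0 => //; lra.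
  have p2 : 0 < (n.+1%:R + 1) ^+ 2 :> R by apply: exprn_gt0; lra.
  rewrite lef_pV2 ?posrE//.
  by rewrite expr2; apply: ler_wpM2r; lra.
by apply: (le_trans (lerD ih e)); rewrite addrA subrK.
Qed.

(** Layer-cake formula with mesh [h]: the series is [x] rounded up to a multiple of [h], so it
    recovers [x] from indicators of tails up to an error [h]. *)
Lemma cell_sum (R : realType) (h x : R) : 0 < h -> 0 <= x ->
  exists N : nat, [/\ x <= N%:R * h, N%:R * h <= x + h &
    (\sum_(a <oo) (h * (a%:R * h < x)%R%:R)%:E = (N%:R * h)%:E)%E].
Proof.
move=> h0 x0.
have ex : exists n : nat, x <= n%:R * h.
  exists (Num.bound (x / h)).
  have := ltW (archi_boundP (divr_ge0 x0 (ltW h0))).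
  by rewrite ler_pdivrMr.
case: (ex_minnP ex) => N N1 N2; exists N; split => //.
  case: N N1 N2 => [|N] N1 N2; first by rewrite mul0r; lra.
  rewrite -natr1 mulrDl mul1r lerD2r leNgt; apply/negP => /ltW/N2; by rewrite ltnn.
have lt_iff (a : nat) : (a%:R * h < x) = (a < N)%N.
  apply/idP/idP => [ax|aN].
    rewrite -(ltr_nat R) -(ltr_pM2r h0); exact: lt_le_trans N1.
  by rewrite ltNge; apply/negP => /N2; rewrite leqNgt aN.
rewrite (@nneseries_split _ _ 0 N)//; last first.
  by move=> k _; rewrite lee_fin mulr_ge0// ltW.
rewrite add0n [X in (_ + X)%E]eseries0 ?adde0; last first.
  by move=> i Ni _; rewrite lt_iff ltnNge Ni mulr0.
rewrite sumEFin; congr EFin.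
rewrite (eq_big_nat _ _ (F2 := fun=> h)); last first.
  by move=> i /andP[_ iN]; rewrite lt_iff iN mulr1.
by rewrite big_const_nat iter_addr addr0 subn0 mulr_natl.
Qed.

Section Moments.
Context d (T : measurableType d) (R : realType) (P : probability T R).

Lemma measurable_tail (X : T -> R) (t : R) : measurable_fun setT X ->
  measurable [set w | t < X w].
Proof. by move=> mX; apply: measurable_gtr => //; exact: measurable_cst. Qed.

Lemma integral_tail_sum (X Y : T -> R) (h : R) :
  measurable_fun setT X -> measurable_fun setT Y ->
  (forall w, 0 <= Y w) -> 0 < h ->
  (\int[P]_w (\sum_(a <oo) (h * (a%:R * h < X w)%R%:R * Y w)%:E) =
   \sum_(a <oo) (h%:E * \int[P]_(w in [set w | a%:R * h < X w]%R) (Y w)%:E))%E.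
Proof.
move=> mX mY Y0 h0.
have mI (a : nat) : measurable_fun setT (fun w => h * (a%:R * h < X w)%R%:R * Y w).
  apply: measurable_funM => //; apply: measurable_funM; first exact: measurable_cst.
  rewrite (_ : (fun w => _) = \1_[set w | a%:R * h < X w]).
    by apply: measurable_indic; exact: measurable_tail.
  by apply/funext => w; rewrite indicE mem_setE.
rewrite integral_nneseries//; last 2 first.
- by move=> a; exact/measurable_EFinP.
- by move=> a w _; rewrite lee_fin !mulr_ge0// ltW.
apply: eq_eseriesr => a _.
rewrite -ge0_integralZl_EFin//; last 4 first.
- exact: measurable_tail.
- by move=> w _; rewrite lee_fin.
- by apply/measurable_EFinP; exact: measurable_funTS.
- exact: ltW.
rewrite [RHS]integral_mkcond; apply: eq_integral => w _.
rewrite patchE; case: ifPn; first by rewrite inE/= => ->; rewrite mulr1 EFinM.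
by rewrite notin_setE/= => /negP/negbTE ->; rewrite mulr0 mul0r.
Qed.

(** By the layer-cake formula the integral is at most K h / (1 - e^(-L h)), hence at most K / L + K
    h, for every mesh h. The weight [Y] makes the lemma applicable twice in a row, which yields
    mixed moments. *)
Lemma integral_mul_exp_tail_le (X Y : T -> R) (K L : R) :
  measurable_fun setT X -> measurable_fun setT Y ->
  (forall w, 0 <= X w) -> (forall w, 0 <= Y w) -> 0 <= K -> 0 < L ->
  (forall t : R, 0 <= t ->
    (\int[P]_(w in [set w | t < X w]%R) (Y w)%:E <= (K * expR (- (L * t)))%:E)%E) ->
  (\int[P]_w (X w * Y w)%:E <= (K / L)%:E)%E.
Proof.
move=> mX mY X0 Y0 K0 L0 tl.
have key (h : R) : 0 < h -> (\int[P]_w (X w * Y w)%:E <= (K / L + K * h)%:E)%E.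
  move=> h0; have Lh0 : 0 < L * h by rewrite mulr_gt0.
  apply: (@le_trans _ _ (\int[P]_w (\sum_(a <oo) (h * (a%:R * h < X w)%R%:R * Y w)%:E))%E).
    apply: ge0_le_integral => //.
    - by move=> w _; rewrite lee_fin mulr_ge0.
    - by apply/measurable_EFinP; exact: measurable_funM.
    - apply: ge0_emeasurable_sum => [a w _ _|a _].
        by rewrite lee_fin !mulr_ge0// ltW.
      apply/measurable_EFinP; apply: measurable_funM => //.
      apply: measurable_funM; first exact: measurable_cst.
      rewrite (_ : (fun w => _) = \1_[set w | a%:R * h < X w]).
        by apply: measurable_indic; exact: measurable_tail.
      by apply/funext => w; rewrite indicE mem_setE.
    - move=> w _; have [N [N1 N2 N3]] := cell_sum h0 (X0 w).
      under eq_eseriesr do rewrite mulrC EFinM.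
      rewrite nneseriesZl//; last by move=> a _; rewrite lee_fin mulr_ge0// ltW.
      by rewrite N3 -EFinM lee_fin mulrC ler_wpM2l.
  rewrite integral_tail_sum//.
  apply: (@le_trans _ _ (\sum_(a <oo) ((h * K) * (expR (- (L * h))) ^+ a)%:E)%E).
    apply: lee_nneseries => [a _ _|a _].
      apply: mule_ge0; first by rewrite lee_fin ltW.
      by apply: integral_ge0 => w _; rewrite lee_fin.
    rewrite -mulrA EFinM; apply: lee_wpmul2l; first by rewrite lee_fin ltW.
    apply: le_trans (tl _ _) _; first by rewrite mulr_ge0// ltW.
    by rewrite -expRM_natl lee_fin ler_wpM2l// ler_expR; nra.
  rewrite nneseries_geometric ?expR_ge0//; last 2 first.
  - by rewrite mulr_ge0// ltW.
  - by rewrite expR_lt1 oppr_lt0.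
  rewrite lee_fin; apply: (@le_trans _ _ (h * K * ((1 + L * h) / (L * h)))).
    apply: ler_wpM2l; first by rewrite mulr_ge0// ltW.
    rewrite -[leRHS]invrK lef_pV2 ?posrE//; last 2 first.
    - exact: one_sub_expR_gt0.
    - by rewrite invr_gt0 divr_gt0//; lra.
    by rewrite invf_div; exact: one_sub_expR_ge.
  by rewrite le_eqVlt; apply/orP; left; apply/eqP; field; rewrite !gt_eqF.
apply/lee_addgt0Pr => e e0; have K1 : 0 < K + 1 by lra.
apply: (le_trans (key _ (divr_gt0 e0 K1))); rewrite -EFinD lee_fin lerD2l.
have E : K * (e / (K + 1)) + e / (K + 1) = e by field; lra.
by have := divr_gt0 e0 K1; lra.
Qed.

(** A lower bound on the mean suffices, because the mean enters the expanded squared deviation with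
    a minus sign. *)
Lemma integral_exp_tail_ge (X : T -> R) (L : R) :
  measurable_fun setT X -> (forall w, 0 <= X w) -> 0 < L ->
  (forall t : R, 0 <= t -> P [set w | t < X w] = (expR (- (L * t)))%:E) ->
  (L^-1%:E <= \int[P]_w (X w)%:E)%E.
Proof.
move=> mX X0 L0 tl; apply/lee_addgt0Pr => h h0.
have Lh0 : 0 < L * h by rewrite mulr_gt0.
apply: (@le_trans _ _ (h * 1 / (1 - expR (- (L * h))))%:E).
  rewrite lee_fin mulr1 ler_pdivlMr; last exact: one_sub_expR_gt0.
  by rewrite mulrC ler_pdivrMr//; have := expR_opp_ge (L * h); lra.
rewrite -nneseries_geometric ?expR_ge0//; last 2 first.
- by rewrite mulr_ge0// ltW.
- by rewrite expR_lt1 oppr_lt0.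
have -> : (\sum_(a <oo) (h * 1 * (expR (- (L * h))) ^+ a)%:E =
   \int[P]_w (\sum_(a <oo) (h * (a%:R * h < X w)%R%:R * 1)%:E))%E.
  rewrite (integral_tail_sum mX (@measurable_cst _ _ _ _ setT (1 : R)))//.
  apply: eq_eseriesr => a _.
  have -> : (\int[P]_(w in [set w | (a%:R * h < X w)%R]) (cst 1 w)%:E =
      P [set w | (a%:R * h < X w)%R])%E.
    by have := integral_cst P (measurable_tail (a%:R * h) mX) 1%E; rewrite mul1e.
  rewrite tl; last by rewrite mulr_ge0// ltW.
  by rewrite mulr1 -expRM_natl EFinM; congr (_ * (expR _)%:E)%E; ring.
have -> : h%:E = (\int[P]_w (cst h%:E) w)%E by rewrite integral_cst// [X in (_ * X)%E]probability_setT mule1.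
rewrite -ge0_integralD//; last 3 first.
- by move=> w _; rewrite lee_fin.
- exact/measurable_EFinP.
- by move=> w _; rewrite lee_fin ltW.
apply: ge0_le_integral => //.
- by move=> w _; apply: nneseries_ge0 => a _ _; rewrite lee_fin !mulr_ge0// ltW.
- apply: ge0_emeasurable_sum => [a w _ _|a _].
    by rewrite lee_fin !mulr_ge0// ltW.
  apply/measurable_EFinP; apply: measurable_funM; last exact: measurable_cst.
  apply: measurable_funM; first exact: measurable_cst.
  rewrite (_ : (fun w => _) = \1_[set w | a%:R * h < X w]).
    by apply: measurable_indic; exact: measurable_tail.
  by apply/funext => w; rewrite indicE mem_setE.
- by apply: emeasurable_funD => //; exact/measurable_EFinP.
- move=> w _; have [N [N1 N2 N3]] := cell_sum h0 (X0 w).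
  by under eq_eseriesr do rewrite mulr1; rewrite N3 -EFinD lee_fin.
Qed.

Lemma integral_tail_eq (X : T -> R) (t : R) (A : set T) :
  measurable_fun setT X -> measurable A ->
  (\int[P]_(w in [set w | t < X w]%R) (\1_A w)%:E = P ([set w | t < X w]%R `&` A))%E.
Proof.
by move=> mX mA; rewrite integral_indic//; [rewrite setIC|exact: measurable_tail].
Qed.

(** * Variance bound for sums of pairwise independent exponentials *)

Section PairwiseExponential.
Variables (V : nat -> T -> R) (lam : nat -> R) (D : pred nat).
Hypothesis mV : forall k, measurable_fun setT (V k).
Hypothesis V0 : forall k w, 0 <= V k w.
Hypothesis lam0 : forall k, D k -> 0 < lam k.
Hypothesis V1 : forall k (t : R), D k -> 0 <= t ->
  P [set w | t < V k w] = (expR (- (lam k * t)))%:E.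
Hypothesis V2 : forall j k (s t : R), D j -> D k -> j != k -> 0 <= s -> 0 <= t ->
  P ([set w | s < V j w] `&` [set w | t < V k w]) =
  (expR (- (lam j * s)) * expR (- (lam k * t)))%:E.

Lemma integral_mul_exp j k : D j -> D k -> j != k ->
  (\int[P]_w (V j w * V k w)%:E <= ((lam j)^-1 * (lam k)^-1)%:E)%E.
Proof.
move=> Dj Dk jk.
under eq_integral do rewrite mulrC.
apply: integral_mul_exp_tail_le => //; [by rewrite invr_ge0 ltW ?lam0|exact: lam0|].
move=> t t0.
have -> : (\int[P]_(w in [set w | (t < V k w)%R]) (V j w)%:E =
   \int[P]_w (V j w * \1_[set w | t < V k w]%R w)%:E)%E.
  rewrite integral_mkcond; apply: eq_integral => w _.
  rewrite patchE indicE; case: ifPn => _; first by rewrite mulr1.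
  by rewrite mulr0.
rewrite mulrC.
apply: integral_mul_exp_tail_le => //; [|exact: lam0|].
  by apply: measurable_indic; exact: measurable_tail.
move=> s s0; rewrite integral_tail_eq//; last exact: measurable_tail.
by rewrite V2// mulrC.
Qed.

(** The joint tail of [V k] with itself is e^(-lam max(s, t)), at most e^(-lam s / 2) e^(-lam t /
    2). This product form, with half the rate, is fed twice to [integral_mul_exp_tail_le]; the 4
    comes from the two halved rates. *)
Lemma integral_sqr_exp k : D k ->
  (\int[P]_w (V k w * V k w)%:E <= (4 * ((lam k)^-1 * (lam k)^-1))%:E)%E.
Proof.
move=> Dk; have lk := lam0 Dk; have l2 : 0 < lam k / 2 by lra.
have -> : 4 * ((lam k)^-1 * (lam k)^-1) = (lam k / 2)^-1 / (lam k / 2).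
  by field; rewrite gt_eqF.
apply: integral_mul_exp_tail_le => //; first by rewrite invr_ge0 ltW.
move=> t t0.
have -> : (\int[P]_(w in [set w | (t < V k w)%R]) (V k w)%:E =
   \int[P]_w (V k w * \1_[set w | t < V k w]%R w)%:E)%E.
  rewrite integral_mkcond; apply: eq_integral => w _.
  rewrite patchE indicE; case: ifPn => _; first by rewrite mulr1.
  by rewrite mulr0.
rewrite mulrC.
apply: integral_mul_exp_tail_le => //; [|].
  by apply: measurable_indic; exact: measurable_tail.
move=> s s0; rewrite integral_tail_eq//; last exact: measurable_tail.
have -> : [set w | s < V k w] `&` [set w | t < V k w] = [set w | Num.max s t < V k w].
  by apply/seteqP; split => w /=; rewrite gt_max; [move=> [-> ->]|move=> /andP[]].
rewrite V1//; last by rewrite le_max s0.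
rewrite lee_fin -expRD ler_expR.
have m1 : s <= Num.max s t by rewrite le_max lexx.
have m2 : t <= Num.max s t by rewrite le_max lexx orbT.
nra.
Qed.

(** With S the sum of the variables, h the sum of the inverse rates and q that of their squares, E S
    >= h and E S^2 <= h^2 + 4 q, since the off-diagonal products factorise. *)
Lemma integral_sqr_dev (r : seq nat) : uniq r -> all D r ->
  (\int[P]_w ((\sum_(k <- r) V k w - \sum_(k <- r) (lam k)^-1) ^+ 2)%:E <=
   (4 * \sum_(k <- r) ((lam k)^-1 * (lam k)^-1))%:E)%E.
Proof.
move=> ur /allP Dr; set h := \sum_(k <- r) (lam k)^-1; set q := \sum_(k <- r) _.
have h0 : 0 <= h by rewrite /h big_seq sumr_ge0// => k /Dr/lam0 ?; rewrite invr_ge0 ltW.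
pose S w := \sum_(k <- r) V k w.
have S0 w : 0 <= S w by apply: sumr_ge0 => k _; exact: V0.
have mS : measurable_fun setT S by exact: measurable_sum.
have iS : (h%:E <= \int[P]_w (S w)%:E)%E.
  under eq_integral do rewrite -sumEFin.
  rewrite ge0_integral_sum//; last 2 first.
  - by move=> k; exact/measurable_EFinP.
  - by move=> k w _; rewrite lee_fin.
  rewrite /h -sumEFin big_seq [leRHS]big_seq; apply: lee_sum => k /Dr Dk.
  by apply: integral_exp_tail_ge => //; [exact: lam0|move=> t; exact: V1].
have iS2 : (\int[P]_w (S w * S w)%:E <= (h * h + 4 * q)%:E)%E.
  have -> : (fun w => (S w * S w)%:E) =
      (fun w => \sum_(j <- r) (\sum_(k <- r) (V j w * V k w)%:E))%E.
    apply/funext => w; rewrite /S mulr_suml -sumEFin; apply: eq_bigr => j _.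
    by rewrite mulr_sumr -sumEFin.
  have m2 j k : measurable_fun setT (fun w => (V j w * V k w)%:E).
    by apply/measurable_EFinP; exact: measurable_funM.
  rewrite ge0_integral_sum//; last 2 first.
  - by move=> j; apply: emeasurable_sum => k.
  - by move=> j w _; apply: sume_ge0 => k _; rewrite lee_fin mulr_ge0.
  have -> : h * h + 4 * q =
     \sum_(j <- r) (\sum_(k <- r) (lam j)^-1 * (lam k)^-1 + 4 * ((lam j)^-1 * (lam j)^-1)).
    rewrite big_split/= -mulr_sumr; congr (_ + _).
    by rewrite /h mulr_suml; apply: eq_bigr => j _; rewrite mulr_sumr.
  rewrite -sumEFin big_seq [leRHS]big_seq; apply: lee_sum => j jr.
  rewrite ge0_integral_sum//; last by move=> k w _; rewrite lee_fin mulr_ge0.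
  rewrite (bigD1_seq j)//= [X in (_ <= (X + _)%:E)%E](bigD1_seq j)//=.
  apply: (@le_trans _ _ ((4 * ((lam j)^-1 * (lam j)^-1))%:E +
     (\sum_(i <- r | i != j) (lam j)^-1 * (lam i)^-1)%:E)%E).
    apply: leeD; first exact: integral_sqr_exp (Dr _ jr).
    rewrite -sumEFin big_seq_cond [leRHS]big_seq_cond; apply: lee_sum => k /andP[kr kj].
    by apply: integral_mul_exp; [exact: Dr|exact: Dr|rewrite eq_sym].
  rewrite -EFinD lee_fin.
  have : 0 <= (lam j)^-1 * (lam j)^-1 by rewrite -expr2 sqr_ge0.
  by lra.
have mD : measurable_fun setT (fun w => (S w - h) ^+ 2).
  by apply: measurable_funX; apply: measurable_funB => //; exact: measurable_cst.
(* The square is expanded with the cross term on the left, so that every integrand is nonnegative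
   and no integral is subtracted. *)
have e : (\int[P]_w ((S w - h) ^+ 2)%:E + (2 * h)%:E * \int[P]_w (S w)%:E =
   \int[P]_w (S w * S w)%:E + (h * h)%:E)%E.
  have -> : (h * h)%:E = (\int[P]_w (cst (h * h)%:E) w)%E.
    by rewrite integral_cst// [X in (_ * X)%E]probability_setT mule1.
  rewrite -ge0_integralZl_EFin//; last 3 first.
  - by move=> w _; rewrite lee_fin.
  - exact/measurable_EFinP.
  - by rewrite mulr_ge0.
  rewrite -!ge0_integralD//.
  - by apply: eq_integral => w _ /=; rewrite -EFinM -!EFinD; congr EFin; ring.
  - by move=> w _; rewrite lee_fin mulr_ge0.
  - by apply/measurable_EFinP; exact: measurable_funM.
  - by move=> w _; rewrite lee_fin mulr_ge0.
  - by move=> w _; rewrite lee_fin sqr_ge0.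
  - exact/measurable_EFinP.
  - by move=> w _; rewrite -EFinM lee_fin !mulr_ge0.
  - by apply: emeasurable_funM => //; exact/measurable_EFinP.
set A := (\int[P]_w ((S w - h) ^+ 2)%:E)%E in e *.
have : (A + (2 * h * h)%:E <= (h * h + 4 * q)%:E + (h * h)%:E)%E.
  apply: (@le_trans _ _ (A + (2 * h)%:E * \int[P]_w (S w)%:E)%E).
    by rewrite leeD2l// EFinM lee_wpmul2l// lee_fin mulr_ge0.
  by rewrite e leeD2r.
by rewrite -EFinD -leeBrDr// -EFinB => /le_trans; apply; rewrite lee_fin; lra.
Qed.

End PairwiseExponential.

End Moments.

(** * Sums of independent exponentials *)

Lemma exists_cube n : (0 < n)%N -> exists j, (j.+1 ^ 3 <= n < j.+2 ^ 3)%N.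
Proof.
move=> n0; have ex : exists m, (n < m.+1 ^ 3)%N.
  by exists n; rewrite !expnS expn0 muln1; nia.
case: (ex_minnP ex) => -[|j] j1 j2; first by move: j1; rewrite exp1n; lia.
by exists j; rewrite j1 andbT leqNgt; apply/negP => /j2; rewrite ltnn.
Qed.

(* Cubes are sparse enough for summable variances, yet dense enough for monotonicity
   to interpolate between them. *)
Lemma cvg_along_cubes (R : realType) (u g : nat -> R) (l : R) :
  {homo u : m n / (m <= n)%N >-> m <= n} -> {homo g : m n / (m <= n)%N >-> m <= n} ->
  (u (j.+1 ^ 3)%N - g (j.+1 ^ 3)%N) @[j --> \oo] --> l ->
  (g (j.+2 ^ 3)%N - g (j.+1 ^ 3)%N) @[j --> \oo] --> (0 : R) ->
  (u n - g n) @[n --> \oo] --> l.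
Proof.
move=> ndu ndg ul g0; apply/cvgrPdist_le => e e0.
have e2 : 0 < e / 2 by lra.
move/cvgrPdist_le : ul => /(_ _ e2) [N1 _ N1P].
move/cvgrPdist_le : g0 => /(_ _ e2) [N2 _ N2P].
pose J := maxn N1 N2; exists (J.+1 ^ 3)%N => // n /= Jn.
have n0 : (0 < n)%N by apply: leq_trans Jn; rewrite expn_gt0.
have [j /andP[j1 j2]] := exists_cube n0.
have Jj : (J <= j)%N.
  rewrite leqNgt; apply/negP => jJ; move: j2; rewrite ltnNge => /negP; apply.
  by apply: leq_trans Jn; rewrite leq_exp2r.
have j1N : (N1 <= j)%N by apply: leq_trans Jj; rewrite leq_maxl.
have j2N : (N2 <= j)%N by apply: leq_trans Jj; rewrite leq_maxr.
have := N1P j j1N; have := N1P j.+1 (leqW j1N); have := N2P j j2N.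
rewrite /= sub0r normrN !ler_norml => /andP[a1 a2] /andP[b1 b2] /andP[c1 c2].
have := ndu _ _ j1; have := ndu _ _ (ltnW j2); have := ndg _ _ j1; have := ndg _ _ (ltnW j2).
by move=> d1 d2 d3 d4; apply/andP; split; lra.
Qed.

Section ExpSum.
Variables (R : realType) (a c : R).
Hypothesis a0 : 0 < a.
Hypothesis c0 : 0 <= c.

Let lam (k : nat) : R := a * k%:R + c.

Let lam_gt0 k : (0 < k)%N -> 0 < lam k.
Proof. by move=> k0; rewrite /lam ltr_pwDl// mulr_gt0// ltr0n. Qed.

(** As for Euler's constant: the sequence is nonincreasing because 1 / (a k + c) <= 1 / (a k) <= (ln
    k - ln (k - 1)) / a, and bounded below by comparing the sum with ln (n + c / a) / a. *)
Lemma harmonic_ln_cvg :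
  exists l : R, (\sum_(1 <= k < n.+1) (lam k)^-1 - ln n%:R / a) @[n --> \oo] --> l.
Proof.
pose f n := \sum_(1 <= k < n.+2) (lam k)^-1 - ln n.+1%:R / a.
suff : cvgn f.
  move=> /cvg_ex[l fl]; exists l; rewrite -(cvg_shiftS (fun n => _ - _)); exact: fl.
apply: nonincreasing_is_cvgn.
  apply/nonincreasing_seqP => n; rewrite /f big_nat_recr//=.
  suff : (lam n.+2)^-1 <= (ln n.+2%:R - ln n.+1%:R) / a by lra.
  have n2 : 0 < n.+2%:R :> R by rewrite ltr0n.
  have n1 : 0 < n.+1%:R :> R by rewrite ltr0n.
  apply: (@le_trans _ _ (n.+2%:R^-1 / a)).
    rewrite -invfM lef_pV2 ?posrE ?lam_gt0//; last by rewrite mulr_gt0.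
    by rewrite /lam mulrC lerDl.
  apply: ler_wpM2r; first by rewrite invr_ge0 ltW.
  rewrite -lerN2 opprB -ln_div ?posrE//.
  have -> : n.+1%:R / n.+2%:R = 1 + - n.+2%:R^-1 :> R.
    by rewrite -[n.+2%:R]natr1 in n2 *; field; rewrite gt_eqF.
  by apply: le_ln1Dx; rewrite ltrN2 invf_lt1// ltr1n.
exists (- ln (1 + c / a) / a) => _ [n _ <-].
have ca : 0 <= c / a by rewrite divr_ge0// ltW.
have h m : (ln (m.+1%:R + c / a) - ln (1 + c / a)) / a <= \sum_(1 <= k < m.+1) (lam k)^-1.
  elim: m => [|m ih]; first by rewrite big_nil subrr mul0r.
  rewrite big_nat_recr//=; apply: le_trans (lerD ih (lexx _)).
  have m1 : 0 < m.+1%:R + c / a :> R by rewrite ltr_pwDl// ltr0n.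
  have m2 : 0 < m.+2%:R + c / a :> R by rewrite ltr_pwDl// ltr0n.
  suff : (ln (m.+2%:R + c / a) - ln (m.+1%:R + c / a)) / a <= (lam m.+1)^-1 by lra.
  have -> : (lam m.+1)^-1 = (m.+1%:R + c / a)^-1 / a.
    by rewrite /lam -invfM; congr (_^-1); field; rewrite gt_eqF.
  apply: ler_wpM2r; first by rewrite invr_ge0 ltW.
  rewrite -ln_div ?posrE//.
  have -> : (m.+2%:R + c / a) / (m.+1%:R + c / a) = 1 + (m.+1%:R + c / a)^-1.
    by rewrite -[m.+2%:R]natr1 addrAC mulrDl divff ?mul1r ?gt_eqF.
  by apply: le_ln1Dx; rewrite (lt_trans (ltrN10 _))// invr_gt0.
have := h n.+1.
have : ln n.+1%:R / a <= ln (n.+2%:R + c / a) / a.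
  apply: ler_wpM2r; first by rewrite invr_ge0 ltW.
  have n1 : 0 < n.+1%:R :> R by rewrite ltr0n.
  have n2 : 0 < n.+2%:R + c / a :> R by rewrite ltr_pwDl// ltr0n.
  by rewrite ler_ln ?posrE// -[n.+2%:R]natr1; lra.
rewrite /f; lra.
Qed.

Definition cube_block j := index_iota (j.+1 ^ 3).+1 (j.+2 ^ 3).+1.

(** With m = j + 1 the block has (m + 1)^3 - m^3 = 3 m^2 + 3 m + 1 elements; this is the origin of
    the constant 7 below. *)
Lemma size_cube_block j : (size (cube_block j) <= 7 * j.+1 ^ 2)%N.
Proof. by rewrite size_iota !expnS !expn0 !muln1; nia. Qed.

Lemma sum_cube_block_le (f : nat -> R) (C : R) j : 0 <= C ->
  (forall k, (j.+1 ^ 3 <= k)%N -> f k <= C) ->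
  \sum_(k <- cube_block j) f k <= 7 * j.+1%:R ^+ 2 * C.
Proof.
move=> C0 fC; apply: (@le_trans _ _ (\sum_(k <- cube_block j) C)).
  rewrite big_seq [leRHS]big_seq; apply: ler_sum => k.
  by rewrite mem_index_iota => /andP[/ltnW/fC].
rewrite big_const_seq count_predT iter_addr addr0 -[leLHS]mulr_natl.
apply: ler_wpM2r => //.
by have := size_cube_block j; rewrite -(ler_nat R) natrM natrX.
Qed.

Lemma cube_gt0 j : (0 < j.+1 ^ 3)%N. Proof. by rewrite expn_gt0. Qed.

Lemma inv_lam_le j k : (j.+1 ^ 3 <= k)%N -> (lam k)^-1 <= (a * j.+1%:R ^+ 3)^-1.
Proof.
move=> jk; rewrite lef_pV2 ?posrE.
- rewrite /lam; apply: (@le_trans _ _ (a * k%:R)); last by rewrite lerDl.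
  by apply: ler_wpM2l; [exact: ltW|rewrite -natrX ler_nat].
- by apply: lam_gt0; apply: leq_trans jk; exact: cube_gt0.
- by rewrite mulr_gt0// exprn_gt0.
Qed.

Lemma sum_inv_lam_sqr j : \sum_(k <- cube_block j) ((lam k)^-1 * (lam k)^-1) <=
  7 / a ^+ 2 * (j.+1%:R ^+ 2)^-1 * (j.+1%:R ^+ 2)^-1.
Proof.
set z := (a * j.+1%:R ^+ 3)^-1.
have z0 : 0 <= z by rewrite invr_ge0 mulr_ge0 ?exprn_ge0// ltW.
apply: (@le_trans _ _ (7 * j.+1%:R ^+ 2 * (z * z))).
  apply: sum_cube_block_le => [|k jk]; first by rewrite mulr_ge0.
  have k0 : 0 <= (lam k)^-1.
    by rewrite invr_ge0 ltW// lam_gt0//; apply: leq_trans jk; exact: cube_gt0.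
  by apply: ler_pM => //; exact: inv_lam_le.
rewrite le_eqVlt; apply/orP; left; apply/eqP; rewrite /z.
have : j.+1%:R != 0 :> R by rewrite pnatr_eq0.
by move: (j.+1%:R : R) => x x0; field; rewrite x0 gt_eqF.
Qed.

(** The hypothesis makes the deviations over blocks absolutely summable, which gives convergence
    along cubes. The expected sum over a block is O(1 / j), so [cvg_along_cubes] fills in the other
    indices. *)
Lemma exp_sum_ln_cvg_det (V : nat -> R) :
  (forall k, (0 < k)%N -> 0 <= V k) ->
  (\sum_(j <oo) (j.+1%:R ^+ 2 *
     (\sum_(k <- cube_block j) V k - \sum_(k <- cube_block j) (lam k)^-1) ^+ 2)%:E < +oo)%E ->
  exists l : R, (\sum_(1 <= k < n.+1) V k - ln n%:R / a) @[n --> \oo] --> l.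
Proof.
move=> V0 Qfin.
pose S n := \sum_(1 <= k < n.+1) V k.
pose g n := \sum_(1 <= k < n.+1) (lam k)^-1.
have nd (f : nat -> R) : (forall k, (0 < k)%N -> 0 <= f k) ->
    {homo (fun n => \sum_(1 <= k < n.+1) f k) : m n / (m <= n)%N >-> m <= n}.
  move=> f0 m n mn; rewrite [leRHS](@big_cat_nat _ _ _ m.+1)//= lerDl.
  by rewrite big_nat_cond sumr_ge0// => k /andP[/andP[/(leq_ltn_trans (leq0n _))/f0]].
have block (f : nat -> R) j : \sum_(k <- cube_block j) f k =
    \sum_(1 <= k < (j.+2 ^ 3).+1) f k - \sum_(1 <= k < (j.+1 ^ 3).+1) f k.
  rewrite [X in _ = X - _](@big_cat_nat _ _ _ (j.+1 ^ 3).+1)//=; last first.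
    by rewrite ltnS leq_exp2r.
  by rewrite addrAC subrr add0r.
pose dl j := \sum_(k <- cube_block j) V k - \sum_(k <- cube_block j) (lam k)^-1.
set Q := (\sum_(j <oo) _)%E in Qfin.
have Q0 : (0 <= Q)%E.
  by apply: nneseries_ge0 => j _ _; rewrite lee_fin mulr_ge0 ?sqr_ge0.
have Qf : Q \is a fin_num by rewrite ge0_fin_numE.
have Qn n : \sum_(0 <= j < n) (j.+1%:R ^+ 2 * dl j ^+ 2) <= fine Q.
  rewrite -lee_fin fineK// -sumEFin; apply: nneseries_lim_ge => j _ _.
  by rewrite lee_fin mulr_ge0 ?sqr_ge0.
have cdl : cvgn (series dl).
  apply: normed_cvg; apply: nondecreasing_is_cvgn.
    by apply: nondecreasing_series => j _ _; exact: normr_ge0.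
  exists (fine Q + 2) => _ [n _ <-]; rewrite /series/=.
  apply: le_trans (lerD (Qn n) (sum_inv_sqr_le R n)).
  rewrite -big_split/=; apply: ler_sum => j _.
  have j0 : 0 < j.+1%:R :> R by rewrite ltr0n.
  (* With m = j + 1 this reads 2 |d| <= m^2 d^2 + m^-2, which is the purpose of the weight m^2. *)
  have : 0 <= (j.+1%:R * `|dl j| - j.+1%:R^-1) ^+ 2 by exact: sqr_ge0.
  rewrite -[dl j ^+ 2]real_normK ?num_real// sqrrB exprMn exprVn.
  have -> : j.+1%:R * `|dl j| * j.+1%:R^-1 = `|dl j| by rewrite mulrAC divff ?mul1r ?gt_eqF.
  have := normr_ge0 (dl j); rewrite mulr2n.
  by move: (j.+1%:R ^- 2) (j.+1%:R ^+ 2 * `|dl j| ^+ 2) (`|dl j|) => x y z; lra.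
have [l0 cl0] : exists l : R, (S (j.+1 ^ 3)%N - g (j.+1 ^ 3)%N) @[j --> \oo] --> l.
  move/cvg_ex : cdl => [l cl]; exists (l + (S (1 ^ 3)%N - g (1 ^ 3)%N)).
  have -> : (fun j => S (j.+1 ^ 3)%N - g (j.+1 ^ 3)%N) =
     (fun j => series dl j + (S (1 ^ 3)%N - g (1 ^ 3)%N)).
    apply/funext; elim=> [|j ih]; first by rewrite /series/= big_geq// add0r.
    by rewrite /series/= big_nat_recr//= /dl !block; move: ih; rewrite /series/= /S /g; lra.
  by apply: cvgD; [exact: cl|exact: cvg_cst].
have g0 : (g (j.+2 ^ 3)%N - g (j.+1 ^ 3)%N) @[j --> \oo] --> (0 : R).
  apply: (@squeeze_cvgr _ _ _ _ (fun=> 0) (fun j => 7 / a * j.+1%:R^-1)).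
  - apply: nearW => j; rewrite /g -block; apply/andP; split.
      rewrite /cube_block big_seq sumr_ge0// => k; rewrite mem_index_iota => /andP[jk _].
      by rewrite invr_ge0 ltW// lam_gt0//; apply: leq_trans jk.
    apply: (@le_trans _ _ (7 * j.+1%:R ^+ 2 * (a * j.+1%:R ^+ 3)^-1)).
      apply: sum_cube_block_le => [|k]; last exact: inv_lam_le.
      by rewrite invr_ge0 mulr_ge0 ?exprn_ge0// ltW.
    rewrite le_eqVlt; apply/orP; left; apply/eqP.
    have : j.+1%:R != 0 :> R by rewrite pnatr_eq0.
    by move: (j.+1%:R : R) => x x0; field; rewrite x0 gt_eqF.
  - exact: cvg_cst.
  - rewrite -[X in _ --> X](mulr0 (7 / a)).
    by apply: cvgM; [exact: cvg_cst|exact: cvg_harmonic].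
have [l1 cl1] := harmonic_ln_cvg.
exists (l0 + l1).
have -> : (fun n => S n - ln n%:R / a) = (fun n => (S n - g n) + (g n - ln n%:R / a)).
  by apply/funext => n; rewrite addrA subrK.
apply: cvgD => //; apply: cvg_along_cubes => //; apply: nd => // k /lam_gt0/ltW.
by rewrite invr_ge0.
Qed.

End ExpSum.

Section ExpSumAE.
Context d (T : measurableType d) (R : realType) (P : probability T R).

Lemma prob1_ae (A : set T) : measurable A -> P A = 1%E -> {ae P, forall w, A w}.
Proof.
move=> mA A1; exists (~` A); split; [exact: measurableC| |by []].
by apply: etrans (probability_setC P mA) _; rewrite A1 subee.
Qed.

(** With m = j + 1, block j has mean squared deviation at most 28 / (a^2 m^4), where 28 is 4 from
    [integral_sqr_dev] times 7 from the block size. The weight m^2 leaves a summable bound, so the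
    weighted series is almost surely finite. *)
Lemma exp_sum_ln_cvg (a c : R) (V : nat -> T -> R) :
  0 < a -> 0 <= c -> (forall k, measurable_fun setT (V k)) ->
  (forall k (t : R), (0 < k)%N -> 0 <= t ->
    P [set w | t < V k w] = (expR (- ((a * k%:R + c) * t)))%:E) ->
  (forall j k (s t : R), (0 < j)%N -> (0 < k)%N -> j != k -> 0 <= s -> 0 <= t ->
    P ([set w | s < V j w] `&` [set w | t < V k w]) =
    (expR (- ((a * j%:R + c) * s)) * expR (- ((a * k%:R + c) * t)))%:E) ->
  {ae P, forall w, exists l : R,
    (\sum_(1 <= k < n.+1) V k w - ln n%:R / a) @[n --> \oo] --> l}.
Proof.
move=> a0 c0 mV V1 V2.
(* The tails make [V k] positive only almost surely; the truncation is nonnegative everywhere and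
   has the same tails. *)
pose U k w := Num.max (V k w) 0.
have U0 k w : 0 <= U k w by rewrite /U le_max lexx orbT.
have mU k : measurable_fun setT (U k) by apply: measurable_maxr => //; exact: measurable_cst.
have Ut k (t : R) : 0 <= t -> [set w | t < U k w] = [set w | t < V k w].
  move=> t0; apply/seteqP; split => w /=; rewrite /U lt_max; last by move=> ->.
  by move=> /orP[//|]; rewrite ltNge t0.
pose lam (k : nat) : R := a * k%:R + c.
have lam0 k : (0 < k)%N -> 0 < lam k by move=> k0; rewrite /lam ltr_pwDl// mulr_gt0// ltr0n.
have U1 k (t : R) : (0 < k)%N -> 0 <= t -> P [set w | t < U k w] = (expR (- (lam k * t)))%:E.
  by move=> k0 t0; rewrite Ut// V1.
have U2 j k (s t : R) : (0 < j)%N -> (0 < k)%N -> j != k -> 0 <= s -> 0 <= t ->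
    P ([set w | s < U j w] `&` [set w | t < U k w]) =
    (expR (- (lam j * s)) * expR (- (lam k * t)))%:E.
  by move=> j0 k0 jk s0 t0; rewrite !Ut// V2.
pose f j w : \bar R := (j.+1%:R ^+ 2 *
   (\sum_(k <- cube_block j) U k w - \sum_(k <- cube_block j) (lam k)^-1) ^+ 2)%:E.
have f0 j w : (0 <= f j w)%E by rewrite lee_fin mulr_ge0 ?sqr_ge0.
have mg j : measurable_fun setT (fun w => ((\sum_(k <- cube_block j) U k w -
     \sum_(k <- cube_block j) (lam k)^-1) ^+ 2)%:E).
  apply/measurable_EFinP; apply: measurable_funX; apply: measurable_funB.
    exact: measurable_sum.
  exact: measurable_cst.
have mf j : measurable_fun setT (f j).
  apply: eq_measurable_fun (emeasurable_funM (@measurable_cst _ _ _ _ setT (j.+1%:R ^+ 2)%:E) (mg j)).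
  by move=> w _; rewrite /f EFinM.
have If : (\int[P]_w (\sum_(j <oo) f j w) < +oo)%E.
  rewrite integral_nneseries//.
  apply: (@le_lt_trans _ _ (28 / a ^+ 2 * 2)%:E); last by rewrite ltry.
  apply: (@le_trans _ _ (\sum_(j <oo) (28 / a ^+ 2 * (j.+1%:R ^+ 2)^-1)%:E)%E); last first.
    apply: bounded_nneseries => [j|n].
      by rewrite mulr_ge0 ?invr_ge0 ?exprn_ge0// divr_ge0 ?exprn_ge0// ltW.
    rewrite -mulr_sumr; apply: ler_wpM2l; first by rewrite divr_ge0 ?exprn_ge0// ltW.
    exact: sum_inv_sqr_le.
  apply: lee_nneseries => [j _ _|j _].
    by apply: integral_ge0 => w _; exact: f0.
  rewrite /f; under eq_integral do rewrite EFinM.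
  rewrite ge0_integralZl_EFin ?exprn_ge0//; last by move=> w _; rewrite lee_fin sqr_ge0.
  have h := @integral_sqr_dev _ _ _ P U lam (fun k => (0 < k)%N) mU U0 lam0 U1 U2
     (cube_block j) (iota_uniq _ _).
  apply: (@le_trans _ _ ((j.+1%:R ^+ 2)%:E * (4 * \sum_(k <- cube_block j) ((lam k)^-1 * (lam k)^-1))%:E)%E).
    apply: lee_wpmul2l; first by rewrite lee_fin exprn_ge0.
    apply: h; apply/allP => k; rewrite mem_index_iota => /andP[+ _].
    exact: leq_trans.
  rewrite -EFinM lee_fin.
  have j0 : 0 < j.+1%:R ^+ 2 :> R by rewrite exprn_gt0// ltr0n.
  have := ler_wpM2l (ltW j0) (sum_inv_lam_sqr a0 c0 j).
  rewrite -/(lam _).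
  have -> : j.+1%:R ^+ 2 * (7 / a ^+ 2 * (j.+1%:R ^+ 2)^-1 * (j.+1%:R ^+ 2)^-1) =
    7 / a ^+ 2 * (j.+1%:R ^+ 2)^-1 :> R.
    have : j.+1%:R != 0 :> R by rewrite pnatr_eq0.
    by move: (j.+1%:R : R) => x x0; field; rewrite x0 gt_eqF.
  set q := \sum_(k <- _) _; set z := 7 / _ * _ => hz.
  have -> : 28 / a ^+ 2 * (j.+1%:R ^+ 2)^-1 = 4 * z by rewrite /z; ring.
  by lra.
have mF : measurable_fun setT (fun w => \sum_(j <oo) f j w)%E.
  by apply: ge0_emeasurable_sum => [j w _ _|j _].
have aef : {ae P, forall w, setT w -> (\sum_(j <oo) f j w)%E \is a fin_num}.
  apply: integrable_ae => //; apply/integrableP; split => //.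
  under eq_integral do rewrite gee0_abs ?nneseries_ge0//.
  exact: If.
have aep : {ae P, forall w, forall k, (0 < k)%N -> 0 < V k w}.
  apply: ae_foralln => k; case: k => [|k]; first exact: nearW.
  apply: filterS (@prob1_ae [set w | 0 < V k.+1 w] _ _) => //.
  - by apply: measurable_gtr => //; exact: measurable_cst.
  - by rewrite V1// mulr0 oppr0 expR0.
near=> w; have wp : forall k, (0 < k)%N -> 0 < V k w by near: w.
have wf : (\sum_(j <oo) f j w)%E \is a fin_num by near: w; apply: filterS aef => w; exact.
apply: (exp_sum_ln_cvg_det a0 c0); first by move=> k /wp/ltW.
have UV k : (0 < k)%N -> U k w = V k w by move=> /wp h; rewrite /U max_l// ltW.
move: wf; rewrite ge0_fin_numE ?nneseries_ge0//; apply: le_lt_trans.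
rewrite le_eqVlt; apply/orP; left; apply/eqP; apply: eq_eseriesr => j _.
rewrite /f; congr (_ * (_ - _) ^+ 2)%:E; apply: eq_big_seq => k.
by rewrite mem_index_iota => /andP[/(leq_ltn_trans (leq0n _)) k0 _]; rewrite UV.
Unshelve. all: by end_near. Qed.

End ExpSumAE.

(** * Attachment histories and the jump clocks along them *)

Section Path.
Variable (b : bool).
Implicit Types (s : nat -> nat) (n m i k : nat).

(** In Model B one more process than nodes is running: a jump of BI_(k+1) at step k stands for the
    self loop of v_(k+1). *)
Definition valid s n := forall k, (1 <= k < n)%N -> (1 <= s k <= k + b)%N.

(* With [s m] the index of the process jumping at step [m], this is the number of
   jumps of BI_i before step [n]. A pair [(i, k)] names the [k]-th holding time of
   BI_i, so [active s n] lists the clocks running at step [n]. *)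
Definition kap s n i : nat := \sum_(1 <= m < n) (s m == i).

Definition chosen s n : nat * nat := (s n, (kap s n (s n)).+1).

Definition active s n : seq (nat * nat) :=
  [seq (i, (kap s n i).+1) | i <- iota 1 (n + b)].

Definition upd s n j : nat -> nat := fun k => if k == n then j else s k.

Lemma kapS s n i : (0 < n)%N -> kap s n.+1 i = (kap s n i + (s n == i))%N.
Proof. by move=> n0; rewrite /kap big_nat_recr. Qed.

Lemma eq_kap s s' n i : (forall k, (1 <= k < n)%N -> s k = s' k) -> kap s n i = kap s' n i.
Proof. by move=> e; apply: eq_big_nat => k /e ->. Qed.

Lemma kap0 s n i : valid s n -> (n + b <= i)%N -> kap s n i = 0%N.
Proof.
move=> vs ni; rewrite /kap big_nat_cond big1// => k /andP[kn _].
by have := vs _ kn; case: eqP => //; lia.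
Qed.

Lemma kap_first s n : kap s 1 n = 0%N.
Proof. by rewrite /kap big_geq. Qed.

Lemma validS s n : valid s n.+1 -> valid s n.
Proof. by move=> vs k kn; apply: vs; lia. Qed.

Lemma valid_le s m n : (m <= n)%N -> valid s n -> valid s m.
Proof. by move=> mn vs k km; apply: vs; lia. Qed.

Lemma eq_valid s s' n : (forall k, (1 <= k < n)%N -> s k = s' k) -> valid s n -> valid s' n.
Proof. by move=> e vs k kn; rewrite -e//; exact: vs. Qed.

Lemma valid_upd s n j : (1 <= j <= n + b)%N -> valid s n -> valid (upd s n j) n.+1.
Proof.
move=> jn vs k kn; rewrite /upd; case: eqP => [->//|kne]; apply: vs; lia.
Qed.

Lemma mem_active s n i k :
  ((i, k) \in active s n) = (1 <= i <= n + b)%N && (k == (kap s n i).+1).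
Proof.
apply/mapP/idP => [[j]|/andP[h /eqP ->]].
  by rewrite mem_iota => h [-> ->]; rewrite eqxx andbT; lia.
by exists i => //; rewrite mem_iota; lia.
Qed.

Lemma chosen_active s n : (1 <= s n <= n + b)%N -> chosen s n \in active s n.
Proof. by move=> h; rewrite mem_active h eqxx. Qed.

Lemma active_uniq s n : uniq (active s n).
Proof. by rewrite map_inj_uniq ?iota_uniq// => i j []. Qed.

Lemma sum_kap s n : (0 < n)%N -> valid s n ->
  (\sum_(i <- iota 1 (n + b)) kap s n i = n.-1)%N.
Proof.
move=> n0 vs; rewrite exchange_big/=.
rewrite (eq_big_nat _ _ (F2 := fun=> 1%N)); last first.
  move=> k kn; have h := vs _ kn.
  rewrite (bigD1_seq (s k))//= ?iota_uniq ?mem_iota//; last by lia.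
  by rewrite eqxx big1 ?addn0// => i; rewrite eq_sym => /negbTE ->.
by rewrite sum_nat_const_nat muln1; lia.
Qed.

Lemma sum_BI_start n : (0 < n)%N -> (\sum_(i <- iota 1 n) BI_start i = n.+1)%N.
Proof.
case: n => // n _; elim: n => [|n ih]; first by rewrite big_seq1.
by rewrite -[n.+2]addn1 iotaD big_cat/= ih big_seq1 /BI_start; case: eqP; lia.
Qed.

(** Self loops fit without a special case: a node born with one has degree 2, the starting value 1
    plus the jump its process made at the step of its arrival. *)
Lemma deg_kap s n i : (0 < n)%N -> valid s n ->
  deg s n i = (if 1 <= i <= n then BI_start i + kap s n i else 0)%N.
Proof.
case: n => // n _; elim: n => [|n ih] vs.
  by rewrite /= kap_first addn0 /BI_start; case: i => [|[|i]].
rewrite [LHS]/= -/(deg s n.+1 i) ih; last exact: validS.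
rewrite (@kapS s n.+1)//; have vn : (1 <= s n.+1 <= n.+1 + b)%N by apply: vs; lia.
have b1 := leq_b1 b.
case: (i =P n.+2) => [->|ni].
  rewrite ifF; last by lia.
  rewrite ifT; last by lia.
  by rewrite (kap0 (n := n.+1)); [rewrite /BI_start/=; lia|exact: validS|lia].
case: ifP => h; [rewrite ifT; last by lia|rewrite ifF; last by lia].
  by lia.
by case: eqP; lia.
Qed.

Section Rates.
Variables (R : realType) (delta : R).

Definition rate (x : nat * nat) : R := BI_rate delta x.1 x.2.

Definition Lam n : R := (2 + delta) * n%:R + b%:R * (1 + delta).

Definition qstep s n : R := rate (chosen s n) / Lam n.

(** The starting values add up to n + b + 1 and the jumps made so far to n - 1, whatever the
    history. *)
Lemma sum_rate_active s n : (0 < n)%N -> valid s n ->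
  \sum_(x <- active s n) rate x = Lam n.
Proof.
move=> n0 vs; rewrite big_map /=.
under eq_bigr do rewrite /rate /BI_rate/= -/(kap _ _ _).
rewrite big_split/= -natr_sum big_split/= sum_kap// sum_BI_start; last by lia.
rewrite (_ : (_ + n.-1)%N = (2 * n + b)%N); last by lia.
rewrite big_const_seq count_predT size_iota iter_addr addr0 -[delta *+ _]mulr_natl.
by rewrite /Lam natrD natrM natrD; ring.
Qed.

Lemma kap_upd s n j i : kap (upd s n j) n i = kap s n i.
Proof. by apply: eq_kap => k kn; rewrite /upd; case: eqP => //; lia. Qed.

Lemma chosen_upd s n j : chosen (upd s n j) n = (j, (kap s n j).+1).
Proof. by rewrite /chosen /upd eqxx -/(upd s n j) kap_upd. Qed.

Lemma Lam_gt0 n : 0 <= delta -> (0 < n)%N -> 0 < Lam n.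
Proof.
move=> d0 n0; rewrite /Lam ltr_pwDl//; first by rewrite mulr_gt0 ?ltr0n//; lra.
by rewrite mulr_ge0//; lra.
Qed.

Lemma rate_gt0 x : 0 <= delta -> 0 < rate x.
Proof.
move=> d0; rewrite /rate /BI_rate ltr_pwDl// ltr0n addn_gt0 /BI_start.
by case: eqP.
Qed.

Lemma sum_qstep s n : 0 <= delta -> (0 < n)%N -> valid s n ->
  \sum_(1 <= j < (n + b).+1) qstep (upd s n j) n = 1.
Proof.
move=> d0 n0 vs; transitivity ((\sum_(x <- active s n) rate x) / Lam n).
  rewrite big_map /index_iota subSS subn0 -mulr_suml; congr (_ / _).
  by apply: eq_bigr => j _; rewrite chosen_upd.
by rewrite sum_rate_active// divff// gt_eqF// Lam_gt0.
Qed.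

Lemma eq_active s s' n : (forall k, (1 <= k < n)%N -> s k = s' k) -> active s n = active s' n.
Proof. by move=> h; apply: eq_map => i; rewrite (eq_kap _ h). Qed.

Lemma eq_chosen s s' n : (forall k, (1 <= k <= n)%N -> s k = s' k) -> (0 < n)%N ->
  chosen s n = chosen s' n.
Proof.
by move=> h n0; rewrite /chosen h ?n0 ?leqnn// (@eq_kap s s')// => k kn; apply: h; lia.
Qed.

Lemma qstep_upd s m j k : (k < m)%N ->
  qstep (upd s m.+1 j) k.+1 = qstep s k.+1.
Proof.
move=> km; rewrite /qstep (@eq_chosen (upd s m.+1 j) s)// => l lk.
by rewrite /upd; case: eqP => //; lia.
Qed.

Lemma sum_prod_qstep_upd s m : 0 <= delta -> valid s m.+1 ->
  \sum_(1 <= j < (m.+1 + b).+1) \prod_(0 <= k < m.+1) qstep (upd s m.+1 j) k.+1 =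
  \prod_(0 <= k < m) qstep s k.+1.
Proof.
move=> d0 vs; transitivity ((\prod_(0 <= k < m) qstep s k.+1) *
    \sum_(1 <= j < (m.+1 + b).+1) qstep (upd s m.+1 j) m.+1); last first.
  by rewrite sum_qstep// mulr1.
rewrite mulr_sumr; apply: eq_bigr => j _; rewrite big_nat_recr//=; congr (_ * _).
by apply: eq_big_nat => k /andP[_ km]; rewrite qstep_upd.
Qed.

(* What is left of the holding times after [m] events along [s]: at each event the
   elapsed time, that of the chosen clock, is subtracted from all running clocks.
   Hence [clock e s m] is T_(m+1) and [gap e s m] is T_(m+2) - T_(m+1). *)
Fixpoint resid (e : nat * nat -> R) s m : nat * nat -> R :=
  if m is m'.+1 then
    fun x => if x \in active s m'.+1 then resid e s m' x - resid e s m' (chosen s m'.+1)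
             else resid e s m' x
  else e.

Definition gap e s m : R := resid e s m (chosen s m.+1).

(** The clocks [e] realise the history [s], with the k-th gap above [v k]. Strictness excludes ties,
    so that the history is determined by the clocks. *)
Definition follows e s (v : nat -> R) m : Prop := forall k, (k < m)%N ->
  v k < gap e s k /\ forall x, x \in active s k.+1 -> x != chosen s k.+1 ->
    gap e s k < resid e s k x.

Definition clock e s m : R := \sum_(0 <= k < m) gap e s k.

Lemma followsS e s v m : follows e s v m.+1 <-> follows e s v m /\
  (v m < gap e s m /\ forall x, x \in active s m.+1 -> x != chosen s m.+1 ->
    gap e s m < resid e s m x).
Proof.
split=> [h|[h1 h2] k]; first by split; [move=> k km; apply: h; lia|exact: h].
by rewrite ltnS leq_eqVlt => /predU1P[->//|]; exact: h1.
Qed.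

Lemma follows_le e s v m n : (m <= n)%N -> follows e s v n -> follows e s v m.
Proof. by move=> mn h k km; apply: h; lia. Qed.

Lemma eq_resid e s s' m : (forall k, (1 <= k <= m)%N -> s k = s' k) ->
  resid e s m = resid e s' m.
Proof.
elim: m => // m ih h; apply/funext => x /=.
rewrite ih; last by move=> k km; apply: h; lia.
by rewrite (@eq_active s s')// ?(@eq_chosen s s')// => k km; apply: h; lia.
Qed.

Lemma eq_gap e s s' m : (forall k, (1 <= k <= m.+1)%N -> s k = s' k) ->
  gap e s m = gap e s' m.
Proof.
move=> h; rewrite /gap (@eq_chosen s s')// (@eq_resid e s s')// => k km; apply: h; lia.
Qed.

Lemma eq_follows e s s' v m : (forall k, (1 <= k <= m)%N -> s k = s' k) ->
  follows e s v m -> follows e s' v m.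
Proof.
move=> h fs k km; have [f1 f2] := fs k km.
have hk l : (1 <= l <= k.+1)%N -> s l = s' l by move=> ?; apply: h; lia.
rewrite -(eq_gap e hk) -(eq_chosen hk)// -(@eq_active s s'); last first.
  by move=> l lk; apply: hk; lia.
by split=> //; rewrite -(@eq_resid e s s')// => l lk; apply: hk; lia.
Qed.

(** At the first disagreement both histories see the same residual clocks, and each of the two
    chosen clocks would have to be strictly smaller than the other. *)
Lemma follows_inj e s s' v v' m : valid s m.+1 -> valid s' m.+1 ->
  follows e s v m -> follows e s' v' m -> forall k, (1 <= k <= m)%N -> s k = s' k.
Proof.
elim: m => [vs vs' _ _ k|m ih vs vs' /followsS[f1 f2] /followsS[g1 g2] k km]; first by lia.
have h := ih (validS vs) (validS vs') f1 g1.
have [|km'] := leqP k m; first by move=> km'; apply: h; lia.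
have {km km'}-> : k = m.+1 by lia.
apply/eqP/negPn/negP => ne.
have ea : active s m.+1 = active s' m.+1 by apply: eq_active => l lk; apply: h; lia.
have er : resid e s m = resid e s' m by apply: eq_resid.
have nc : chosen s m.+1 != chosen s' m.+1.
  by apply: contra ne => /eqP[-> _].
have s1 := vs m.+1 (ltnSn _); have s1' := vs' m.+1 (ltnSn _).
have := f2.2 (chosen s' m.+1); rewrite ea eq_sym => /(_ (chosen_active s1') nc).
have := g2.2 (chosen s m.+1); rewrite -ea => /(_ (chosen_active s1) nc).
by rewrite /gap -er => l2 l1; move: (lt_trans l1 l2); rewrite ltxx.
Qed.


(** * The recursion for the event times, read off the clocks *)

Section Deterministic.
Variables (e : nat -> nat -> R) (s : nat -> nat).
Let eu (x : nat * nat) := e x.1 x.2.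
Let tau := jump_time e.
Hypothesis e0 : forall i k, (0 < i)%N -> (0 < k)%N -> 0 < e i k.
Hypothesis vs : forall n, valid s n.
Hypothesis fs : forall m, follows eu s (fun=> 0) m.

(** This is T^A_i or T^B_(i-1); truncated subtraction accounts for T^B_0 = T^B_1 = 0. *)
Definition birth_time i := clock eu s (i.-1 - b).

(** Common form of [TAs] and [TBs], which differ only in the number of initial zeros. *)
Fixpoint times (t : nat -> nat -> R) m : seq R :=
  if m is m'.+1 then let u := times t m' in rcons u (next_time t u) else nseq b.+1 0.

Let gap_gt0 m : 0 < gap eu s m.
Proof. by have /followsS[_ [h _]] := @fs m.+1. Qed.

Let resid_ge m x : x \in active s m.+1 -> gap eu s m <= resid eu s m x.
Proof.
move=> xA; have /followsS[_ [_ h]] := @fs m.+1.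
by have [->//|xc] := eqVneq x (chosen s m.+1); exact/ltW/h.
Qed.

Lemma clockS m : clock eu s m.+1 = clock eu s m + gap eu s m.
Proof. by rewrite /clock big_nat_recr. Qed.

Lemma clock_lt m : clock eu s m < clock eu s m.+1.
Proof. by rewrite clockS ltrDl gap_gt0. Qed.

Lemma jump_time0 i : tau i 0 = 0.
Proof. by rewrite /tau /jump_time big_geq. Qed.

Lemma jump_timeS i k : tau i k.+1 = tau i k + e i k.+1.
Proof. by rewrite /tau /jump_time big_nat_recr. Qed.

Lemma jump_time_nd i k l : (0 < i)%N -> (k <= l)%N -> tau i k <= tau i l.
Proof.
move=> i0; elim: l => [|l ih]; first by rewrite leqn0 => /eqP ->.
rewrite leq_eqVlt ltnS => /predU1P[->//|/ih h].
by rewrite jump_timeS (le_trans h)// lerDl ltW// e0.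
Qed.

Let sP n : (0 < n)%N -> (1 <= s n <= n + b)%N.
Proof. by move=> n0; apply: (@vs n.+1); lia. Qed.

Lemma resid_fresh m i k : ((kap s m.+1 i).+1 < k)%N \/ (m.+1 + b < i)%N ->
  resid eu s m (i, k) = e i k.
Proof.
elim: m => [//|m ih] h /=; rewrite mem_active ifF; last first.
  by move: h; rewrite (@kapS s m.+1)//; lia.
by apply: ih; move: h; rewrite (@kapS s m.+1)//; lia.
Qed.

Lemma gap_chosen m : gap eu s m = resid eu s m (s m.+1, (kap s m.+1 (s m.+1)).+1).
Proof. by []. Qed.

(** Passes from remaining to absolute time. In the step, BI_i has just started or has just jumped,
    and then its clock is fresh, or its clock loses one gap. *)
Lemma resid_active m i : (1 <= i <= m.+1 + b)%N ->
  resid eu s m (i, (kap s m.+1 i).+1) =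
  birth_time i + tau i (kap s m.+1 i).+1 - clock eu s m.
Proof.
elim: m i => [|m ih] i im.
  rewrite /= /birth_time kap_first (_ : (i.-1 - b)%N = 0%N); last by lia.
  by rewrite addrAC subrr add0r jump_timeS jump_time0 add0r.
have [inew|iold] := eqVneq i (m.+2 + b)%N.
  have k0 : kap s m.+2 i = 0%N by apply: kap0; [exact: vs|rewrite inew].
  rewrite k0 /= mem_active ifF; last by lia.
  rewrite resid_fresh; last by right; lia.
  rewrite /birth_time (_ : (i.-1 - b)%N = m.+1); last by lia.
  by rewrite jump_timeS jump_time0; ring.
have im' : (1 <= i <= m.+1 + b)%N by lia.
rewrite (@kapS s m.+1)//; case: (s m.+1 =P i) => si.
  rewrite addn1 /= mem_active ifF; last by lia.
  rewrite resid_fresh; last by left; lia.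
  by rewrite clockS gap_chosen si ih// [in RHS]jump_timeS; ring.
rewrite addn0 /= mem_active im' eqxx/= ih// -/(gap eu s m) clockS.
by ring.
Qed.

Lemma jumped_before m i : (1 <= i <= m.+1 + b)%N ->
  birth_time i + tau i (kap s m.+1 i) <= clock eu s m.
Proof.
elim: m i => [|m ih] i im.
  rewrite /birth_time kap_first (_ : (i.-1 - b)%N = 0%N); last by lia.
  by rewrite jump_time0 addr0.
have [inew|iold] := eqVneq i (m.+2 + b)%N.
  have k0 : kap s m.+2 i = 0%N by apply: kap0; [exact: vs|rewrite inew].
  rewrite k0 jump_time0 addr0 /birth_time (_ : (i.-1 - b)%N = m.+1)//; last by lia.
have im' : (1 <= i <= m.+1 + b)%N by lia.
rewrite (@kapS s m.+1)//; case: (s m.+1 =P i) => si.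
  rewrite addn1 clockS gap_chosen si resid_active//; lra.
by rewrite addn0 (le_trans (ih _ im'))// ltW// clock_lt.
Qed.

Lemma not_jumped_yet m i : (1 <= i <= m.+1 + b)%N ->
  clock eu s m < birth_time i + tau i (kap s m.+1 i).+1.
Proof.
move=> im; rewrite -subr_gt0 -resid_active//.
by apply: lt_le_trans (gap_gt0 m) _; apply: resid_ge; rewrite mem_active im eqxx.
Qed.

(** The infimum in [next_time] is attained at the chosen clock: jumps already counted by [kap] are
    past, and a later jump of any process comes no earlier than its next one, whose residual time is
    at least the gap. *)
Lemma timesP m : size (times tau m) = (m + b).+1 /\
  forall i, (i <= m + b)%N -> nth 0 (times tau m) i = clock eu s (i - b).
Proof.
elim: m => [|m [sz nt]].
  split; first by rewrite size_nseq.
  move=> i ib; rewrite nth_nseq (_ : (i - b)%N = 0%N) ?if_same; last by lia.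
  by rewrite /clock big_geq.
split=> /=; first by rewrite size_rcons sz.
move=> i im; rewrite nth_rcons sz; case: ifP => [h|h]; first by apply: nt; lia.
rewrite ifT; last by lia.
have -> : (i - b)%N = m.+1 by lia.
have lst : last 0 (times tau m) = clock eu s m.
  rewrite -nth_last sz/= nt//; congr clock; lia.
have [sm1 sm2] : (1 <= s m.+1)%N /\ (s m.+1 <= m.+1 + b)%N by have := @sP m.+1 isT; lia.
have birth j : (1 <= j <= m.+1 + b)%N -> nth 0 (times tau m) j.-1 = birth_time j.
  by move=> jm; rewrite nt//; lia.
rewrite /next_time sz lst; set S := [set _ | _].
have lbS : lbound S (clock eu s m.+1).
  move=> r [j [k [jm k0 -> lt_r]]].
  have jm' : (1 <= j <= m.+1 + b)%N by lia.
  move: lt_r; rewrite birth// => lt_r.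
  have kk : ((kap s m.+1 j).+1 <= k)%N.
    rewrite ltnNge; apply/negP => kk; move: lt_r; rewrite ltNge => /negP; apply.
    apply: le_trans (jumped_before jm'); rewrite lerD2l.
    by apply: jump_time_nd => //; lia.
  apply: (@le_trans _ _ (birth_time j + tau j (kap s m.+1 j).+1)); last first.
    by rewrite lerD2l; apply: jump_time_nd => //; lia.
  rewrite clockS -lerBrDl -resid_active//; apply: resid_ge.
  by rewrite mem_active jm' eqxx.
have Sx : S (clock eu s m.+1).
  exists (s m.+1), (kap s m.+1 (s m.+1)).+1; split => //; [lia| |exact: clock_lt].
  rewrite birth; last by lia.
  by rewrite clockS gap_chosen resid_active; [ring|lia].
apply/eqP; rewrite eq_le; apply/andP; split.
  by apply: ge_inf => //; exists (clock eu s m.+1).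
by apply: lb_le_inf => //; exists (clock eu s m.+1).
Qed.

End Deterministic.
End Rates.
End Path.

Lemma TAs_times (R : realType) (t : nat -> nat -> R) m : TAs t m = times false t m.
Proof. by elim: m => //= m ->. Qed.

Lemma TBs_times (R : realType) (t : nat -> nat -> R) m : TBs t m = times true t m.
Proof. by elim: m => //= m ->. Qed.

(** * The embedded attachment process *)

Section ProbaTools.
Context d (T : measurableType d) (R : realType) (P : probability T R).

Lemma prob_ae_eq (A B : set T) : measurable A -> measurable B ->
  {ae P, forall w, A w <-> B w} -> P A = P B.
Proof.
move=> mA mB [N [mN N0 sN]].
have sub C D : measurable C -> measurable D -> C `<=` D `|` N -> (P C <= P D)%E.
  move=> mC mD CD; rewrite -(measureU0 mD mN N0).
  by apply: le_measure; rewrite ?inE//; exact: measurableU.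
have h w : N w \/ (A w <-> B w).
  by have [?|nw] := pselect (N w); [left|right; apply: contrapT => /sN].
by apply/eqP; rewrite eq_le !sub// => w ?; have [?|[? ?]] := h w; auto; [right|left; auto|right|left; auto].
Qed.

Lemma prob_bigsetU (r : seq nat) (F : nat -> set T) : uniq r ->
  (forall j, measurable (F j)) -> trivIset [set` r] F ->
  P (\big[setU/set0]_(j <- r) F j) = (\sum_(j <- r) P (F j))%E.
Proof.
move=> ur mF tF; rewrite -bigcup_seq measure_fin_bigcup//.
by rewrite [RHS]fsbig_seq.
Qed.

Lemma prob_finite_partition (A : set T) (X : T -> nat) N :
  measurable A -> (forall j, measurable [set w | X w = j]) ->
  (forall w, A w -> (1 <= X w <= N)%N) ->
  P A = (\sum_(1 <= j < N.+1) P (A `&` [set w | X w = j]))%E.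
Proof.
move=> mA mX XN; rewrite -prob_bigsetU ?iota_uniq//.
- congr (P _); rewrite -bigcup_seq; apply/seteqP; split => w.
    by move=> Aw; exists (X w) => //=; rewrite mem_index_iota ltnS; exact: XN.
  by move=> [j _ []].
- by move=> j; exact: measurableI.
- by apply/trivIsetP => i j _ _ ij; apply/seteqP; split => // w [[_ /= e1] [_ /= e2]]; move: ij; rewrite -e1 -e2 eqxx.
Qed.

End ProbaTools.

Definition seqfun (l : seq nat) : nat -> nat := nth 0%N l.

Lemma seqfun_map (s : nat -> nat) m k : (k <= m)%N -> seqfun (map s (iota 0 m.+1)) k = s k.
Proof. by move=> km; rewrite /seqfun (nth_map 0%N) ?size_iota// nth_iota. Qed.

(* Enumerates the finite prefixes of histories. *)
Definition decode_path n : nat -> nat := seqfun (odflt [::] (unpickle n)).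

Lemma decode_pathK (s : nat -> nat) m k : (k <= m)%N ->
  decode_path (pickle (map s (iota 0 m.+1))) k = s k.
Proof. by move=> km; rewrite /decode_path pickleK seqfun_map. Qed.

Section Agrees.
Context d (T : measurableType d).

Definition agrees (X : nat -> T -> nat) s m : set T :=
  [set w | forall k, (1 <= k <= m)%N -> X k w = s k].

Lemma measurable_agrees X s m : (forall k j, measurable [set w | X k w = j]) ->
  measurable (agrees X s m).
Proof.
move=> mX; rewrite (_ : agrees _ _ _ = \bigcap_k (if (1 <= k <= m)%N then [set w | X k w = s k] else setT)).
  by apply: bigcapT_measurable => k; case: ifP.
apply/seteqP; split => w /=.
  by move=> h k _; case: ifP => // km; exact: h.
by move=> h k km; have := h k I; rewrite km.
Qed.

End Agrees.

Section Embedding.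
Context d (T : measurableType d) (R : realType) (P : probability T R).
Variables (delta : R) (b : bool) (E : nat -> nat -> T -> R).
Hypothesis hdelta : 0 <= delta.
Hypothesis E_meas : forall i k, measurable_fun setT (E i k).
Hypothesis E_indep : mutually_independent P
  (fun ik : nat * nat => (1 <= ik.1)%N /\ (1 <= ik.2)%N) (fun ik => E ik.1 ik.2).
Hypothesis E_exp : forall i k, (1 <= i)%N -> (1 <= k)%N ->
  exp_distributed P (BI_rate delta i k) (E i k).

Let eu w (x : nat * nat) : R := E x.1 x.2 w.

Lemma survival_init : survival P setT 1
  (fun x : nat * nat => (1 <= x.1)%N /\ (1 <= x.2)%N) (rate delta) (fun x w => eu w x).
Proof.
move=> J t uJ okJ t0; rewrite setTI mul1r.
have := E_indep (B := fun j => `]t j, +oo[%classic) uJ okJ (fun j => measurable_itv _).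
have e j : (fun ik : nat * nat => E ik.1 ik.2) j @^-1` `]t j, +oo[ = [set w | t j < eu w j].
  by apply/seteqP; split => w /=; rewrite in_itv/= andbT.
have -> : \big[setI/setT]_(j <- J) ((fun ik : nat * nat => E ik.1 ik.2) j @^-1` `]t j, +oo[) =
    above (fun x w => eu w x) t J.
  elim: J {uJ okJ} => [|j J ih].
    by rewrite big_nil; apply/seteqP; split.
  by rewrite big_cons ih above_cons e.
move=> ->; congr EFin; apply: eq_big_seq => j /okJ[j1 j2].
by rewrite e E_exp.
Qed.

Lemma measurable_resid s m x : measurable_fun setT (fun w => resid b (eu w) s m x).
Proof.
elim: m x => [|m ih] x; first exact: E_meas.
by rewrite /=; case: (x \in _) => //; exact: measurable_funB.
Qed.

Definition path_event s (v : nat -> R) m : set T := [set w | follows b (eu w) s v m].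

Lemma path_eventS s v m : path_event s v m.+1 = path_event s v m `&`
  [set w | v m < resid b (eu w) s m (chosen s m.+1) /\
    forall x, x \in active b s m.+1 -> x != chosen s m.+1 ->
    resid b (eu w) s m (chosen s m.+1) < resid b (eu w) s m x].
Proof. by apply/seteqP; split => w; move/followsS. Qed.

Lemma measurable_path s v m : measurable (path_event s v m).
Proof.
elim: m => [|m ih]; first by rewrite (_ : path_event _ _ _ = setT)//; apply/seteqP; split.
rewrite path_eventS; apply: measurableI => //.
rewrite (_ : [set w | _] = [set w | v m < resid b (eu w) s m (chosen s m.+1)] `&`
   above (fun x w => resid b (eu w) s m x - resid b (eu w) s m (chosen s m.+1)) (fun=> 0)
     [seq x <- active b s m.+1 | x != chosen s m.+1]).
  apply: measurableI.
    apply: measurable_gtr; [exact: measurable_cst|exact: measurable_resid].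
  by apply: measurable_above => x; apply: measurable_funB; exact: measurable_resid.
apply/seteqP; split => w [h1 h2]; split => // x.
  by rewrite mem_filter subr_gt0 => /andP[xc xA]; exact: h2.
by move=> xA xc; have := h2 x; rewrite mem_filter xA xc subr_gt0 => /(_ isT).
Qed.

Lemma path_survival s v m : valid b s m.+1 -> (forall k, 0 <= v k) ->
  survival P (path_event s v m)
    (\prod_(0 <= k < m) (qstep b delta s k.+1 * expR (- (Lam b delta k.+1 * v k))))
    (fun x => (1 <= x.1)%N /\ (kap s m.+1 x.1 < x.2)%N) (rate delta)
    (fun x w => resid b (eu w) s m x).
Proof.
move=> vs v0; elim: m vs => [|m ih] vs.
  rewrite big_geq// (_ : path_event _ _ _ = setT); last by apply/seteqP; split.
  by move=> J t uJ okJ t0; apply: survival_init => // j /okJ[j1]; rewrite kap_first.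
have sm : (1 <= s m.+1 <= m.+1 + b)%N by apply: vs; lia.
have := @survival_min _ _ _ P _ _ _ _ _ _ (active b s m.+1) (chosen s m.+1) (v m)
  (measurable_path s v m) (measurable_resid s m) (ih (validS vs))
  (fun x _ => rate_gt0 x hdelta) (active_uniq _ _ _).
rewrite sum_rate_active//; last exact: validS.
move=> /(_ _ (chosen_active sm) (v0 m)) h.
rewrite path_eventS big_nat_recr//=.
move=> J t uJ okJ t0; apply: h => //.
  move=> x; case: x => i k; rewrite mem_active => /andP[/andP[i1 i2] /eqP ->].
  by split => //=.
move=> x /okJ[x1 x2]; split; last first.
  apply/eqP => xc; move: x2; rewrite xc /chosen/= (@kapS s m.+1)// eqxx; lia.
by split => //; apply: leq_ltn_trans x2; rewrite (@kapS s m.+1)// leq_addr.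
Qed.

Lemma path_prob s v m : valid b s m.+1 -> (forall k, 0 <= v k) ->
  P (path_event s v m) =
  (\prod_(0 <= k < m) (qstep b delta s k.+1 * expR (- (Lam b delta k.+1 * v k))))%:E.
Proof.
move=> vs v0; have := path_survival vs v0 (J := [::]) (t := fun=> 0) isT.
rewrite big_nil mulr1 => <-//.
by congr (P _); apply/seteqP; split => w // [].
Qed.

Definition tie_free m : set T :=
  [set w | exists2 s, valid b s m.+1 & follows b (eu w) s (fun=> 0) m].

Lemma path_prob0 s m : valid b s m.+1 ->
  P (path_event s (fun=> 0) m) = (\prod_(0 <= k < m) qstep b delta s k.+1)%:E.
Proof.
move=> vs; rewrite path_prob//; congr EFin; apply: eq_bigr => k _.
by rewrite mulr0 oppr0 expR0 mulr1.
Qed.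

(** The one-step continuations are disjoint, and as the [qstep] sum to 1 their probabilities already
    add up to that of the path. *)
Lemma ties_null s m : valid b s m.+1 ->
  P (path_event s (fun=> 0) m `\`
     \big[setU/set0]_(1 <= j < (m.+1 + b).+1) path_event (upd s m.+1 j) (fun=> 0) m.+1) = 0%E.
Proof.
move=> vs; set B := \big[_/_]_(_ <= _ < _) _.
have mB : measurable B by apply: bigsetU_measurable => j _; exact: measurable_path.
have jP j : j \in index_iota 1 (m.+1 + b).+1 -> valid b (upd s m.+1 j) m.+2.
  by rewrite mem_index_iota => jm; apply: valid_upd => //; lia.
have BA : B `<=` path_event s (fun=> 0) m.
  rewrite /B -bigcup_seq => w [j _ /(@follows_le _ _ _ _ _ m m.+1 (leqnSn _))].
  by apply: eq_follows => k km; rewrite /upd; case: eqP => //; lia.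
have PB : P B = P (path_event s (fun=> 0) m).
  rewrite /B prob_bigsetU ?iota_uniq//; last 2 first.
  - by move=> j; exact: measurable_path.
  - apply/trivIsetP => i j /jP vi /jP vj ij; apply/seteqP; split => // w [fi fj].
    have := follows_inj vi vj fi fj (k := m.+1).
    by rewrite /upd eqxx ltnS leqnn => /(_ isT) h; move: ij; rewrite h eqxx.
  rewrite path_prob0// (eq_big_seq (fun j =>
     (\prod_(0 <= k < m.+1) qstep b delta (upd s m.+1 j) k.+1)%:E)); last first.
    by move=> j /jP vj; rewrite path_prob0.
  by rewrite sumEFin sum_prod_qstep_upd.
have mP := measurable_path s (fun=> 0) m.
rewrite measureD//; last by rewrite ltey_eq fin_num_measure.
by rewrite setIidr// [X in (_ - X)%E]PB subee// fin_num_measure.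
Qed.

Lemma tie_free_ae : {ae P, forall w, forall m, tie_free m w}.
Proof.
apply: ae_foralln; elim=> [|m ih].
  by apply: nearW => w; exists (fun=> 1%N) => // k; lia.
pose N s := path_event s (fun=> 0) m `\`
     \big[setU/set0]_(1 <= j < (m.+1 + b).+1) path_event (upd s m.+1 j) (fun=> 0) m.+1.
(* Uncountably many histories [s] share countably many prefixes, so a countable union of null sets
   covers all ties. *)
pose M n := if `[< valid b (decode_path n) m.+1 >] then N (decode_path n) else set0.
have nN : P.-negligible (\bigcup_n M n).
  apply: negligible_bigcup => n; rewrite /M; case: asboolP => [vs|_]; last exact: negligible_set0.
  exists (N (decode_path n)); split => //; last exact: ties_null.
  apply: measurableD; first exact: measurable_path.
  by apply: bigsetU_measurable => j _; exact: measurable_path.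
apply: negligibleS (negligibleU ih nN) => w nw.
have [[s vs fs]|ng] := pselect (tie_free m w); [right|by left].
pose l := pickle (map s (iota 0 m.+1)); exists l => //.
have el k : (1 <= k <= m)%N -> s k = decode_path l k by move=> km; rewrite decode_pathK//; lia.
have vl : valid b (decode_path l) m.+1 by apply: eq_valid vs => k km; apply: el; lia.
rewrite /M; case: asboolP => // _; split; first exact: eq_follows fs.
rewrite -bigcup_seq => -[j]; rewrite /= mem_index_iota => jm fj; apply: nw.
exists (upd (decode_path l) m.+1 j) => //; apply: valid_upd => //; lia.
Qed.

(* The value 1 is a default for the null event where clocks tie. *)
Definition choice_of (k : nat) (w : T) : nat :=
  if k is 0 then 1%N else
  if pselect (exists s, valid b s k.+1 /\ follows b (eu w) s (fun=> 0) k) is left h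
  then (projT1 (cid h)) k else 1%N.

Lemma choice_of_valid w n : valid b (choice_of^~ w) n.
Proof.
move=> k /andP[k0 _]; rewrite /choice_of; case: k k0 => // k _.
case: pselect => [h|_]; last by lia.
by case: cid => s /= [vs _]; apply: vs; lia.
Qed.

(** [choice_of] picks a separate witness for each [k]; by [follows_inj] all of them agree with
    [s]. *)
Lemma choice_of_path s v m w : (forall k, 0 <= v k) -> valid b s m.+1 ->
  path_event s v m w -> forall k, (1 <= k <= m)%N -> choice_of k w = s k.
Proof.
move=> v0 vs fs k km.
have f0 : follows b (eu w) s (fun=> 0) k.
  move=> l lk; have [h1 h2] := fs l (leq_trans lk (proj2 (andP km))).
  by split => //; exact: le_lt_trans h1.
have vk : valid b s k.+1 by apply: valid_le vs; lia.
rewrite /choice_of; case: k km f0 vk => // k km f0 vk.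
case: pselect => [h|[]]; last by exists s.
case: cid => s' /= [vs' fs'].
by apply: (follows_inj vs' vk fs' f0); lia.
Qed.

Lemma choice_of_follows w m : tie_free m w -> follows b (eu w) (choice_of^~ w) (fun=> 0) m.
Proof.
move=> [s vs fs]; apply: eq_follows (fs) => k km.
by apply/esym; apply: (@choice_of_path s (fun=> 0) m).
Qed.

Lemma measurable_choice_of k j : measurable [set w | choice_of k w = j].
Proof.
case: k => [|k].
  have [<-|j1] := eqVneq 1%N j.
    by rewrite (_ : [set w | _] = setT)//; apply/seteqP; split.
  by rewrite (_ : [set w | _] = set0)//; apply/seteqP; split => w //= h; move: j1; rewrite h eqxx.
pose M (Q : pred nat) n := let s := decode_path n in
  if `[< valid b s k.+2 /\ Q (s k.+1) >] then path_event s (fun=> 0) k.+1 else set0.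
have mM Q : measurable (\bigcup_n M Q n).
  apply: bigcupT_measurable => n; rewrite /M; case: asboolP => // _; exact: measurable_path.
have MP (Q : pred nat) w : (\bigcup_n M Q n) w <->
    exists s, [/\ valid b s k.+2, Q (s k.+1) & follows b (eu w) s (fun=> 0) k.+1].
  split=> [[n _]|[s [vs qs fs]]].
    rewrite /M; case: asboolP => // -[vs qs] fs.
    by exists (decode_path n).
  pose l := pickle (map s (iota 0 k.+2)); exists l => //.
  have el i : (1 <= i <= k.+1)%N -> s i = decode_path l i by move=> ik; rewrite decode_pathK//; lia.
  rewrite /M; case: asboolP => [_|[]]; first exact: eq_follows fs.
  by split; [apply: eq_valid vs => i ik; apply: el; lia|rewrite -el//; lia].
(* The complement of all paths is added for [j] = 1, the default value. *)
rewrite (_ : [set w | _] = (\bigcup_n M (pred1 j) n) `|`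
    (if j == 1%N then ~` (\bigcup_n M xpredT n) else set0)).
  apply: measurableU => //; case: ifP => // _; exact: measurableC.
apply/seteqP; split => w /=.
  case: pselect => [h|h].
    by case: cid => s /= [vs fs] sj; left; apply/MP; exists s; split => //; apply/eqP.
  by move=> <-; right; rewrite eqxx => /MP[s [vs _ fs]]; apply: h; exists s.
move=> [/MP[s [vs /eqP sj fs]]|].
  by have := @choice_of_path s (fun=> 0) k.+1 w (fun=> lexx _) vs fs k.+1; rewrite /= sj; apply; lia.
case: eqP => // -> h; case: pselect => // -[s [vs fs]].
by exfalso; apply: h; apply/MP; exists s.
Qed.

Definition gap_of k w : R := gap b (eu w) (choice_of^~ w) k.

Lemma measurable_gap_of k : measurable_fun setT (gap_of k).
Proof.
pose A n := agrees choice_of (decode_path n) k.+1.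
have -> : [set: T] = \bigcup_n A n.
  apply/seteqP; split => // w _; exists (pickle (map (choice_of^~ w) (iota 0 k.+2))) => //.
  by move=> i ik; rewrite decode_pathK//; lia.
apply/measurable_fun_bigcup => [n|n].
  by apply: measurable_agrees; exact: measurable_choice_of.
apply: (@eq_measurable_fun _ _ _ _ _ (fun w => gap b (eu w) (decode_path n) k)).
  by move=> w; rewrite inE => Aw; apply: eq_gap => i ik; rewrite Aw.
by apply: measurable_funTS; exact: measurable_resid.
Qed.

Let gaps_above (v : nat -> R) n : set T := [set w | forall k, (k < n)%N -> v k < gap_of k w].

Let measurable_gaps_above v n : measurable (gaps_above v n).
Proof.
rewrite (_ : gaps_above v n = above gap_of v (iota 0 n)).
  by apply: measurable_above; exact: measurable_gap_of.
by apply/seteqP; split => w h k; [rewrite mem_iota add0n; exact: h|move=> kn; apply: h; rewrite mem_iota].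
Qed.

Let measurable_agrees_choice s m : measurable (agrees choice_of s m).
Proof. by apply: measurable_agrees; exact: measurable_choice_of. Qed.

Let measurable_gap_gt k (t : R) : measurable [set w | t < gap_of k w].
Proof. by apply: measurable_gtr; [exact: measurable_cst|exact: measurable_gap_of]. Qed.

Lemma agrees_gaps_prob s v n : valid b s n.+1 -> (forall k, 0 <= v k) ->
  P (agrees choice_of s n `&` gaps_above v n) =
  (\prod_(0 <= k < n) (qstep b delta s k.+1 * expR (- (Lam b delta k.+1 * v k))))%:E.
Proof.
move=> vs v0; rewrite -path_prob//; apply: prob_ae_eq.
- exact: measurableI.
- exact: measurable_path.
apply: filterS tie_free_ae => w tf; split => [[ag gp]|fs].
  have f0 : follows b (eu w) s (fun=> 0) n.
    by apply: eq_follows (choice_of_follows (tf n)) => k; exact: ag.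
  move=> k kn; have [_ h2] := f0 k kn; split => //.
  by rewrite -(@eq_gap _ _ _ (choice_of^~ w) s); [exact: gp|move=> l lk; apply: ag; lia].
have ag := choice_of_path v0 vs fs; split => // k kn.
have [h1 _] := fs k kn.
by rewrite /gap_of (@eq_gap _ _ _ _ s)// => l lk; apply: ag; lia.
Qed.

(** Frees the choices after step m by summing over them one at a time, by induction on their number.
    The exponential factors come out of the sums because [Lam] ignores the history; the case m = 0
    is the independence of the gaps. *)
Lemma agrees_gaps_above_prob s v m n : (m <= n)%N -> valid b s m.+1 -> (forall k, 0 <= v k) ->
  P (agrees choice_of s m `&` gaps_above v n) =
  ((\prod_(0 <= k < m) qstep b delta s k.+1) *
   \prod_(0 <= k < n) expR (- (Lam b delta k.+1 * v k)))%:E.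
Proof.
move=> mn vs v0; move hE : (n - m)%N => h.
elim: h m s mn vs hE => [|h ih] m s mn vs hE.
  have -> : m = n by lia.
  rewrite -big_split; apply: agrees_gaps_prob => //.
  by have <- : m = n by lia.
rewrite (@prob_finite_partition _ _ _ _ _ (choice_of m.+1) (m.+1 + b)); last 3 first.
- exact: measurableI.
- by move=> j; exact: measurable_choice_of.
- by move=> w _; apply: (@choice_of_valid w m.+2); lia.
rewrite (eq_big_nat _ _ (F2 := fun j => ((\prod_(0 <= k < m.+1) qstep b delta (upd s m.+1 j) k.+1) *
   \prod_(0 <= k < n) expR (- (Lam b delta k.+1 * v k)))%:E)).
  by rewrite sumEFin -mulr_suml sum_prod_qstep_upd.
move=> j jm; rewrite -(ih m.+1 (upd s m.+1 j)); [|lia|apply: valid_upd => //; lia|lia].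
congr (P _); rewrite setIAC; congr (_ `&` _); apply/seteqP; split => w.
  by move=> [ag cj] k km; rewrite /upd; case: eqP => [->//|km']; apply: ag; lia.
move=> ag; split; last by have := ag m.+1; rewrite /upd eqxx; apply; lia.
by move=> k km; rewrite ag; [rewrite /upd; case: eqP => //; lia|lia].
Qed.

Lemma gaps_above_prob v n : (forall k, 0 <= v k) ->
  P (gaps_above v n) = (\prod_(0 <= k < n) expR (- (Lam b delta k.+1 * v k)))%:E.
Proof.
move=> v0; have := @agrees_gaps_above_prob (fun=> 1%N) v 0 n (leq0n _).
rewrite big_geq// mul1r => <-//; last by move=> k; lia.
by congr (P _); apply/seteqP; split => [w h|w []//]; split => // k; lia.
Qed.

Lemma gap_of_gt0 : {ae P, forall w, forall k, 0 < gap_of k w}.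
Proof.
apply: filterS tie_free_ae => w tf k.
by have /followsS[_ [h _]] := choice_of_follows (tf k.+1).
Qed.

Lemma gap_of_pair_prob j k (s t : R) : j != k -> 0 <= s -> 0 <= t ->
  P ([set w | s < gap_of j w] `&` [set w | t < gap_of k w]) =
  (expR (- (Lam b delta j.+1 * s)) * expR (- (Lam b delta k.+1 * t)))%:E.
Proof.
(* The zero thresholds cost nothing, since all gaps are almost surely positive. *)
move=> jk s0 t0; pose v i := if i == j then s else if i == k then t else 0.
have v0 i : 0 <= v i by rewrite /v; do 2 case: ifP => // _.
pose n := (maxn j k).+1.
have jn : (j < n)%N by rewrite ltnS leq_maxl.
have kn : (k < n)%N by rewrite ltnS leq_maxr.
transitivity (P (gaps_above v n)).
  apply: prob_ae_eq => //.
    by apply: measurableI; exact: measurable_gap_gt.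
  apply: filterS gap_of_gt0 => w g0; split => [[h1 h2] i _|h].
    by rewrite /v; case: eqP => [->//|_]; case: eqP => [->//|_].
  by split; [have := h j jn; rewrite /v eqxx|have := h k kn; rewrite /v eqxx eq_sym (negbTE jk)].
rewrite gaps_above_prob//; congr EFin.
rewrite (bigD1_seq j) ?mem_index_iota ?iota_uniq//= {1}/v eqxx; congr (_ * _).
have kF : k \in [seq i <- index_iota 0 n | i != j].
  by rewrite mem_filter eq_sym jk mem_index_iota.
rewrite -big_filter (bigD1_seq k kF) ?filter_uniq ?iota_uniq//.
rewrite {1}/v eqxx eq_sym (negbTE jk) big_seq_cond big1; first exact: mulr1.
move=> i /andP[]; rewrite mem_filter => /andP[ij _] ik.
by rewrite /v (negbTE ij) (negbTE ik) mulr0 oppr0 expR0.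
Qed.

Lemma gap_of_prob k (t : R) : 0 <= t ->
  P [set w | t < gap_of k w] = (expR (- (Lam b delta k.+1 * t)))%:E.
Proof.
move=> t0; rewrite (_ : expR _ = expR (- (Lam b delta k.+1 * t)) *
   expR (- (Lam b delta k.+2 * 0))); last by rewrite mulr0 oppr0 expR0 mulr1.
rewrite -gap_of_pair_prob//; last by rewrite neq_ltn ltnSn.
apply: prob_ae_eq.
- exact: measurable_gap_gt.
- by apply: measurableI; exact: measurable_gap_gt.
by apply: filterS gap_of_gt0 => w g0; split => [h|[]//]; split => //=.
Qed.

Lemma choice_of_law s m : P (agrees choice_of s m) =
  (\prod_(1 <= k < m.+1) (if (1 <= s k <= k + b)%N then qstep b delta s k else 0))%:E.
Proof.
have [vs|nvs] := pselect (valid b s m.+1); last first.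
  have [k km sk] : exists2 k, (1 <= k < m.+1)%N & ~~ (1 <= s k <= k + b)%N.
    apply: contrapT => h; apply: nvs => k km; apply/negPn/negP => sk; apply: h; by exists k.
  (* Along an invalid history both sides vanish. *)
  rewrite (bigD1_seq k)/= ?mem_index_iota ?iota_uniq// (negbTE sk) mul0r.
  rewrite (_ : agrees _ _ _ = set0) ?measure0//; apply/seteqP; split => w //= ag.
  move: sk; rewrite -ag; last by lia.
  by move=> /negP; apply; apply: (@choice_of_valid w m.+1).
transitivity (P (agrees choice_of s m `&` gaps_above (fun=> 0) m)).
  apply: prob_ae_eq => //; first exact: measurableI.
  by apply: filterS gap_of_gt0 => w g0; split => [h|[]//]; split => // k _.
rewrite agrees_gaps_prob//; congr EFin.
rewrite [RHS]big_add1/=.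
apply: eq_big_nat => k km; rewrite mulr0 oppr0 expR0 mulr1 ifT//.
by apply: vs; lia.
Qed.

End Embedding.

(** * Uniform smallness of the degrees of late nodes *)

Section Determined.
Context d (T : measurableType d) (X : nat -> T -> nat).
Hypothesis mX : forall k j, measurable [set w | X k w = j].

Definition determined_by (V : Type) (Q : (nat -> nat) -> V) N :=
  forall s s', (forall k, (1 <= k <= N)%N -> s k = s' k) -> Q s = Q s'.

(** Finitely many integer coordinates matter, so the event is a countable union of cylinders. *)
Lemma measurable_determined (Q : (nat -> nat) -> Prop) N :
  determined_by Q N -> measurable [set w | Q (X^~ w)].
Proof.
move=> dQ.
rewrite (_ : [set w | _] = \bigcup_n
    (if `[< Q (decode_path n) >] then agrees X (decode_path n) N else set0)).
  apply: bigcupT_measurable => n; case: asboolP => // _; exact: measurable_agrees.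
apply/seteqP; split => w /=.
  move=> Qw; pose l := pickle (map (X^~ w) (iota 0 N.+1)).
  have el k : (1 <= k <= N)%N -> X k w = decode_path l k.
    by move=> kN; rewrite decode_pathK//; lia.
  exists l => //; rewrite (asboolT _)//.
  by rewrite -(dQ (X^~ w)).
move=> [n _]; case: asboolP => // Qn ag.
by rewrite (dQ _ (decode_path n)).
Qed.

End Determined.

(** * Maximal inequality for nonnegative supermartingales of the history *)

Section Maximal.
Context d (T : measurableType d) (R : realType) (P : probability T R).
Variables (delta : R) (b : bool) (X : nat -> T -> nat).
Hypothesis hdelta : 0 <= delta.
Hypothesis mX : forall k j, measurable [set w | X k w = j].
Hypothesis Xvalid : forall w n, valid b (X^~ w) n.
Hypothesis Xlaw : forall s m, valid b s m.+1 ->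
  P (agrees X s m) = (\prod_(0 <= k < m) qstep b delta s k.+1)%:E.

Lemma agrees_upd s m j : (0 < j)%N ->
  agrees X (upd s m.+1 j) m.+1 = agrees X s m `&` [set w | X m.+1 w = j].
Proof.
move=> j0; apply/seteqP; split => w.
  move=> ag; split; last by have := ag m.+1; rewrite /upd eqxx; apply; lia.
  by move=> k km; rewrite ag; [rewrite /upd; case: eqP => //; lia|lia].
by move=> [ag cj] k km; rewrite /upd; case: eqP => [->//|km']; apply: ag; lia.
Qed.

Lemma prod_qstep_ge0 s m : 0 <= \prod_(0 <= k < m) qstep b delta s k.+1.
Proof.
rewrite big_nat_cond; apply: prodr_ge0 => k _.
by rewrite divr_ge0// ltW ?rate_gt0// Lam_gt0.
Qed.

Variable phi : nat -> (nat -> nat) -> R.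
Hypothesis phi0 : forall m s, 0 <= phi m s.
Hypothesis phi_det : forall m, determined_by (phi m) m.
Hypothesis phi_super : forall m s, valid b s m.+1 ->
  \sum_(1 <= j < (m.+1 + b).+1)
     qstep b delta (upd s m.+1 j) m.+1 * phi m.+1 (upd s m.+1 j) <= phi m s.

Let reached (L : R) m h : set T :=
  [set w | exists k, (m <= k <= m + h)%N /\ L <= phi k (X^~ w)].

Let measurable_reached L m h : measurable (reached L m h).
Proof.
apply: (@measurable_determined _ _ X mX (fun s => exists k, (m <= k <= m + h)%N /\ L <= phi k s) (m + h)).
move=> s s' e; apply/propext; split => -[k [km h1]]; exists k; split => //.
  by rewrite -(phi_det (s := s))// => l lk; apply: e; lia.
by rewrite (phi_det (s' := s'))// => l lk; apply: e; lia.
Qed.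

(** Induction on the horizon. If [phi m s] is at least [L], the bound exceeds the probability of the
    cylinder; otherwise the level is reached after step m, and summing over the next choice uses
    [phi_super]. *)
Lemma reached_prob L h m s : 0 < L -> valid b s m.+1 ->
  (P (agrees X s m `&` reached L m h) <=
   ((\prod_(0 <= k < m) qstep b delta s k.+1) * (phi m s / L))%:E)%E.
Proof.
move=> L0.
have mA m' s' : measurable (agrees X s' m') by exact: measurable_agrees.
have big_phi h' m' s' : valid b s' m'.+1 -> L <= phi m' s' ->
    (P (agrees X s' m' `&` reached L m' h') <=
     ((\prod_(0 <= k < m') qstep b delta s' k.+1) * (phi m' s' / L))%:E)%E.
  move=> vs' Lphi; apply: (@le_trans _ _ (P (agrees X s' m'))).
    by apply: le_measure; rewrite ?inE//; exact: measurableI.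
  by rewrite Xlaw// lee_fin ler_peMr ?prod_qstep_ge0// ler_pdivlMr// mul1r.
elim: h m s => [|h ih] m s vs; have [Lphi|phiL] := leP L (phi m s);
  try exact: (big_phi _ _ _ vs Lphi); have pi0 := prod_qstep_ge0 s m.
  have r0 : 0 <= phi m s / L by rewrite divr_ge0// ltW.
  rewrite (_ : _ `&` _ = set0) ?measure0; first by rewrite lee_fin mulr_ge0.
  apply/seteqP; split => // w [ag [k [km]]].
  have -> : k = m by lia.
  by rewrite leNgt (@phi_det m (X^~ w) s) ?phiL.
apply: (@le_trans _ _ (P (agrees X s m `&` reached L m.+1 h))).
  apply: le_measure; rewrite ?inE; [exact: measurableI|exact: measurableI|].
  move=> w [ag [k [km hk]]]; split => //; exists k; split => //.
  suff : k != m by lia.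
  by apply: contraL hk => /eqP ->; rewrite -ltNge (@phi_det m (X^~ w) s).
rewrite (@prob_finite_partition _ _ _ _ _ (X m.+1) (m.+1 + b)); last 3 first.
- exact: measurableI.
- by move=> j; exact: mX.
- by move=> w _; apply: (@Xvalid w m.+2); lia.
apply: (@le_trans _ _ (\sum_(1 <= j < (m.+1 + b).+1)
   ((\prod_(0 <= k < m) qstep b delta s k.+1) *
    (qstep b delta (upd s m.+1 j) m.+1 * phi m.+1 (upd s m.+1 j)) / L)%:E)%E).
  rewrite [leLHS]big_seq [leRHS]big_seq; apply: lee_sum => j.
  rewrite mem_index_iota => /andP[j0 jm].
  rewrite setIAC -agrees_upd//.
  apply: le_trans (ih m.+1 (upd s m.+1 j) _) _; first by apply: valid_upd => //; lia.
  rewrite lee_fin big_nat_recr//= (eq_big_nat _ _ (F2 := fun k => qstep b delta s k.+1)).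
    by rewrite le_eqVlt; apply/orP; left; apply/eqP; ring.
  by move=> k /andP[_ km]; rewrite qstep_upd.
rewrite sumEFin lee_fin -mulr_suml -mulr_sumr -mulrA.
apply: ler_wpM2l => //; apply: ler_wpM2r; first by rewrite invr_ge0 ltW.
exact: phi_super.
Qed.

(** The history [s0] is arbitrary because [phi 0] depends on no choice. *)
Lemma ever_reached_prob L s0 : 0 < L ->
  (P [set w | exists k, L <= phi k (X^~ w)]%R <= (phi 0 s0 / L)%:E)%E.
Proof.
move=> L0.
have <- : \bigcup_h reached L 0 h = [set w | exists k, L <= phi k (X^~ w)].
  apply/seteqP; split => w; first by move=> [h _ [k [_ hk]]]; exists k.
  by move=> [k hk]; exists k => //; exists k; split => //; lia.
have /cvg_lim <-// : P (reached L 0 h) @[h --> \oo] --> P (\bigcup_h reached L 0 h).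
  apply: nondecreasing_cvg_mu => //; first exact: bigcupT_measurable.
  by move=> m n mn; apply/subsetPset => w [k [km hk]]; exists k; split => //; lia.
apply: lime_le.
  apply/cvg_ex; exists (P (\bigcup_h reached L 0 h)); apply: nondecreasing_cvg_mu => //; first exact: bigcupT_measurable.
  by move=> m n mn; apply/subsetPset => w [k [km hk]]; exists k; split => //; lia.
apply: nearW => h; have := @reached_prob L h 0 s0 L0.
rewrite big_geq// mul1r (_ : _ `&` _ = reached L 0 h).
  by apply; move=> k; lia.
by apply/seteqP; split => [w []//|w hw]; split => // k; lia.
Qed.

End Maximal.

(** * Rising-factorial martingales of the degrees *)

Section Tail.
Variables (R : realType) (delta : R) (b : bool).
Hypothesis hdelta : 0 <= delta.

Definition rise (p : nat) (x : R) : R := \prod_(0 <= l < p) (x + l%:R).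

(** The reason for rising factorials: when the degree plus delta is x, a jump has probability x /
    Lam and multiplies [rise p x] by (x + p) / x, so the mean growth factor is 1 + p / Lam whatever
    x is. *)
Lemma rise_shift p x : rise p (x + 1) * x = rise p x * (x + p%:R).
Proof.
rewrite /rise; elim: p => [|p ih]; first by rewrite !big_geq// mul1r mul1r addr0.
rewrite !big_nat_recr//= mulrAC ih -!mulrA; congr (_ * _).
by rewrite -[p.+1%:R]natr1; ring.
Qed.

Lemma rise_ge0 p x : 0 <= x -> 0 <= rise p x.
Proof. by move=> x0; apply: prodr_ge0 => l _; exact: addr_ge0. Qed.

Lemma exp_le_rise p x y : 0 <= x -> x <= y -> x ^+ p <= rise p y.
Proof.
move=> x0 xy; elim: p => [|p ih]; first by rewrite /rise big_geq.
rewrite exprSr /rise big_nat_recr//=; apply: ler_pM => //; first exact: exprn_ge0.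
by rewrite (le_trans xy)// lerDl.
Qed.

(* Mean growth factor of the [p]-th rising factorial of a degree over the steps
   [c .. m]; BI_i is active from step [i - b] on. *)
Definition growth (p c m : nat) : R := \prod_(c <= k < m.+1) (1 + p%:R / Lam b delta k).

Lemma growth_gt0 p c m : (0 < c)%N -> 0 < growth p c m.
Proof.
move=> c0; rewrite /growth big_nat_cond; apply: prodr_gt0 => k /andP[/andP[ck _] _].
by rewrite ltr_pwDl// divr_ge0// ltW// Lam_gt0//; exact: leq_trans ck.
Qed.

(** From 1 + z <= e^z and p / Lam k <= p / ((2 + delta) k), with 1/c + ... + 1/m <= 1 + ln m - ln c.
    Writing m + 1 for m also covers the empty product. *)
Lemma growth_le p c m : (0 < c)%N -> (c <= m.+1)%N ->
  growth p c m <= expR (p%:R * (2 + delta)^-1 * (1 + ln m.+1%:R - ln c%:R)).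
Proof.
move=> c0 cm.
have a0 : 0 < 2 + delta by rewrite ltr_wpDr.
have pa0 : 0 <= p%:R * (2 + delta)^-1 by rewrite mulr_ge0// invr_ge0 ltW.
have Lk k : (0 < k)%N -> p%:R / Lam b delta k <= p%:R * (2 + delta)^-1 * k%:R^-1.
  move=> k0; have k0' : 0 < k%:R :> R by rewrite ltr0n.
  rewrite -mulrA -invfM; apply: ler_wpM2l => //.
  rewrite lef_pV2 ?posrE ?Lam_gt0//; last by rewrite mulr_gt0.
  by rewrite /Lam lerDl mulr_ge0// addr_ge0.
have step k : (0 < k)%N -> k.+1%:R^-1 <= ln k.+1%:R - ln k%:R :> R.
  move=> k0; have k1 : 0 < k%:R :> R by rewrite ltr0n.
  have k2 : 0 < k.+1%:R :> R by rewrite ltr0n.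
  rewrite -lerN2 opprB -ln_div ?posrE//.
  have -> : k%:R / k.+1%:R = 1 + - k.+1%:R^-1 :> R.
    by rewrite -[k.+1%:R]natr1 in k2 *; field; rewrite gt_eqF.
  by apply: le_ln1Dx; rewrite ltrN2 invf_lt1// ltr1n.
have one_le k : (0 < k)%N ->
    1 + p%:R / Lam b delta k <= expR (p%:R * (2 + delta)^-1 * k%:R^-1).
  by move=> k0; apply: le_trans (expR_ge1Dx _) _; rewrite ler_expR Lk.
have pos k : (0 < k)%N -> 0 <= 1 + p%:R / Lam b delta k.
  by move=> k0; rewrite addr_ge0// divr_ge0// ltW// Lam_gt0.
have c1 : c%:R^-1 <= 1 :> R by rewrite invf_le1 ?ltr0n// ler1n.
have aux n : (c <= n)%N ->
    growth p c n <= expR (p%:R * (2 + delta)^-1 * (1 + ln n%:R - ln c%:R)).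
  elim: n => [|n ih] cn; first by lia.
  have [->|cn'] := eqVneq c n.+1.
    rewrite /growth big_nat1 addrK; apply: le_trans (one_le _ (ltn0Sn n)) _.
    rewrite ler_expR; apply: ler_wpM2l => //.
    by rewrite invf_le1 ?ltr0n// ler1n.
  have cn2 : (c <= n)%N by lia.
  rewrite /growth big_nat_recr/=; last by lia.
  apply: (@le_trans _ _ (expR (p%:R * (2 + delta)^-1 * (1 + ln n%:R - ln c%:R)) *
      expR (p%:R * (2 + delta)^-1 * n.+1%:R^-1))).
    apply: ler_pM; [exact/ltW/growth_gt0|exact: pos|exact: ih|exact: one_le].
  rewrite -expRD ler_expR -mulrDr; apply: ler_wpM2l => //.
  rewrite addrAC lerD2r -addrA lerD2l -lerBrDl; apply: step; lia.
have [cm'|cm'] := leqP c m.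
  apply: le_trans (aux _ cm') _; rewrite ler_expR; apply: ler_wpM2l => //.
  have m0 : 0 < m%:R :> R by rewrite ltr0n; lia.
  have m1 : 0 < m.+1%:R :> R by rewrite ltr0n.
  by rewrite lerD2r lerD2l ler_ln ?posrE// ler_nat.
have -> : c = m.+1 by lia.
by rewrite /growth big_geq// addrK mulr1 -[leLHS]expR0 ler_expR.
Qed.

(** The leading 1 is the starting value of BI_i for i > 1. Until BI_i runs, both the jump count and
    the product are trivial and the value is constant. *)
Definition node_phi (i p m : nat) (s : nat -> nat) : R :=
  rise p (1 + (kap s m.+1 i)%:R + delta) / growth p (i - b) m.

Lemma node_phi_ge0 i p m s : (1 < i)%N -> 0 <= node_phi i p m s.
Proof.
move=> i1; rewrite /node_phi divr_ge0//; first by rewrite rise_ge0// !addr_ge0.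
by rewrite ltW// growth_gt0//; lia.
Qed.

Lemma node_phi_det i p m : determined_by (node_phi i p m) m.
Proof. by move=> s s' e; rewrite /node_phi (@eq_kap s s'). Qed.

Lemma node_phi_super i p m s : (1 < i)%N -> valid b s m.+1 ->
  \sum_(1 <= j < (m.+1 + b).+1)
     qstep b delta (upd s m.+1 j) m.+1 * node_phi i p m.+1 (upd s m.+1 j) <=
  node_phi i p m s.
Proof.
move=> i1 vs; set x := 1 + (kap s m.+1 i)%:R + delta.
have x0 : 0 < x by rewrite /x -addrA ltr_pwDl// addr_ge0.
have G0 : 0 < growth p (i - b) m by apply: growth_gt0; lia.
have kapU j : kap (upd s m.+1 j) m.+2 i = (kap s m.+1 i + (j == i))%N.
  by rewrite (@kapS _ m.+1)// kap_upd /upd eqxx.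
have [im|im] := leqP i (m.+1 + b); last first.
  (* BI_i is not running yet, so no admissible choice equals i. *)
  rewrite (eq_big_nat _ _ (F2 := fun j => qstep b delta (upd s m.+1 j) m.+1 * node_phi i p m s)).
    by rewrite -mulr_suml sum_qstep// mul1r.
  move=> j jm; congr (_ * _); rewrite /node_phi kapU (_ : (j == i) = false) ?addn0; last by lia.
  by congr (_ / _); rewrite /growth !big_geq//; lia.
have L0 := Lam_gt0 b hdelta (ltn0Sn m).
have GS : growth p (i - b) m.+1 = growth p (i - b) m * (1 + p%:R / Lam b delta m.+1).
  by rewrite /growth big_nat_recr//=; lia.
have p1 : 0 < 1 + p%:R / Lam b delta m.+1 by rewrite ltr_pwDl// divr_ge0// ltW.
(* The value without a jump for every choice, plus a correction at the choice i. *)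
rewrite (eq_big_nat _ _ (F2 := fun j => qstep b delta (upd s m.+1 j) m.+1 *
     (rise p x / growth p (i - b) m.+1) + (if j == i then
     qstep b delta (upd s m.+1 i) m.+1 * ((rise p (x + 1) - rise p x) / growth p (i - b) m.+1)
     else 0))); last first.
  move=> j jm; rewrite /node_phi kapU; case: (j =P i) => [->|ji].
    rewrite -mulrDr -mulrDl; congr (_ * (_ / _)).
    rewrite [RHS]addrC subrK; congr (rise _ _).
    have -> : (kap s m.+1 i + true = (kap s m.+1 i).+1)%N by rewrite addn1.
    by rewrite /x -natr1; ring.
  by rewrite addn0 addr0.
rewrite big_split/= -mulr_suml sum_qstep// mul1r.
have iI : i \in index_iota 1 (m.+1 + b).+1 by rewrite mem_index_iota; lia.
rewrite (bigD1_seq i iI) ?iota_uniq//= eqxx big1 ?addr0; last by move=> j /negbTE ->.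
rewrite /qstep chosen_upd /rate /BI_rate/=.
have -> : (BI_start i + kap s m.+1 i)%:R + delta = x.
  by rewrite /x /BI_start; case: eqP => [|_]; [lia|rewrite natrD].
rewrite GS le_eqVlt; apply/orP; left; apply/eqP; rewrite /node_phi -/x.
have -> : rise p (x + 1) = rise p x * (x + p%:R) / x.
  by rewrite -rise_shift mulfK// gt_eqF.
have lp : 0 < Lam b delta m.+1 + p%:R by rewrite ltr_wpDr.
by field; do ?[apply/andP; split]; rewrite gt_eqF// addrC.
Qed.

End Tail.

Section TailAE.
Context d (T : measurableType d) (R : realType) (P : probability T R).
Variables (delta : R) (b : bool) (X : nat -> T -> nat).
Hypothesis hdelta : 0 <= delta.
Hypothesis mX : forall k j, measurable [set w | X k w = j].
Hypothesis Xvalid : forall w n, valid b (X^~ w) n.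
Hypothesis Xlaw : forall s m, valid b s m.+1 ->
  P (agrees X s m) = (\prod_(0 <= k < m) qstep b delta s k.+1)%:E.

Let alpha : R := (2 + delta)^-1.

Lemma power_scaleE (x : R) : 0 < x -> power_scale delta x = expR (alpha * ln x).
Proof. by move=> x0; rewrite /power_scale /powR gt_eqF. Qed.

(** The rising factorial is at least (eps n^alpha)^p, and its mean growth from c = j + 2 - b on is
    at most (e n / c)^(p alpha). In the quotient n cancels and c^(p alpha) >= (j + 1)^2 is left. *)
Lemma node_phi_large (eps : R) (p j n : nat) s : 0 < eps -> 2 <= p%:R * alpha ->
  valid b s n -> (j.+2 <= n)%N -> eps * power_scale delta n%:R <= (deg s n j.+2)%:R ->
  eps ^+ p * expR (- (p%:R * alpha)) * j.+1%:R ^+ 2 <= node_phi delta b j.+2 p n.-1 s.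
Proof.
move=> e0 pa vs jn hD.
have n0 : (0 < n)%N by lia.
have n0' : 0 < n%:R :> R by rewrite ltr0n.
have -> : node_phi delta b j.+2 p n.-1 s =
   rise p ((deg s n j.+2)%:R + delta) / growth delta b p (j.+2 - b) n.-1.
  rewrite /node_phi prednK// (deg_kap _ n0 vs) ifT; last by lia.
  by rewrite /BI_start/= natrD.
set c := (j.+2 - b)%N; have c0 : (0 < c)%N by rewrite /c; lia.
have c0' : 0 < c%:R :> R by rewrite ltr0n.
have cn : (c <= n.-1.+1)%N by rewrite /c; lia.
have gl := growth_le b hdelta p c0 cn; rewrite prednK// -/alpha in gl.
have G0 := growth_gt0 b hdelta p n.-1 c0.
rewrite ler_pdivlMr//.
have e1 : 0 <= eps * power_scale delta n%:R by rewrite mulr_ge0 ?powR_ge0// ltW.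
apply: (@le_trans _ _ ((eps * power_scale delta n%:R) ^+ p)); last first.
  apply: le_trans (exp_le_rise p e1 (lexx _)) _.
  rewrite /rise; apply: ler_prod => l _; rewrite addr_ge0//= lerD2r.
  by rewrite (le_trans hD)// lerDl.
rewrite exprMn -mulrA -mulrA; apply: ler_wpM2l; first by rewrite exprn_ge0// ltW.
rewrite power_scaleE// -expRM_natl.
apply: (@le_trans _ _ (expR (- (p%:R * alpha)) * (expR (p%:R * alpha * ln c%:R) *
   expR (p%:R * alpha * (1 + ln n%:R - ln c%:R))))); last first.
  by rewrite -!expRD ler_expR; lra.
rewrite -[leLHS]mulrA; apply: ler_wpM2l; first exact: expR_ge0.
apply: ler_pM; [exact: exprn_ge0|exact: ltW| |exact: gl].
have lnc : 0 <= ln c%:R :> R by rewrite ln_ge0// ler1n.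
apply: (@le_trans _ _ (expR (2%:R * ln c%:R))); last by rewrite ler_expR ler_wpM2r.
rewrite expRM_natl lnK ?posrE// lerXn2r ?nnegrE// ler_nat /c; lia.
Qed.

Lemma eventually_small_degree (eps : R) : 0 < eps ->
  {ae P, forall w, exists I, forall i n, (I <= i)%N -> (i <= n)%N ->
     (deg (X^~ w) n i)%:R < eps * power_scale delta n%:R}.
Proof.
move=> e0; pose p := (2 * Num.bound (2 + delta))%N.
have pa : 2 <= p%:R * alpha.
  rewrite /p natrM -mulrA ler_peMr// /alpha ler_pdivlMr ?mul1r; last by rewrite ltr_wpDr.
  by apply/ltW/archi_boundP; rewrite addr_ge0.
pose L j := eps ^+ p * expR (- (p%:R * alpha)) * j.+1%:R ^+ 2.
have K0 : 0 < eps ^+ p * expR (- (p%:R * alpha)) by rewrite mulr_gt0 ?exprn_gt0 ?expR_gt0.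
have L0 j : 0 < L j by rewrite mulr_gt0// exprn_gt0.
(* Index [j] stands for node j + 2: the first node starts from 2 and is left out. The probabilities
   are O((j + 1)^-2), as Borel-Cantelli requires. *)
pose F j : set T := [set w | exists k, L j <= node_phi delta b j.+2 p k (X^~ w)].
have mF j : measurable (F j).
  rewrite (_ : F j = \bigcup_k [set w | L j <= node_phi delta b j.+2 p k (X^~ w)]).
    apply: bigcupT_measurable => k.
    have := @measurable_determined _ _ _ mX (fun s => is_true (L j <= node_phi delta b j.+2 p k s)) k.
    by apply; move=> s s' e; rewrite (node_phi_det _ _ _ _ e).
  by apply/seteqP; split => w; [move=> [k]; exists k|move=> [k _]; exists k].
have PF j : (P (F j) <= (rise p (1 + delta) / L j)%:E)%E.
  have := @ever_reached_prob _ _ _ P delta b X hdelta mX Xvalid Xlaw (node_phi delta b j.+2 p)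
    (fun m s => @node_phi_ge0 _ _ b hdelta j.+2 p m s isT) (@node_phi_det _ delta b j.+2 p)
    (fun m s => @node_phi_super _ _ b hdelta j.+2 p m s isT) (L j) (fun=> 1%N) (L0 j).
  rewrite {2}/node_phi kap_first addr0 /growth big_geq ?divr1//; lia.
have sF : (\sum_(j <oo) P (F j) < +oo)%E.
  apply: (@le_lt_trans _ _ (rise p (1 + delta) / (eps ^+ p * expR (- (p%:R * alpha))) * 2)%:E);
    last by rewrite ltry.
  have C0 : 0 <= rise p (1 + delta) / (eps ^+ p * expR (- (p%:R * alpha))).
    by rewrite divr_ge0 ?rise_ge0 ?addr_ge0// ltW.
  apply: (@le_trans _ _ (\sum_(j <oo) (rise p (1 + delta) / (eps ^+ p * expR (- (p%:R * alpha))) *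
      (j.+1%:R ^+ 2)^-1)%:E)%E).
    apply: lee_nneseries => // j _; apply: le_trans (PF j) _.
    by rewrite lee_fin /L invfM mulrA.
  apply: bounded_nneseries => [j|n]; first by rewrite mulr_ge0// invr_ge0 exprn_ge0.
  rewrite -mulr_sumr; apply: ler_wpM2l => //; exact: sum_inv_sqr_le.
have null := lim_sup_set_cvg0 mF sF.
exists (lim_sup_set F); split => //.
  by apply: bigcapT_measurable => n; apply: bigcup_measurable.
move=> w /= nw n _ /=; apply: contrapT => nF; apply: nw.
exists n.+2 => i m ni im; rewrite ltNge; apply/negP => hD; apply: nF.
case: i ni im hD => [|[|i]]//; rewrite !ltnS => ni im hD.
exists i => //; exists m.-1.
exact: node_phi_large.
Qed.

End TailAE.

(** * Deterministic limits along a sample path *)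

Lemma cvg_pinfty_of_ln (R : realType) (u : nat -> R) (a l : R) : 0 < a ->
  (u n - ln n%:R / a) @[n --> \oo] --> l -> u n @[n --> \oo] --> +oo.
Proof.
move=> a0 ul; apply/cvgryPge => A.
move/cvgrPdist_le : ul => /(_ 1 ltr01) [N1 _ N1P].
have [N2 N2P] : exists N : nat, expR (a * (A - l + 1)) <= N%:R.
  exists (Num.bound (expR (a * (A - l + 1)))); apply/ltW/archi_boundP.
  exact: expR_ge0.
exists (maxn N1 N2) => // n /= nN.
have := N1P n (leq_trans (leq_maxl _ _) nN); rewrite /= ler_norml => /andP[_ h1].
have n2 : expR (a * (A - l + 1)) <= n%:R.
  by apply: (le_trans N2P); rewrite ler_nat; exact: leq_trans (leq_maxr _ _) nN.
have n0 : 0 < n%:R :> R by apply: lt_le_trans n2; exact: expR_gt0.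
have : A - l + 1 <= ln n%:R / a.
  by rewrite ler_pdivlMr// mulrC -ler_expR lnK.
by lra.
Qed.

(** * Growth of a single birth process *)

Section BirthProcess.
Variables (R : realType) (e : nat -> nat -> R) (i : nat) (l : R).
Let tau := jump_time e.
Hypothesis i0 : (0 < i)%N.
Hypothesis e0 : forall i k, (0 < i)%N -> (0 < k)%N -> 0 < e i k.
Hypothesis tau_ln : (\sum_(1 <= k < n.+1) e i k - ln n%:R / 1) @[n --> \oo] --> l.

Lemma BI_value k (t : R) : tau i k <= t -> t < tau i k.+1 ->
  BI tau i t = (BI_start i + k)%:R.
Proof.
move=> h1 h2; rewrite /BI natrD; congr (_ + _).
rewrite (@nneseries_split _ _ 1 k)//.
rewrite [X in (_ + X)%E]eseries0 ?adde0; last first.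
  move=> j kj _; rewrite (_ : (tau i j <= t) = false)//.
  apply/negbTE; rewrite -ltNge (lt_le_trans h2)//.
  by apply: jump_time_nd => //; lia.
rewrite sumEFin/= (eq_big_nat _ _ (F2 := fun=> 1)); last first.
  move=> j jk; rewrite (_ : (tau i j <= t) = true)//.
  by apply: le_trans h1; apply: jump_time_nd => //; lia.
by rewrite big_const_nat iter_addr addr0 add1n subn1.
Qed.

Lemma tau_cvg_pinfty : tau i k @[k --> \oo] --> +oo.
Proof. by apply: (@cvg_pinfty_of_ln _ _ 1 l). Qed.

Lemma exp_tau_cvg0 : expR (- tau i k) @[k --> \oo] --> (0 : R).
Proof.
have := tau_cvg_pinfty => /cvgryPgt h.
apply/cvgrPdist_lt => eps eps0; near=> k.
rewrite sub0r normrN ger0_norm ?expR_ge0// -(@lnK _ eps) ?posrE// ltr_expR ltrNl.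
by near: k; exact: h.
Unshelve. all: by end_near. Qed.

Lemma mul_exp_tau_cvg : k%:R * expR (- tau i k) @[k --> \oo] --> expR (- l).
Proof.
have h : expR (- (tau i k - ln k%:R / 1)) @[k --> \oo] --> expR (- l).
  apply: continuous_cvg; first exact: continuous_expR.
  exact: cvgN.
apply: cvg_trans h; apply: near_eq_cvg; exists 1%N => // k /= k1.
rewrite divr1 opprB expRD lnK//; rewrite posrE ltr0n//; lia.
Qed.

Lemma upper_BI_cvg : (BI_start i + k)%:R * expR (- tau i k) @[k --> \oo] --> expR (- l).
Proof.
have -> : (fun k => (BI_start i + k)%:R * expR (- tau i k)) =
   (fun k => (BI_start i)%:R * expR (- tau i k) + k%:R * expR (- tau i k)).
  by apply/funext => k; rewrite natrD mulrDl.
rewrite -[X in _ --> X]add0r -{1}(mulr0 (BI_start i)%:R).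
apply: cvgD; last exact: mul_exp_tau_cvg.
by apply: cvgM; [exact: cvg_cst|exact: exp_tau_cvg0].
Qed.

Lemma lower_BI_cvg : (BI_start i + k)%:R * expR (- tau i k.+1) @[k --> \oo] --> expR (- l).
Proof.
have -> : (fun k => (BI_start i + k)%:R * expR (- tau i k.+1)) =
   (fun k => ((BI_start i + k.+1)%:R * expR (- tau i k.+1)) - expR (- tau i k.+1)).
  by apply/funext => k; rewrite addnS -natr1 mulrDl mul1r addrK.
rewrite -[X in _ --> X]subr0; apply: cvgB.
  by rewrite (cvg_shiftS (fun k => (BI_start i + k)%:R * expR (- tau i k))); exact: upper_BI_cvg.
by rewrite (cvg_shiftS (fun k => expR (- tau i k))); exact: exp_tau_cvg0.
Qed.

(** Between consecutive jumps BI_i is constant, so the product lies between its values at the two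
    ends, and both envelopes converge to the same limit. *)
Lemma BI_cvg : expR (- t) * BI tau i t @[t --> +oo] --> expR (- l).
Proof.
apply/cvgrPdist_le => eps eps0.
move/cvgrPdist_le : upper_BI_cvg => /(_ _ eps0) [N1 _ N1P].
move/cvgrPdist_le : lower_BI_cvg => /(_ _ eps0) [N2 _ N2P].
pose K := maxn N1 N2.
near=> t.
have tK : tau i K < t by near: t; apply: nbhs_pinfty_gt; exact: num_real.
have ex : exists k, t < tau i k.
  have := tau_cvg_pinfty => /cvgryPgt/(_ t) [N _ NP].
  by exists N; exact: (NP N (leqnn N)).
case: (ex_minnP ex) => -[|k] k1 k2.
  move: k1; rewrite /tau jump_time0 => t0; have := jump_time_nd e0 i0 (leq0n K).
  by rewrite jump_time0; move: tK t0; rewrite /tau; lra.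
have tk : tau i k <= t by rewrite leNgt; apply/negP => /k2; rewrite ltnn.
have Kk : (K <= k)%N.
  rewrite leqNgt; apply/negP => kK; move: k1; rewrite ltNge => /negP; apply.
  by apply/ltW; apply: le_lt_trans tK; exact: (jump_time_nd e0 i0).
rewrite (BI_value tk k1) mulrC.
have := N1P k (leq_trans (leq_maxl _ _) Kk); have := N2P k (leq_trans (leq_maxr _ _) Kk).
rewrite /= !ler_norml => /andP[a1 a2] /andP[b1 b2].
have c1 : (BI_start i + k)%:R * expR (- t) <= (BI_start i + k)%:R * expR (- tau i k).
  by rewrite ler_wpM2l// ler_expR lerN2.
have c2 : (BI_start i + k)%:R * expR (- tau i k.+1) <= (BI_start i + k)%:R * expR (- t).
  by rewrite ler_wpM2l// ler_expR lerN2 ltW.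
by apply/andP; split; lra.
Unshelve. all: by end_near. Qed.

Lemma sigma_eq : sigma tau i = expR (- l).
Proof. by apply/cvg_lim => //; exact: BI_cvg. Qed.

End BirthProcess.

(** * Limit of one normalised degree *)

Section DegreeLimit.
Variables (R : realType) (delta : R) (b : bool) (e : nat -> nat -> R) (s : nat -> nat).
Hypothesis hdelta : 0 <= delta.
Let eu (x : nat * nat) := e x.1 x.2.
Let tau := jump_time e.
Hypothesis e0 : forall i k, (0 < i)%N -> (0 < k)%N -> 0 < e i k.
Hypothesis vs : forall n, valid b s n.
Hypothesis fs : forall m, follows b eu s (fun=> 0) m.
Hypothesis tau_ln : forall i, (0 < i)%N -> exists l : R,
  (\sum_(1 <= k < n.+1) e i k - ln n%:R / 1) @[n --> \oo] --> l.
Variable lT : R.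
Hypothesis clock_ln :
  (\sum_(1 <= k < n.+1) gap b eu s k.-1 - ln n%:R / (2 + delta)) @[n --> \oo] --> lT.
Variables (T : nat -> R) (W : R).
Hypothesis TE : forall n, (0 < n)%N -> T n = clock b eu s n.-1.
Hypothesis WE : W = lim (n%:R * expR (- ((2 + delta) * T n)) @[n --> \oo]).

Let a0 : 0 < 2 + delta.
Proof. by rewrite ltr_wpDr. Qed.

Let clockE n : clock b eu s n = \sum_(1 <= k < n.+1) gap b eu s k.-1.
Proof. by rewrite big_add1. Qed.

Lemma W_cvg : n%:R * expR (- ((2 + delta) * T n)) @[n --> \oo] --> expR (- ((2 + delta) * lT)).
Proof.
pose f (n : nat) : R := n%:R * expR (- ((2 + delta) * T n)).
suff : f n.+2 @[n --> \oo] --> expR (- ((2 + delta) * lT)).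
  by rewrite (cvg_shiftS (fun n => f n.+1)) (cvg_shiftS f).
(* [T n.+2] is the clock after n + 1 gaps, so n + 2 splits as n + 1, matching the logarithm, times 1
   + 1 / (n + 1). *)
have -> : (fun n => f n.+2) =
  (fun n => (1 + n.+1%:R^-1) *
     expR (- ((2 + delta) * (clock b eu s n.+1 - ln n.+1%:R / (2 + delta))))).
  apply/funext => n; rewrite /f TE//=.
  have n1 : 0 < n.+1%:R :> R by rewrite ltr0n.
  rewrite mulrBr opprB [(2 + delta) * (_ / _)]mulrC divfK ?gt_eqF// expRD lnK ?posrE//.
  rewrite mulrA; congr (_ * _).
  by rewrite mulrDl mul1r mulVf ?gt_eqF// natr1.
rewrite -[X in _ --> X]mul1r; apply: cvgM.
  rewrite -[X in _ --> X]addr0.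
  by apply: cvgD; [exact: cvg_cst|exact: cvg_harmonic].
apply: continuous_cvg; first exact: continuous_expR.
apply: cvgN; apply: cvgM; first exact: cvg_cst.
rewrite (cvg_shiftS (fun n => clock b eu s n - ln n%:R / (2 + delta))).
by move: clock_ln; under eq_fun do rewrite -clockE.
Qed.

Lemma W_eq : W = expR (- ((2 + delta) * lT)).
Proof. by rewrite WE; apply/cvg_lim => //; exact: W_cvg. Qed.

Lemma power_scale_W : power_scale delta W = expR (- lT).
Proof.
rewrite power_scaleE W_eq ?expR_gt0// expRK; congr expR.
by field; rewrite gt_eqF.
Qed.

Lemma power_scale_clock_cvg :
  power_scale delta n%:R * expR (- T n) @[n --> \oo] --> power_scale delta W.
Proof.
rewrite power_scale_W.
have h : expR ((2 + delta)^-1 * ln (n%:R * expR (- ((2 + delta) * T n)))) @[n --> \oo] -->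
    expR ((2 + delta)^-1 * ln (expR (- ((2 + delta) * lT)))).
  apply: continuous_cvg; first exact: continuous_expR.
  apply: cvgM; first exact: cvg_cst.
  apply: continuous_cvg; last exact: W_cvg.
  by apply: continuous_ln; exact: expR_gt0.
have <- : expR ((2 + delta)^-1 * ln (expR (- ((2 + delta) * lT)))) = expR (- lT).
  by rewrite expRK; congr expR; field; rewrite gt_eqF.
apply: cvg_trans h; apply: near_eq_cvg; exists 1%N => // n /= n1.
have n0 : 0 < n%:R :> R by rewrite ltr0n.
rewrite power_scaleE// lnM ?posrE ?expR_gt0// expRK -expRD; congr expR.
by field; rewrite gt_eqF.
Qed.

(** The degree at time n is BI_i evaluated at age T_n minus the birth time, and n^(1/(2+delta))
    e^(-T_n) converges to W^(1/(2+delta)). Strict positivity is recorded because test functions are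
    continuous only on (0, +oo]. *)
Lemma deg_cvg i : (0 < i)%N ->
  (deg s n i)%:R / power_scale delta n%:R @[n --> \oo] -->
    sigma tau i * expR (- birth_time b e s i) / power_scale delta W /\
  0 < sigma tau i * expR (- birth_time b e s i) / power_scale delta W.
Proof.
move=> i0; have [l tl] := tau_ln i0.
have pW : 0 < power_scale delta W by rewrite power_scale_W expR_gt0.
rewrite (sigma_eq i0 e0 tl); split; last by rewrite divr_gt0// mulr_gt0// expR_gt0.
have Toy : (T n - birth_time b e s i) @[n --> \oo] --> +oo.
  have coy : clock b eu s n @[n --> \oo] --> +oo.
    apply: (cvg_pinfty_of_ln a0 (l := lT)).
    by move: clock_ln; under eq_fun do rewrite -clockE.
  apply/cvgryPge => A; have /cvgryPge/(_ (A + birth_time b e s i)) [N _ NP] := coy.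
  exists N.+1 => // n /= Nn; rewrite TE; last by lia.
  by rewrite lerBrDr; apply: (NP n.-1); rewrite /=; lia.
have h : (expR (- (T n - birth_time b e s i)) * BI tau i (T n - birth_time b e s i)) *
    expR (- birth_time b e s i) / (power_scale delta n%:R * expR (- T n)) @[n --> \oo] -->
    expR (- l) * expR (- birth_time b e s i) / power_scale delta W.
  apply: cvgM; last first.
    by apply: cvgV; [rewrite gt_eqF|exact: power_scale_clock_cvg].
  apply: cvgM; last exact: cvg_cst.
  exact: (cvg_comp _ _ Toy (BI_cvg i0 e0 tl)).
apply: cvg_trans h; apply: near_eq_cvg; exists i => // n /= ni.
have n0 : (0 < n)%N by lia.
have ps0 : 0 < power_scale delta n%:R by rewrite power_scaleE ?expR_gt0// ltr0n.
(* At time T_n process i has made exactly [kap s n i] jumps, by [jumped_before] and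
   [not_jumped_yet]. *)
rewrite (@BI_value _ _ _ i0 e0 (kap s n i)).
- rewrite (deg_kap _ n0 (@vs n)) ifT; last by lia.
  rewrite opprB expRD.
  have := gt_eqF ps0; have := gt_eqF (expR_gt0 (- T n)).
  have -> : expR (- birth_time b e s i) = (expR (birth_time b e s i))^-1 by rewrite expRN.
  have := gt_eqF (expR_gt0 (birth_time b e s i)).
  by move=> /negbT q1 /negbT q2 /negbT q3; field; rewrite q1 q2 q3.
- rewrite -{1}(prednK n0) lerBrDl TE//; apply: jumped_before => //.
  by rewrite prednK//; lia.
- rewrite -{2}(prednK n0) ltrBlDl TE//; apply: not_jumped_yet => //.
  by rewrite prednK//; lia.
Qed.

End DegreeLimit.

(** * Passage from sample paths to laws *)

Section NonMeasurable.
Context d (T : measurableType d) (R : realType) (P : probability T R).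
Import HBNNSimple.

(* The library integral is a supremum over simple functions, so null sets can be
   ignored even when the integrand is not measurable on them. *)
Lemma ge0_integral_null_eq (N : set T) (f g : T -> \bar R) :
  measurable N -> P N = 0%E -> (forall w, 0 <= f w)%E -> (forall w, 0 <= g w)%E ->
  (forall w, ~ N w -> f w = g w) -> (\int[P]_w f w = \int[P]_w g w)%E.
Proof.
move=> mN N0.
suff le (u v : T -> \bar R) : (forall w, 0 <= u w)%E -> (forall w, 0 <= v w)%E ->
    (forall w, ~ N w -> u w = v w) -> (\int[P]_w u w <= \int[P]_w v w)%E.
  move=> f0 g0 fg; apply/eqP; rewrite eq_le !le// => w nw; by rewrite fg.
move=> u0 v0 uv; rewrite !ge0_integralTE//.
apply: ge_ereal_sup => _ [h hu <-].
pose h' : {nnsfun T >-> R} := proj_nnsfun h (measurableC mN).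
have h'E w : h' w = h w * \1_(~` N) w by rewrite /h'/= mindicE indicE.
have -> : sintegral P h = sintegral P h'.
  rewrite -!integralT_nnsfun; apply: ge0_ae_eq_integral => //.
  - exact/measurable_EFinP.
  - exact/measurable_EFinP.
  - by move=> w _; rewrite lee_fin.
  - by move=> w _; rewrite lee_fin.
  - exists N; split => // w /=; apply: contra_notP => nw _.
    by rewrite /h'/= mindicE mem_set// mulr1.
apply: ereal_sup_ubound; exists h' => // w; rewrite h'E indicE.
have [nw|nw] := pselect (N w).
  by rewrite memNset ?mulr0//; apply/contrapT => /[apply].
by rewrite mem_set// mulr1 -uv.
Qed.

Lemma integral_null_eq (N : set T) (f g : T -> \bar R) :
  measurable N -> P N = 0%E -> (forall w, ~ N w -> f w = g w) ->
  (\int[P]_w f w = \int[P]_w g w)%E.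
Proof.
move=> mN N0 fg; rewrite integralE [RHS]integralE; congr (_ - _)%E;
  apply: (ge0_integral_null_eq mN N0) => // w nw; by rewrite ?funeposE ?funenegE fg.
Qed.

(** The limit [g] is not assumed measurable. Multiplying everything by the indicator of the
    complement of [N] makes the convergence hold everywhere, and the new limit is then
    measurable. *)
Lemma bounded_cvg_integral (g_ : nat -> T -> R) (g : T -> R) (C : R) :
  (forall n, measurable_fun setT (g_ n)) -> (forall n w, `|g_ n w| <= C) ->
  {ae P, forall w, g_ n w @[n --> \oo] --> g w} ->
  (\int[P]_w (g_ n w)%:E)%E @[n --> \oo] --> (\int[P]_w (g w)%:E)%E.
Proof.
move=> mg_ gC [N [mN N0 sN]].
have cv w : ~ N w -> g_ n w @[n --> \oo] --> g w.
  by move=> nw; apply: contrapT => /sN.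
pose h_ n w : R := g_ n w * \1_(~` N) w.
pose h w : R := g w * \1_(~` N) w.
have hE w (u : T -> R) : ~ N w -> u w * \1_(~` N) w = u w.
  by move=> nw; rewrite indicE mem_set// mulr1.
have -> : (\int[P]_w (g w)%:E = \int[P]_w (h w)%:E)%E.
  by apply: (integral_null_eq mN N0) => w nw; rewrite /h hE.
have -> : (fun n => \int[P]_w (g_ n w)%:E)%E = (fun n => \int[P]_w (h_ n w)%:E)%E.
  by apply/funext => n; apply: (integral_null_eq mN N0) => w nw; rewrite /h_ hE.
have mI : measurable_fun setT (\1_(~` N) : T -> R).
  by apply: measurable_indic; exact: measurableC.
have mh_ n : measurable_fun setT (h_ n) by exact: measurable_funM.
have ch w : h_ n w @[n --> \oo] --> h w.
  have [nw|nw] := pselect (N w).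
    have z (u : R) : u * \1_(~` N) w = 0 :> R.
      by rewrite indicE memNset ?mulr0//; apply/contrapT => /[apply].
    by rewrite /h z; under eq_fun do rewrite /h_ z; exact: cvg_cst.
  rewrite /h hE//; under eq_fun do rewrite /h_ hE//.
  exact: cv.
have mh : measurable_fun setT h.
  by apply: (@measurable_fun_cvg _ _ _ _ h_) => // w _; exact: ch.
have d1 n : measurable_fun setT (fun w => (h_ n w)%:E) by exact/measurable_EFinP.
have d2 : measurable_fun setT (fun w => (h w)%:E) by exact/measurable_EFinP.
have d3 : {ae P, forall w, setT w -> (h_ n w)%:E @[n --> \oo] --> (h w)%:E}.
  by apply: nearW => w _; apply: cvg_EFin; [exact: nearW|exact: ch].
have d4 : P.-integrable setT (EFin \o cst C) by exact: finite_measure_integrable_cst.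
have d5 : {ae P, forall w n, setT w -> (`|(h_ n w)%:E| <= (EFin \o cst C) w)%E}.
  apply: nearW => w n _ /=; rewrite lee_fin /h_ normrM.
  rewrite -[leRHS]mulr1; apply: ler_pM => //.
  by rewrite indicE; case: (w \in _); rewrite ?normr1 ?normr0.
by have [] := dominated_convergence measurableT d1 d2 d3 d4 d5.
Qed.

End NonMeasurable.

(** * Comparison of laws through finite prefixes *)

Section Transfer.
Variable (R : realType).

Lemma measurable_fun_determined d (T : measurableType d) (X : nat -> T -> nat)
    (g : (nat -> nat) -> R) N :
  (forall k j, measurable [set w | X k w = j]) -> determined_by g N ->
  measurable_fun setT (fun w => g (X^~ w)).
Proof.
move=> mX dg _ B mB; rewrite setTI.
apply: (@measurable_determined _ _ X mX (fun s => B (g s)) N) => s s' e.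
by rewrite (dg s s').
Qed.

Let code (N : nat) (s : nat -> nat) : nat := pickle (map s (iota 0 N.+1)).

(** Choice 0 has no meaning and [agrees] leaves it free; resetting it makes the code a function of
    the choices 1 to N. *)
Let sval0 (s : nat -> nat) : nat -> nat := fun k => if k is 0 then 0%N else s k.

Lemma integral_determined d (T : measurableType d) (P : probability T R)
    (X : nat -> T -> nat) (g : (nat -> nat) -> R) (C : R) N :
  (forall k j, measurable [set w | X k w = j]) -> determined_by g N ->
  (forall s, `|g s| <= C) ->
  (\int[P]_w (g (X^~ w))%:E = \sum_(n <oo) (g (decode_path n))%:E *
     P [set w | code N (sval0 (X^~ w)) = n])%E.
Proof.
move=> mX dg gC.
pose A n : set T := [set w | code N (sval0 (X^~ w)) = n].
have AE n w : A n w -> forall k, (1 <= k <= N)%N -> X k w = decode_path n k.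
  by move=> <- k kN; rewrite /code decode_pathK; [case: k kN|lia].
have mA n : measurable (A n).
  apply: (@measurable_determined _ _ X mX (fun s => code N (sval0 s) = n) N) => s s' e.
  congr (_ = _); rewrite /code; congr pickle; apply/eq_in_map => k.
  by rewrite mem_iota => kN; case: k kN => // k kN; apply: e; lia.
have UA : \bigcup_n A n = setT.
  by apply/seteqP; split => // w _; exists (code N (sval0 (X^~ w))).
have mg := measurable_fun_determined mX dg.
have ig : P.-integrable setT (EFin \o (fun w => g (X^~ w))).
  apply: measurable_bounded_integrable => //.
    by rewrite ltey_eq fin_num_measure.
  by exists C; split; [exact: num_real|move=> M CM w _; exact: le_trans (ltW CM)].
rewrite -UA integral_bigcup ?UA//.
- apply: eq_eseriesr => n _.
  rewrite -(integral_cst P (mA n)); apply: eq_integral => w; rewrite inE => Aw.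
  by rewrite (dg (X^~ w) (decode_path n))//; exact: AE.
- by apply/trivIsetP => i j _ _ ij; apply/seteqP; split => // w; rewrite /A => -[/= e1 e2]; move: ij; rewrite -e1 -e2 eqxx.
Qed.

Lemma integral_determined_transfer
    d1 (T1 : measurableType d1) (P1 : probability T1 R) (X1 : nat -> T1 -> nat)
    d2 (T2 : measurableType d2) (P2 : probability T2 R) (X2 : nat -> T2 -> nat)
    (g : (nat -> nat) -> R) (C : R) N :
  (forall k j, measurable [set w | X1 k w = j]) ->
  (forall k j, measurable [set w | X2 k w = j]) ->
  (forall s, P1 (agrees X1 s N) = P2 (agrees X2 s N)) ->
  determined_by g N -> (forall s, `|g s| <= C) ->
  (\int[P1]_w (g (X1^~ w))%:E = \int[P2]_w (g (X2^~ w))%:E)%E.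
Proof.
move=> m1 m2 e12 dg gC; rewrite !(integral_determined _ _ dg gC)//.
apply: eq_eseriesr => n _; congr (_ * _)%E.
(* An integer that codes no prefix of this length gives the empty event on both spaces; any other
   gives a cylinder. *)
have AE d (T : measurableType d) (X : nat -> T -> nat) :
    [set w | code N (sval0 (X^~ w)) = n] =
    if `[< code N (sval0 (decode_path n)) = n >] then agrees X (decode_path n) N else set0.
  have ee s s' : (forall k, (1 <= k <= N)%N -> s k = s' k) ->
      code N (sval0 s) = code N (sval0 s').
    move=> h; rewrite /code; congr pickle; apply/eq_in_map => k.
    by rewrite mem_iota => kN; case: k kN => // k kN; apply: h; lia.
  have ag w : code N (sval0 (X^~ w)) = n -> agrees X (decode_path n) N w.
    by move=> <- k kN; rewrite /code decode_pathK; [case: k kN|lia].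
  apply/seteqP; split => w /=.
    move=> h; rewrite asboolT; first exact: ag.
    by rewrite -(ee (X^~ w))//; exact: ag.
  by case: asboolP => // h agw; rewrite (ee (X^~ w) (decode_path n)).
rewrite !AE; case: asboolP => _; last by rewrite !measure0.
exact: e12.
Qed.

End Transfer.

(** * Vague convergence from coordinatewise limits and small tails *)

Section Vague.
Variables (R : realType) (delta : R) (s : nat -> nat) (y : nat -> R) (x : nat -> \bar R).
Hypothesis hdelta : 0 <= delta.
Hypothesis x0 : x 0%N = 0%E.
Hypothesis xy : forall i, (0 < i)%N -> x i = (y i)%:E.
Hypothesis y0 : forall i, (0 < i)%N -> 0 < y i.
Hypothesis deg_lim : forall i, (0 < i)%N ->
  (deg s n i)%:R / power_scale delta n%:R @[n --> \oo] --> y i.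
Hypothesis small : forall r : nat, exists I, forall i n, (I <= i)%N -> (i <= n)%N ->
  (deg s n i)%:R < r.+1%:R^-1 * power_scale delta n%:R.

Let ps_gt0 n : (0 < n)%N -> 0 < power_scale delta n%:R.
Proof. by move=> n0; rewrite power_scaleE ?expR_gt0// ltr0n. Qed.

(** The index [I] is uniform in n. The levels 1 / (r + 1) in [small] form a countable family, so
    that they can hold simultaneously almost surely. *)
Lemma points_small (eps : R) : 0 < eps -> exists I, forall i, (I <= i)%N ->
  (x i < eps%:E)%E /\ forall n, (degree_points delta s n i < eps%:E)%E.
Proof.
move=> eps0.
have [r reps] : exists r : nat, r.+1%:R^-1 < eps.
  exists (Num.bound eps^-1); rewrite invf_plt ?posrE ?ltr0n//.
  have := archi_boundP (ltW (_ : 0 < eps^-1)); rewrite invr_gt0 => /(_ eps0).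
  by move=> /lt_trans; apply; rewrite ltr_nat.
have [I IP] := small r; exists (maxn I 1) => i Ii.
have i0 : (0 < i)%N by lia.
have Ii' : (I <= i)%N by lia.
split.
  rewrite xy// lte_fin; apply: le_lt_trans reps.
  apply: (ler_cvg_to (deg_lim i0) (cvg_cst _)).
  exists i => // n /= ni; rewrite ler_pdivrMr ?ps_gt0//; last by lia.
  exact/ltW/IP.
move=> n; rewrite /degree_points; case: ifP => [/andP[_ ni]|_]; last by rewrite lte_fin.
rewrite lte_fin; apply: lt_trans reps; rewrite ltr_pdivrMr ?ps_gt0//; last by lia.
exact: IP.
Qed.

Lemma radon_limit : radon_points x.
Proof.
move=> eps /points_small[I IP]; apply: (@sub_finite_set _ _ `I_I); last exact: finite_II.
move=> i /= h; rewrite ltnNge; apply/negP => /IP[]; by rewrite ltNge h.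
Qed.

Lemma radon_degree n : radon_points (degree_points delta s n).
Proof.
move=> eps /points_small[I IP]; apply: (@sub_finite_set _ _ `I_I); last exact: finite_II.
move=> i /= h; rewrite ltnNge; apply/negP => /IP[_ /(_ n)]; by rewrite ltNge h.
Qed.

(** A test function vanishes below some eps, so by [points_small] all integrals are sums over the
    same finitely many indices, and each term converges. *)
Lemma vague_degree : vague_cvg (degree_points delta s) x.
Proof.
move=> f [f0 [[eps eps0 feps] fc]].
have [I IP] := points_small eps0.
have pmE (z : nat -> \bar R) : (forall i, (I <= i)%N -> (z i < eps%:E)%E) ->
    pm_int z f = (\sum_(0 <= i < I) f (z i))%:E.
  move=> zI; rewrite /pm_int (@nneseries_split _ _ 0 I)//; last by move=> k _; rewrite lee_fin.
  rewrite add0n [X in (_ + X)%E]eseries0 ?adde0 ?sumEFin//.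
  by move=> i Ii _; rewrite feps// zI.
rewrite pmE; last by move=> i /IP[].
have -> : (fun n => pm_int (degree_points delta s n) f) =
   (fun n => (\sum_(0 <= i < I) f (degree_points delta s n i))%:E).
  by apply/funext => n; rewrite pmE// => i /IP[_]; exact.
apply: cvg_EFin; first exact: nearW.
suff fi i : f (degree_points delta s n i) @[n --> \oo] --> f (x i).
  elim: I {IP pmE} => [|I ih] /=.
    by rewrite big_geq//; under eq_fun do rewrite big_geq//; exact: cvg_cst.
  rewrite big_nat_recr//=; under eq_fun do rewrite big_nat_recr//=.
  exact: cvgD.
case: i => [|i].
  by rewrite x0 /degree_points/=; exact: cvg_cst.
have c : degree_points delta s n i.+1 @[n --> \oo] --> x i.+1.
  rewrite xy//.
  have h : ((deg s n i.+1)%:R / power_scale delta n%:R)%:E @[n --> \oo] --> (y i.+1)%:E.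
    by apply: cvg_EFin; [exact: nearW|exact: deg_lim].
  apply: cvg_trans h; apply: near_eq_cvg; exists i.+1 => // n /= ni.
  by rewrite /degree_points ni.
apply: continuous_cvg => //; apply: fc; rewrite xy// lte_fin; exact: y0.
Qed.

End Vague.

(** * The coupling *)

Lemma eq_deg s s' n i : (forall k, (1 <= k < n)%N -> s k = s' k) -> deg s n i = deg s' n i.
Proof.
elim: n => // n ih h /=; case: n ih h => // n ih h.
rewrite -!/(deg _ n.+1 i) (h n.+1); last by lia.
by rewrite ih// => k kn; apply: h; lia.
Qed.

Lemma degree_points_determined (R : realType) (delta : R) n :
  determined_by (fun s => degree_points delta s n) n.
Proof.
move=> s s' h; apply/funext => i; rewrite /degree_points (@eq_deg s s')// => k kn.
by apply: h; lia.
Qed.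

Section Coupling.
Context d (Om : measurableType d) (R : realType) (P : probability Om R).
Variables (delta : R) (b : bool) (E : nat -> nat -> Om -> R).
Hypothesis hdelta : 0 <= delta.
Hypothesis E_meas : forall i k, measurable_fun setT (E i k).
Hypothesis E_indep : mutually_independent P
  (fun ik : nat * nat => (1 <= ik.1)%N /\ (1 <= ik.2)%N) (fun ik => E ik.1 ik.2).
Hypothesis E_exp : forall i k, (1 <= i)%N -> (1 <= k)%N ->
  exp_distributed P (BI_rate delta i k) (E i k).

Let e w i k : R := E i k w.
Let X := choice_of b E.

Let E_pos : {ae P, forall w, forall i k, (0 < i)%N -> (0 < k)%N -> 0 < e w i k}.
Proof.
apply: ae_foralln => i; apply: ae_foralln => k.
have [i0|i0] := posnP i; first by apply: nearW => w; rewrite i0.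
have [k0|k0] := posnP k; first by apply: nearW => w; rewrite k0.
apply: filterS (@prob1_ae _ _ _ P [set w | 0 < E i k w] _ _) => //.
  by apply: measurable_gtr => //; exact: measurable_cst.
by rewrite E_exp// mulr0 oppr0 expR0.
Qed.

(** Puts the rates in the form a k + c with a = 1 required by [exp_sum_ln_cvg]. *)
Let BI_rateE i k : (0 < i)%N -> (0 < k)%N ->
  BI_rate delta i k = 1 * k%:R + ((BI_start i).-1%:R + delta).
Proof.
move=> i0; case: k => // k _; rewrite /BI_rate /BI_start mul1r/= addrA; congr (_ + _).
by rewrite -natrD; congr (_%:R); case: eqP => _ /=; lia.
Qed.

Let tau_cvg : {ae P, forall w, forall i, (0 < i)%N -> exists l : R,
  (\sum_(1 <= k < n.+1) e w i k - ln n%:R / 1) @[n --> \oo] --> l}.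
Proof.
apply: ae_foralln => i; have [i0|i0] := posnP i; first by apply: nearW => w; rewrite i0.
have c0 : 0 <= (BI_start i).-1%:R + delta by exact: addr_ge0.
apply: filterS (@exp_sum_ln_cvg _ _ _ P 1 ((BI_start i).-1%:R + delta) (E i) ltr01 c0 _ _ _) => //.
- by move=> k t k0 t0; rewrite E_exp// BI_rateE.
move=> j k s t j0 k0 jk s0 t0.
have jk' : (i, k) != (i, j) by rewrite xpair_eqE eqxx eq_sym.
have := survival_init E_indep E_exp (J := [:: (i, j); (i, k)])
  (t := fun x => if x == (i, j) then s else t).
rewrite setTI !big_cons big_nil mul1r mulr1 eqxx (negbTE jk') /rate/= !BI_rateE// => <-//.
- congr (P _); apply/seteqP; split => w /=.
    move=> [h1 h2] x; rewrite !inE => /orP[/eqP ->|/eqP ->]; first by rewrite eqxx.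
    by rewrite (negbTE jk').
  move=> h; split; first by have := h (i, j); rewrite !inE eqxx; exact.
  by have := h (i, k); rewrite !inE eqxx (negbTE jk') orbT; exact.
- by rewrite /= !inE andbT eq_sym.
- by move=> x; rewrite !inE => /orP[/eqP ->|/eqP ->].
- by move=> x; case: ifP.
Qed.

Let gap_cvg : {ae P, forall w, exists l : R,
  (\sum_(1 <= k < n.+1) gap_of b E k.-1 w - ln n%:R / (2 + delta)) @[n --> \oo] --> l}.
Proof.
have a0 : 0 < 2 + delta by rewrite ltr_wpDr.
have c0 : 0 <= b%:R * (1 + delta) by rewrite mulr_ge0// addr_ge0.
apply: (@exp_sum_ln_cvg _ _ _ P _ _ (fun k => gap_of b E k.-1) a0 c0).
- by move=> k; exact: measurable_gap_of.
- by move=> k t k0 t0; rewrite (gap_of_prob b hdelta)// /Lam prednK.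
- move=> j k s t j0 k0 jk s0 t0.
  rewrite (gap_of_pair_prob b hdelta)//; first by rewrite /Lam !prednK.
  by apply: contra jk => /eqP h; rewrite -(prednK j0) h prednK.
Qed.

Let X_meas k j : measurable [set w | X k w = j].
Proof. exact: measurable_choice_of. Qed.

Let X_law s m : valid b s m.+1 -> P (agrees X s m) = (\prod_(0 <= k < m) qstep b delta s k.+1)%:E.
Proof.
move=> vs; rewrite (choice_of_law b hdelta)//; congr EFin; rewrite big_add1/=.
by apply: eq_big_nat => k km; rewrite ifT//; apply: vs; lia.
Qed.

Let small_degree : {ae P, forall w, forall r : nat, exists I, forall i n,
  (I <= i)%N -> (i <= n)%N ->
  (deg (X^~ w) n i)%:R < r.+1%:R^-1 * power_scale delta n%:R}.
Proof.
apply: ae_foralln => r.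
apply: (eventually_small_degree hdelta X_meas _ X_law); last by rewrite invr_gt0.
by move=> w n; exact: choice_of_valid.
Qed.

(** [T] gives the event times and [S] the birth times. They coincide in Model A, and in Model B [S]
    is [T] with its index lowered by one. *)
Variables (T S : (nat -> nat -> R) -> nat -> R).
Hypothesis TE : forall (e : nat -> nat -> R) s,
  (forall i k, (0 < i)%N -> (0 < k)%N -> 0 < e i k) -> (forall n, valid b s n) ->
  (forall m, follows b (fun x => e x.1 x.2) s (fun=> 0) m) ->
  forall n, (0 < n)%N -> T (jump_time e) n = clock b (fun x => e x.1 x.2) s n.-1.
Hypothesis SE : forall (e : nat -> nat -> R) s,
  (forall i k, (0 < i)%N -> (0 < k)%N -> 0 < e i k) -> (forall n, valid b s n) ->
  (forall m, follows b (fun x => e x.1 x.2) s (fun=> 0) m) ->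
  forall i, (0 < i)%N -> S (jump_time e) i = birth_time b e s i.

Let W (t : nat -> nat -> R) := lim (n%:R * expR (- ((2 + delta) * T t n)) @[n --> \oo]).

Lemma coupled_cvg (F : (set (\bar R) -> \bar R) -> R) : bounded_vague_continuous F ->
  {ae P, forall w, F (ptm (degree_points delta (X^~ w) n)) @[n --> \oo] -->
    F (ptm (limit_points delta (jump_time (e w)) (S (jump_time (e w))) (W (jump_time (e w)))))}.
Proof.
move=> [_ Fc]; have tie_ae := tie_free_ae b hdelta E_meas E_indep E_exp; near=> w.
have e0 : forall i k, (0 < i)%N -> (0 < k)%N -> 0 < e w i k by near: w.
have tl : forall i, (0 < i)%N -> exists l : R,
  (\sum_(1 <= k < n.+1) e w i k - ln n%:R / 1) @[n --> \oo] --> l by near: w.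
have [lT gl] : exists l : R,
  (\sum_(1 <= k < n.+1) gap_of b E k.-1 w - ln n%:R / (2 + delta)) @[n --> \oo] --> l.
  by near: w.
have sm : forall r : nat, exists I, forall i n, (I <= i)%N -> (i <= n)%N ->
  (deg (X^~ w) n i)%:R < r.+1%:R^-1 * power_scale delta n%:R by near: w.
have tf : forall m, tie_free b E m w by near: w.
have vs n : valid b (X^~ w) n by exact: choice_of_valid.
have fs m : follows b (fun x => e w x.1 x.2) (X^~ w) (fun=> 0) m by exact: choice_of_follows.
have dc i (i0 : (0 < i)%N) := deg_cvg hdelta e0 vs fs tl gl (TE e0 vs fs) erefl i0.
pose y i := sigma (jump_time (e w)) i * expR (- birth_time b (e w) (X^~ w) i) /
  power_scale delta (W (jump_time (e w))).
have xy i : (0 < i)%N -> limit_points delta (jump_time (e w)) (S (jump_time (e w)))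
    (W (jump_time (e w))) i = (y i)%:E.
  by move=> i0; rewrite /limit_points i0 (SE e0 vs fs).
have y0 i : (0 < i)%N -> 0 < y i by move=> i0; exact: (dc i i0).2.
have dl i : (0 < i)%N -> (deg (X^~ w) n i)%:R / power_scale delta n%:R @[n --> \oo] --> y i.
  by move=> i0; exact: (dc i i0).1.
apply: Fc.
- exact: (radon_limit _ xy dl sm).
- by move=> n; exact: (radon_degree _ xy dl sm).
- by apply: vague_degree xy y0 dl sm.
Unshelve. all: by end_near. Qed.

(** At each n the functional reads n choices, so [Y] can be replaced by the choices extracted from
    the clocks; [coupled_cvg] and the bound on [F] then apply. *)
Lemma degree_law_cvg dX (OmX : measurableType dX) (PX : probability OmX R)
    (Y : nat -> OmX -> nat) (F : (set (\bar R) -> \bar R) -> R) :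
  (forall k j, measurable [set w | Y k w = j]) ->
  (forall s m, PX (agrees Y s m) =
    (\prod_(1 <= k < m.+1) (if (1 <= s k <= k + b)%N then qstep b delta s k else 0))%:E) ->
  bounded_vague_continuous F ->
  (\int[PX]_w (F (ptm (degree_points delta (Y^~ w) n)))%:E)%E @[n --> \oo] -->
  (\int[P]_w (F (ptm (limit_points delta (jump_time (e w)) (S (jump_time (e w)))
     (W (jump_time (e w))))))%:E)%E.
Proof.
move=> mY lawY bF; have [[C FC] _] := bF.
have det n : determined_by (fun s => F (ptm (degree_points delta s n))) n.
  by move=> s s' h; rewrite (degree_points_determined delta h).
have -> : (fun n => \int[PX]_w (F (ptm (degree_points delta (Y^~ w) n)))%:E)%E =
    (fun n => \int[P]_w (F (ptm (degree_points delta (X^~ w) n)))%:E)%E.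
  apply/funext => n; apply: (integral_determined_transfer mY X_meas _ (det n)) => //.
  by move=> s; rewrite lawY (choice_of_law b hdelta).
apply: (@bounded_cvg_integral _ _ _ P (fun n w => F (ptm (degree_points delta (X^~ w) n))) _ C).
- by move=> n; exact: (measurable_fun_determined X_meas (det n)).
- by move=> n w; exact: FC.
- exact: coupled_cvg.
Qed.

End Coupling.

(** * Matching the two models with the clocks *)

Lemma eq_prod_step (R : realType) (b : bool) (delta : R) (p : (nat -> nat) -> nat -> R) s m :
  (forall k, (0 < k)%N -> valid b s k -> p s k =
     if (1 <= s k <= k + b)%N then qstep b delta s k else 0) ->
  \prod_(1 <= k < m.+1) p s k =
  \prod_(1 <= k < m.+1) (if (1 <= s k <= k + b)%N then qstep b delta s k else 0).
Proof.
move=> pE; elim: m => [|m ih]; first by rewrite !big_geq.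
rewrite big_nat_recr//= [RHS]big_nat_recr//= ih.
(* [p] is controlled only after a valid prefix; once the history has left the admissible range, a
   zero factor kills both products. *)
have [vs|nvs] := pselect (valid b s m.+1); first by rewrite pE.
suff -> : \prod_(1 <= k < m.+1) (if (1 <= s k <= k + b)%N then qstep b delta s k else 0) = 0 :> R.
  by rewrite !mul0r.
have [k km sk] : exists2 k, (1 <= k < m.+1)%N & ~~ (1 <= s k <= k + b)%N.
  by apply: contrapT => h; apply: nvs => k km; apply/negPn/negP => sk; apply: h; exists k.
by rewrite (bigD1_seq k) ?mem_index_iota ?iota_uniq//= (negbTE sk) mul0r.
Qed.

Lemma pA_qstep (R : realType) (delta : R) s k : (0 < k)%N -> valid false s k ->
  pA delta s k = if (1 <= s k <= k + false)%N then qstep false delta s k else 0.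
Proof.
move=> k0 vs; rewrite addn0 /pA; case: ifP => // h.
rewrite /qstep /rate /BI_rate /Lam/= mul0r addr0 (deg_kap _ k0 vs) h.
by [].
Qed.

Lemma pB_qstep (R : realType) (delta : R) s k : (0 < k)%N -> valid true s k ->
  pB delta s k = if (1 <= s k <= k + true)%N then qstep true delta s k else 0.
Proof.
move=> k0 vs; rewrite /pB /qstep /rate /BI_rate /Lam/= mul1r addrA.
case: ifP => h; first by rewrite ifT; [rewrite (deg_kap _ k0 vs) h|lia].
case: eqP => [->|sk]; last by rewrite ifF//; lia.
rewrite ifT; last by lia.
(* Self loop: BI_(k+1) has not jumped yet, so its rate is 1 + delta. *)
rewrite (kap0 vs) ?addn1// addn0 /BI_start; case: eqP => //; lia.
Qed.

Section Times.
Variables (R : realType) (e : nat -> nat -> R) (s : nat -> nat).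
Hypothesis e0 : forall i k, (0 < i)%N -> (0 < k)%N -> 0 < e i k.

Lemma TA_clock : (forall n, valid false s n) ->
  (forall m, follows false (fun x => e x.1 x.2) s (fun=> 0) m) ->
  forall n, (0 < n)%N -> TA (jump_time e) n = clock false (fun x => e x.1 x.2) s n.-1.
Proof.
move=> vs fs n n0; have [_ h] := timesP e0 vs fs n.-1.
by rewrite /TA TAs_times h ?subn0// addn0.
Qed.

Lemma TB_clock : (forall n, valid true s n) ->
  (forall m, follows true (fun x => e x.1 x.2) s (fun=> 0) m) ->
  forall n, TB (jump_time e) n = clock true (fun x => e x.1 x.2) s n.-1.
Proof.
move=> vs fs n; have [_ h] := timesP e0 vs fs n.-1.
by rewrite /TB TBs_times h ?subn1//; lia.
Qed.

End Times.

Theorem mainTheorem5 (R : realType) (delta : R) (hdelta : 0 <= delta)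
  (* Model A: choice process XA on (OmA, PA) *)
  (dA : measure_display) (OmA : measurableType dA) (PA : probability OmA R)
  (XA : nat -> OmA -> nat)
  (XA_meas : forall k j, measurable [set w | XA k w = j])
  (XA_law : forall (m : nat) (s : nat -> nat),
     PA [set w | forall k, (1 <= k <= m)%N -> XA k w = s k] =
     (\prod_(1 <= k < m.+1) pA delta s k)%:E)
  (* Model B: choice process XB on (OmB, PB) *)
  (dB : measure_display) (OmB : measurableType dB) (PB : probability OmB R)
  (XB : nat -> OmB -> nat)
  (XB_meas : forall k j, measurable [set w | XB k w = j])
  (XB_law : forall (m : nat) (s : nat -> nat),
     PB [set w | forall k, (1 <= k <= m)%N -> XB k w = s k] =
     (\prod_(1 <= k < m.+1) pB delta s k)%:E)
  (* independent B.I. processes on (Om, P), given by their holding times *)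
  (d : measure_display) (Om : measurableType d) (P : probability Om R)
  (E : nat -> nat -> Om -> R)
  (E_meas : forall i k, measurable_fun setT (E i k))
  (E_indep : mutually_independent P (fun ik : nat * nat => (1 <= ik.1)%N /\ (1 <= ik.2)%N)
               (fun ik => E ik.1 ik.2))
  (E_exp : forall i k, (1 <= i)%N -> (1 <= k)%N ->
             exp_distributed P (BI_rate delta i k) (E i k)) :
  let tau w := jump_time (fun i k => E i k w) in
  forall F : (set (\bar R) -> \bar R) -> R, bounded_vague_continuous F ->
    ((\int[PA]_w (F (ptm (degree_points delta (XA^~ w) n)))%:E)%E @[n --> \oo] -->
       (\int[P]_w (F (ptm (limit_points delta (tau w) (TA (tau w)) (WA delta (tau w)))))%:E)%E)
    /\
    ((\int[PB]_w (F (ptm (degree_points delta (XB^~ w) n)))%:E)%E @[n --> \oo] -->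
       (\int[P]_w (F (ptm (limit_points delta (tau w) (fun i => TB (tau w) i.-1)
                                           (WB delta (tau w)))))%:E)%E).
Proof.
move=> tau F bF; split.
- apply: (@degree_law_cvg _ _ _ P delta false E hdelta E_meas E_indep E_exp
    (@TA R) (@TA R) _ _ _ _ PA XA F XA_meas _ bF).
  + exact: TA_clock.
  + by move=> e s e0 vs fs i i0; rewrite (TA_clock e0 vs fs i0) /birth_time subn0.
  + by move=> s m; rewrite XA_law (eq_prod_step _ (pA_qstep delta (s := s))).
- apply: (@degree_law_cvg _ _ _ P delta true E hdelta E_meas E_indep E_exp
    (@TB R) (fun t i => TB t i.-1) _ _ _ _ PB XB F XB_meas _ bF).
  + by move=> e s e0 vs fs n _; exact: TB_clock.
  + by move=> e s e0 vs fs i i0; rewrite (TB_clock e0 vs fs) /birth_time subn1.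
  + by move=> s m; rewrite XB_law (eq_prod_step _ (pB_qstep delta (s := s))).
Qed.
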